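(* Let $d\ge 1$ be an integer and let $p,r\in[1,\infty)$ satisfy $dr=p$. Then the projective tensor product $L_{p,\pi}(\mu^d)$ of $d$ copies of $L_p(\mu)$ is contractively embedded into $L_p(\mu^d)$ as a dense subspace, the embedding being given by the linear map sending an elementary tensor $f_1\otimes\cdots\otimes f_d$ to the function $(x_1,\dots,x_d)\mapsto f_1(x_1)\cdots f_d(x_d)$. Moreover, the linear map $D_d$ defined on elementary tensors $f_1\otimes\cdots\otimes f_d$ by $$D_d(f_1\otimes\cdots\otimes f_d)(x)=f_1(x)\cdots f_d(x),\qquad x\in X,$$ is a norm $1$ linear map from $L_{p,\pi}(\mu^d)\subset L_p(\mu^d)$ to $L_r(\mu)$.
   Context: $(X,\mathcal F,\mu)$ is a standard (Lebesgue, in the sense of Rokhlin) probability space; $L_p(\mu)$ is the usual space of complex-valued functions with norm $|\cdot|_p$, and $L_p(\mu^d)=L_p(X^d,\mathcal F^{\otimes d},\mu^d)$. The projective tensor product of Banach spaces $B_1,\dots,B_d$ is the completion of the algebraic tensor product $B_1\otimes\cdots\otimes B_d$ with respect to the projective norm, i.e. the supremum of all cross norms (norms giving every elementary tensor $f_1\otimes\cdots\otimes f_d$ the value $\prod_i|f_i|_{B_i}$). $L_{p,\pi}(\mu^d)$ denotes the projective tensor product of $d$ copies of $L_p(\mu)$, with its projective norm. *)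

(* Defs.v *)
From HB Require Import structures.
From mathcomp Require Import all_boot all_order all_algebra.
From mathcomp Require Import lra.
From mathcomp Require Import generic_quotient ring_quotient complex freeg.
From mathcomp Require Import all_classical all_reals all_analysis.
From mathcomp Require Import measurable_realfun.
Set Implicit Arguments.
Unset Strict Implicit.
Unset Printing Implicit Defensive.
Import Order.TTheory GRing.Theory Num.Theory.
Import numFieldNormedType.Exports.
Import Quotient Normc.

Local Open Scope classical_set_scope.
Local Open Scope ring_scope.
Local Open Scope quotient_scope.

Section LmodQuotient.
Context {K : pzRingType} {V : lmodType K} (S : zmodClosed V).
Hypothesis SZ : GRing.scaler_closed S.

Definition lmod_quot of GRing.scaler_closed S : Type := {quot S}.

Local Notation Q := (lmod_quot SZ).

HB.instance Definition _ := Choice.on Q.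
HB.instance Definition _ : EqQuotient V (Quotient.equiv S) Q :=
  EqQuotient.on Q.
HB.instance Definition _ := GRing.Zmodule.on Q.

Lemma lmod_quot_eqP (x y : V) :
  reflect (\pi_Q x = \pi_Q y) (x - y \in S).
Proof. by rewrite -[x - y \in S]/(Quotient.equiv S x y) -eqmodE; exact: eqP. Qed.

Lemma pi_lmod_quotD : {morph \pi_Q : x y / x + y}.
Proof. by move=> x y; exact: (@pi_addr _ _ _ _ _ {quot S}). Qed.

Let scaleq (a : K) (x : Q) : Q := \pi_Q (a *: repr x).

Let pi_scaleq a (x : V) : scaleq a (\pi_Q x) = \pi_Q (a *: x).
Proof.
apply/lmod_quot_eqP; rewrite -scalerBr SZ//.
by apply/lmod_quot_eqP; rewrite reprK.
Qed.

Let scaleqA a b x : scaleq a (scaleq b x) = scaleq (a * b) x.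
Proof. by rewrite -[x]reprK (pi_scaleq b) (pi_scaleq a) pi_scaleq scalerA. Qed.

Let scale1q : left_id 1 scaleq.
Proof. by move=> x; rewrite -[x]reprK pi_scaleq scale1r. Qed.

Let scaleqDr : right_distributive scaleq +%R.
Proof.
by move=> a x y; rewrite -[x]reprK -[y]reprK -pi_lmod_quotD !pi_scaleq
  scalerDr pi_lmod_quotD.
Qed.

Let scaleqDl x : {morph scaleq^~ x : a b / a + b}.
Proof.
move=> a b; rewrite -[x]reprK !pi_scaleq scalerDl. exact: pi_lmod_quotD.
Qed.

HB.instance Definition _ := GRing.Zmodule_isLmodule.Build K Q
  scaleqA scale1q scaleqDr scaleqDl.

Lemma pi_lmod_quotZ a (x : V) : \pi_Q (a *: x) = a *: \pi_Q x.
Proof. by rewrite -pi_scaleq. Qed.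

Definition lmod_proj (x : V) : Q := \pi_Q x.

Let lmod_proj_linear : linear lmod_proj.
Proof. by move=> a x y; rewrite /lmod_proj pi_lmod_quotD pi_lmod_quotZ. Qed.

HB.instance Definition _ := GRing.isLinear.Build K V Q *:%R lmod_proj
  lmod_proj_linear.

End LmodQuotient.
Arguments lmod_proj {K V S} SZ.

Section Seminorm.
Context {R : realType}.

Record seminorm (V : lmodType R[i]) := Seminorm {
  seminorm_fun :> V -> R ;
  seminormD : forall x y, seminorm_fun (x + y) <= seminorm_fun x + seminorm_fun y ;
  seminormZ : forall a x, seminorm_fun (a *: x) = normc a * seminorm_fun x }.

Section theory.
Context {V : lmodType R[i]} (N : seminorm V).
Implicit Types x y : V.

Lemma seminorm0 : N 0 = 0.
Proof. by rewrite -(scale0r 0) seminormZ normc0 mul0r. Qed.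

Lemma seminormN x : N (- x) = N x.
Proof.
rewrite -scaleN1r seminormZ (_ : normc _ = 1) ?mul1r//.
by rewrite (_ : -1 = (-1) +i* (- 0))%C// /normc oppr0 expr0n addr0 sqrrN
  expr1n sqrtr1.
Qed.

Lemma seminorm_ge0 x : 0 <= N x.
Proof.
have := seminormD N x (- x).
by rewrite subrr seminorm0 seminormN -mulr2n pmulrn_lge0.
Qed.

Lemma seminorm_distrC x y : N (x - y) = N (y - x).
Proof. by rewrite -seminormN opprB. Qed.

Lemma seminorm_distD y x z : N (x - z) <= N (x - y) + N (y - z).
Proof. by rewrite -[x in leLHS](subrK y) -addrA seminormD. Qed.

Lemma seminorm_lipschitz x y : `|N x - N y| <= N (x - y).
Proof.
rewrite ler_norml.
have := seminormD N (x - y) y; rewrite subrK => h1.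
have := seminormD N (y - x) x; rewrite subrK seminorm_distrC => h2.
by apply/andP; split; lra.
Qed.

Definition seminorm_ker : {pred V} := [pred x | N x == 0].

Let seminorm_ker_zmod : zmod_closed seminorm_ker.
Proof.
split; first by rewrite inE seminorm0.
move=> x y; rewrite !inE => /eqP Nx /eqP Ny.
rewrite eq_le seminorm_ge0 andbT (le_trans (seminormD _ _ _))//.
by rewrite seminormN Nx Ny addr0.
Qed.

HB.instance Definition _ :=
  GRing.isZmodClosed.Build V seminorm_ker seminorm_ker_zmod.

Lemma seminorm_kerZ : GRing.scaler_closed seminorm_ker.
Proof. by move=> a x; rewrite !inE seminormZ => /eqP ->; rewrite mulr0. Qed.

(* The normed space obtained from V by identifying the vectors x and y such
   that N (x - y) = 0. *)
Definition normed_quot : Type := lmod_quot seminorm_kerZ.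

HB.instance Definition _ := GRing.Lmodule.on normed_quot.
HB.instance Definition _ : EqQuotient V (Quotient.equiv seminorm_ker) normed_quot
  := EqQuotient.on normed_quot.

Definition normed_proj (x : V) : normed_quot := lmod_proj seminorm_kerZ x.

Let normed_proj_linear : linear normed_proj.
Proof. exact: (linearP (lmod_proj seminorm_kerZ)). Qed.

HB.instance Definition _ := GRing.isLinear.Build R[i] V normed_quot *:%R
  normed_proj normed_proj_linear.

Definition quot_norm (q : normed_quot) : R[i] := (N (repr q))%:C%C.

Lemma quot_norm_proj x : quot_norm (normed_proj x) = (N x)%:C%C.
Proof.
have /lmod_quot_eqP : \pi_(lmod_quot seminorm_kerZ) (repr (normed_proj x)) =
  \pi_(lmod_quot seminorm_kerZ) x by rewrite reprK.
rewrite inE => /eqP Nx; congr (_%:C%C); apply/eqP; rewrite -subr_eq0 -normr_eq0.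
by rewrite eq_le normr_ge0 andbT -Nx seminorm_lipschitz.
Qed.

Lemma normed_proj_repr (q : normed_quot) : normed_proj (repr q) = q.
Proof. exact: reprK. Qed.

Let quot_normD p q : quot_norm (p + q) <= quot_norm p + quot_norm q.
Proof.
rewrite -[p]normed_proj_repr -[q]normed_proj_repr -linearD !quot_norm_proj.
by rewrite -rmorphD lecR seminormD.
Qed.

Let quot_normZ (a : R[i]) q : quot_norm (a *: q) = `|a| * quot_norm q.
Proof.
by rewrite -[q]normed_proj_repr -linearZ !quot_norm_proj seminormZ rmorphM.
Qed.

Let quot_norm0 q : quot_norm q = 0 -> q = 0.
Proof.
rewrite -[q]normed_proj_repr quot_norm_proj => -[Nq].
rewrite -(linear0 normed_proj); apply/lmod_quot_eqP.
by rewrite subr0 inE Nq.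
Qed.

HB.instance Definition _ := Lmodule_isNormed.Build R[i] normed_quot
  quot_normD quot_normZ quot_norm0.

Lemma normed_projE x : `|normed_proj x| = (N x)%:C%C.
Proof. exact: quot_norm_proj. Qed.

End theory.
End Seminorm.
Arguments seminorm {R} V.
Arguments normed_quot {R V} N.
Arguments normed_proj {R V} N x.

(* Completion of a seminormed space (V, N): Cauchy sequences, modulo the ones
   whose seminorm tends to 0. *)
Section Completion.
Context {R : realType} {V : lmodType R[i]} (N : seminorm V).
Implicit Types u v : nat -> V.

Definition is_cauchy u := forall e : R, 0 < e ->
  exists n0 : nat, forall m n, (n0 <= m)%N -> (n0 <= n)%N -> N (u m - u n) < e.

Definition cauchy_pred : {pred nat -> V} := [pred u | `[< is_cauchy u >]].

Lemma cauchy_predP u : reflect (is_cauchy u) (u \in cauchy_pred).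
Proof. exact: asboolP. Qed.

Let cauchy_pred_submod : submod_closed cauchy_pred.
Proof.
split=> [|a u v].
  by apply/cauchy_predP => e e0; exists 0%N => m n _ _; rewrite (subr0 (0 : V)) seminorm0.
move=> /cauchy_predP cu /cauchy_predP cv; apply/cauchy_predP => e e0.
have a0 : 0 < normc a + 1 by rewrite ltr_wpDl// /normc; case: a => *; exact: sqrtr_ge0.
have [n1 h1] := cu (e / 2 / (normc a + 1)) ltac:(by rewrite !divr_gt0).
have [n2 h2] := cv (e / 2) ltac:(by rewrite divr_gt0).
exists (maxn n1 n2) => m n; rewrite !geq_max => /andP[m1 m2] /andP[k1 k2].
rewrite [X in N X](_ : _ = a *: (u m - u n) + (v m - v n)); last first.
  by rewrite scalerBr opprD addrACA.
apply: (le_lt_trans (seminormD _ _ _)); rewrite seminormZ [ltRHS]splitr.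
apply: ler_ltD; last exact: h2.
rewrite (le_trans (y := (normc a + 1) * N (u m - u n)))//.
  by rewrite ler_wpM2r ?seminorm_ge0// lerDl.
by rewrite mulrC -ler_pdivlMr// ltW// h1.
Qed.

HB.instance Definition _ :=
  GRing.isSubmodClosed.Build R[i] (nat -> V) cauchy_pred cauchy_pred_submod.

Record cauchy_seq : Type := CauchySeq {
  cauchy_seq_val :> nat -> V ;
  cauchy_seqP : cauchy_seq_val \in cauchy_pred }.

HB.instance Definition _ := [isSub for cauchy_seq_val].
HB.instance Definition _ := [Choice of cauchy_seq by <:].
HB.instance Definition _ := [SubChoice_isSubLmodule of cauchy_seq by <:].

Lemma cauchy_seq_cauchy (u : cauchy_seq) : is_cauchy u.
Proof. exact/cauchy_predP/cauchy_seqP. Qed.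

Lemma is_cvg_cauchy_seq (u : cauchy_seq) : cvgn (fun n => N (u n)).
Proof.
apply/cauchy_cvgP/cauchy_exP => e e0.
have [n0 h] := cauchy_seq_cauchy u e0.
exists (N (u n0)); exists n0 => //= n n0n.
by rewrite /ball/= (le_lt_trans (seminorm_lipschitz _ _ _))// h.
Qed.

Definition lim_fun (u : cauchy_seq) : R := limn (fun n => N (u n)).

Let lim_funD (u v : cauchy_seq) : lim_fun (u + v) <= lim_fun u + lim_fun v.
Proof.
rewrite /lim_fun -limD; [|exact: is_cvg_cauchy_seq..].
apply: ler_lim; [exact: is_cvg_cauchy_seq|by apply: is_cvgD; exact: is_cvg_cauchy_seq|].
by apply: nearW => n; exact: seminormD.
Qed.

Let lim_funZ a (u : cauchy_seq) : lim_fun (a *: u) = normc a * lim_fun u.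
Proof.
rewrite /lim_fun; apply: cvg_lim => //.
under eq_fun do rewrite seminormZ.
by apply: cvgM; [exact: cvg_cst|exact: is_cvg_cauchy_seq].
Qed.

Definition lim_seminorm : seminorm cauchy_seq := Seminorm lim_funD lim_funZ.

Definition completion : Type := normed_quot lim_seminorm.

HB.instance Definition _ := NormedModule.on completion.

Let cauchy_cst (x : V) : (fun=> x) \in cauchy_pred.
Proof.
by apply/cauchy_predP => e e0; exists 0%N => m n _ _; rewrite subrr seminorm0.
Qed.

Definition to_completion (x : V) : completion :=
  normed_proj lim_seminorm (CauchySeq (cauchy_cst x)).

Let to_completion_linear : linear to_completion.
Proof.
move=> a x y; rewrite /to_completion -linearP; congr normed_proj.
exact/val_inj.
Qed.

HB.instance Definition _ := GRing.isLinear.Build R[i] V completion *:%R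
  to_completion to_completion_linear.

Lemma norm_to_completion x : `|to_completion x| = (N x)%:C%C.
Proof.
rewrite normed_projE; congr (_%:C%C).
by apply: cvg_lim => //; exact: (@cvg_cst R (N x)).
Qed.

Lemma to_completion_approx (q : completion) (e : R) : 0 < e ->
  exists x, `|q - to_completion x| < e%:C%C.
Proof.
move=> e0; rewrite -[q]normed_proj_repr; move: (repr q) => u.
have e20 : 0 < e / 2 by rewrite divr_gt0.
have [n0 h] := cauchy_seq_cauchy u e20.
exists (u n0); rewrite /to_completion -linearB normed_projE ltcR.
apply: (@le_lt_trans _ _ (e / 2)); last by rewrite ltr_pdivrMr// ltr_pMr// ltr1n.
rewrite /= /lim_fun; apply: limr_le; first exact: is_cvg_cauchy_seq.
by exists n0 => //= n n0n; rewrite ltW// h.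
Qed.

Let completion_complete (F : set_system completion) :
  ProperFilter F -> cauchy F -> cvg F.
Proof.
move=> FF Fc.
pose e n : R := n.+1%:R^-1.
have e0 n : 0 < e n by rewrite invr_gt0.
have ec0 n : 0 < (e n)%:C%C :> R[i] by rewrite ltcR.
have cF (n : nat) : exists x : V,
    F [set q | `|q - to_completion x| < (e n + e n)%:C%C].
  have [q Fq] := (cauchyP F).1 Fc _ (ec0 n).
  have [x qx] := to_completion_approx q (e0 n).
  exists x; apply: filterS Fq => p /= qp.
  rewrite -(subrK q p) -addrA (le_lt_trans (ler_normD _ _))// rmorphD ltrD//.
  by rewrite distrC.
have [x Fx] := choice cF.
have xmn m n : N (x m - x n) < e m + e m + (e n + e n).
  have /filter_ex[q [/= qm qn]] : F
      ([set q | `|q - to_completion (x m)| < (e m + e m)%:C%C] `&`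
       [set q | `|q - to_completion (x n)| < (e n + e n)%:C%C]).
    by apply: filterI.
  rewrite -ltcR -norm_to_completion linearB /= -(subrK q (to_completion (x m))).
  rewrite -addrA (le_lt_trans (ler_normD _ _))// rmorphD ltrD//.
  by rewrite distrC.
have eN (r : R) : 0 < r -> exists n0, forall n, (n0 <= n)%N -> e n < r.
  move=> r0; have [n0 _ h] := near_infty_natSinv_lt (PosNum r0).
  by exists n0 => n n0n; apply: h.
have cx : is_cauchy x.
  move=> r r0; have [n0 h] := eN (r / 4) ltac:(by rewrite divr_gt0).
  exists n0 => m n m0 nn0; apply: (lt_trans (xmn m n)).
  by have := h m m0; have := h n nn0; lra.
pose q0 : completion :=
  normed_proj lim_seminorm (CauchySeq (introT (cauchy_predP x) cx)).
have q0x n : `|q0 - to_completion (x n)| <= (3 * e n)%:C%C.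
  rewrite /to_completion -linearB normed_projE lecR /= /lim_fun.
  apply: limr_le; first exact: is_cvg_cauchy_seq.
  have [n0 h] := eN (e n / 2) ltac:(by rewrite divr_gt0).
  exists n0 => //= m n0m; rewrite ltW// (lt_le_trans (xmn _ _))//.
  by have := h m n0m; lra.
apply/cvg_ex; exists q0; apply/cvg_ballP => r r0.
have rR : r = (complex.Re r)%:C%C by rewrite RRe_real// gtr0_real.
have {}r0 : 0 < complex.Re r by move: r0; rewrite rR ltcR.
have [n h] := eN (complex.Re r / 5) ltac:(by rewrite divr_gt0).
apply: filterS (Fx n) => p /= pn; rewrite -ball_normE /ball_ /=.
rewrite -(subrK (to_completion (x n)) q0) -addrA.
rewrite (le_lt_trans (ler_normD _ _))// rR.
rewrite (@lt_le_trans _ _ ((3 * e n)%:C%C + (e n + e n)%:C%C))//.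
  by rewrite ler_ltD ?q0x// distrC.
by rewrite -rmorphD lecR; have := h n (leqnn n); lra.
Qed.

HB.instance Definition _ :=
  Uniform_isComplete.Build completion completion_complete.

End Completion.
Arguments completion {R V} N.
Arguments to_completion {R V} N x.

(* The norm of a normed space over R[i] takes its values in the nonnegative
   reals of R[i]; rnorm is the same norm as an element of R. *)
Definition rnorm {R : realType} {V : normedModType R[i]} (x : V) : R := complex.Re `|x|.

Definition is_norm {R : realType} {V : lmodType R[i]} (N : V -> R) :=
  [/\ forall x y, N (x + y) <= N x + N y,
      forall a x, N (a *: x) = normc a * N x &
      forall x, N x = 0 -> x = 0].

Section TensorProduct.
Context {R : realType} {d : nat} (B : 'I_d -> normedModType R[i]).

Local Notation free := {freeg (forall i, B i) / R[i]}.

(* The subspace of the free vector space on B_1 x ... x B_d whose quotient is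
   the algebraic tensor product. *)
Inductive tensor_rel : free -> Prop :=
| tensor_rel0 : tensor_rel 0
| tensor_rel_lin a u v :
    tensor_rel u -> tensor_rel v -> tensor_rel (a *: u + v)
| tensor_rel_multilin (f : forall i, B i) i a (x y : B i) :
    tensor_rel (<< dfwith f i (a *: x + y) >> - a *: << dfwith f i x >>
                - << dfwith f i y >>).

Definition tensor_pred : {pred free} := [pred u | `[< tensor_rel u >]].

Lemma tensor_predP u : reflect (tensor_rel u) (u \in tensor_pred).
Proof. exact: asboolP. Qed.

Let tensor_pred_submod : submod_closed tensor_pred.
Proof.
split=> [|a u v /tensor_predP ? /tensor_predP ?]; apply/tensor_predP.
  exact: tensor_rel0.
exact: tensor_rel_lin.
Qed.

HB.instance Definition _ :=
  GRing.isZmodClosed.Build free tensor_pred (GRing.submod_closedB tensor_pred_submod).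

Lemma tensor_predZ : GRing.scaler_closed tensor_pred.
Proof. exact: (GRing.subsemimod_closedZ tensor_pred_submod). Qed.

Definition tensor : Type := lmod_quot tensor_predZ.

HB.instance Definition _ := GRing.Lmodule.on tensor.
HB.instance Definition _ : EqQuotient free (Quotient.equiv tensor_pred) tensor :=
  EqQuotient.on tensor.

Definition elem_tensor (f : forall i, B i) : tensor :=
  lmod_proj tensor_predZ << f >>.

Lemma elem_tensor_multilinear f i a (x y : B i) :
  elem_tensor (dfwith f i (a *: x + y)) =
  a *: elem_tensor (dfwith f i x) + elem_tensor (dfwith f i y).
Proof.
rewrite /elem_tensor -linearP; apply/lmod_quot_eqP/tensor_predP.
by rewrite opprD addrA; exact: tensor_rel_multilin.
Qed.

Lemma tensor_sumE (u : tensor) :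
  u = \sum_(f <- dom (repr u)) coeff f (repr u) *: elem_tensor f.
Proof.
rewrite -[LHS]reprK -[repr u in LHS]freeg_sumE.
rewrite -[LHS]/(lmod_proj tensor_predZ _) linear_sum.
apply: eq_bigr => f _ /=; rewrite -linearZ; congr lmod_proj.
by apply/eqP/freeg_eqP => g; rewrite coeffZ !coeffU mulrA mulr1.
Qed.

Definition cross_norm (N : tensor -> R) :=
  is_norm N /\ forall f, N (elem_tensor f) = \prod_(i < d) rnorm (f i).

(* sup is taken in R: the set is bounded (proj_norm_has_ubound). *)
Definition proj_norm_fun (u : tensor) : R := sup [set N u | N in cross_norm].

Lemma proj_norm_has_ubound u : has_ubound [set N u | N in cross_norm].
Proof.
exists (\sum_(f <- dom (repr u))
  normc (coeff f (repr u)) * \prod_(i < d) rnorm (f i)).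
move=> _ [N [[ND NZ _] Ne] <-]; rewrite [in leLHS](tensor_sumE u).
elim: (dom _) => [|f s IH].
  by rewrite !big_nil -(scale0r 0) NZ normc0 mul0r.
by rewrite !big_cons (le_trans (ND _ _))// NZ Ne lerD.
Qed.

Lemma cross_norm_le N u : cross_norm N -> N u <= proj_norm_fun u.
Proof.
by move=> cN; apply: ub_le_sup; [exact: proj_norm_has_ubound|exists N].
Qed.

Lemma proj_norm_le u M : 0 <= M -> (forall N, cross_norm N -> N u <= M) ->
  proj_norm_fun u <= M.
Proof.
move=> M0 h; rewrite /proj_norm_fun; set A := [set _ | _ in _].
have [->|A0] := eqVneq A set0; first by rewrite sup0.
by apply: ge_sup; [exact/set0P|move=> _ [N cN <-]; exact: h].
Qed.

Lemma proj_norm_ge0 u : 0 <= proj_norm_fun u.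
Proof.
rewrite /proj_norm_fun; set A := [set _ | _ in _].
have [->|/set0P[_ [N cN _]]] := eqVneq A set0; first by rewrite sup0.
have [[ND NZ N0] _] := cN.
apply: le_trans (cross_norm_le u cN).
by have := @seminorm_ge0 _ _ (Seminorm ND NZ) u.
Qed.

Let proj_normD u v : proj_norm_fun (u + v) <= proj_norm_fun u + proj_norm_fun v.
Proof.
apply: proj_norm_le => [|N cN]; first by rewrite addr_ge0 ?proj_norm_ge0.
by have [[ND _ _] _] := cN; rewrite (le_trans (ND _ _))// lerD// cross_norm_le.
Qed.

Let proj_normZ_le a u : proj_norm_fun (a *: u) <= normc a * proj_norm_fun u.
Proof.
have a0 : 0 <= normc a by case: a => ? ?; exact: sqrtr_ge0.
apply: proj_norm_le => [|N cN]; first by rewrite mulr_ge0// proj_norm_ge0.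
by have [[_ -> _] _] := cN; rewrite ler_wpM2l// cross_norm_le.
Qed.

Let proj_normZ a u : proj_norm_fun (a *: u) = normc a * proj_norm_fun u.
Proof.
apply/eqP; rewrite eq_le proj_normZ_le/=.
have [->|a0] := eqVneq a 0; first by rewrite normc0 mul0r proj_norm_ge0.
have n0 : 0 < normc a.
  rewrite lt_neqAle eq_sym; apply/andP; split; last first.
    by case: (a) => ? ?; exact: sqrtr_ge0.
  by apply: contra a0 => /eqP/eq0_normc ->.
rewrite mulrC -ler_pdivlMr// mulrC -normcV.
by rewrite -[in leLHS](scale1r u) -(mulVf a0) -scalerA.
Qed.

Definition proj_norm : seminorm tensor := Seminorm proj_normD proj_normZ.

(* completion performs both the identification of tensors at distance 0 (vacuous
   here, the projective norm being a norm) and the completion. *)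
Definition proj_tensor : Type := completion proj_norm.

HB.instance Definition _ := CompleteNormedModule.on proj_tensor.

Definition elem_proj_tensor (f : forall i, B i) : proj_tensor :=
  to_completion proj_norm (elem_tensor f).

End TensorProduct.
Arguments tensor {R d} B.
Arguments proj_tensor {R d} B.

Section ComplexLp.
Context {disp} {T : measurableType disp} {R : realType}.
Variables (mu : {measure set T -> \bar R}) (p : R) (p1 : 1 <= p).
Implicit Types f g : T -> R[i].

Definition cmeasurable f :=
  measurable_fun setT (fun x => complex.Re (f x)) /\
  measurable_fun setT (fun x => complex.Im (f x)).

Definition cLnorm f : \bar R := Lnorm mu p%:E (fun x => (normc (f x))%:E).

Let p0 : 0 < p. Proof. exact: lt_le_trans p1. Qed.

Lemma measurable_normc f : cmeasurable f -> measurable_fun setT (@normc R \o f).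
Proof.
move=> [mr mi].
rewrite (_ : _ \o _ = fun x =>
  Num.sqrt (complex.Re (f x) ^+ 2 + complex.Im (f x) ^+ 2)); last first.
  by apply/funext => x /=; case: (f x).
apply: measurableT_comp.
  by apply: continuous_measurable_fun; exact: sqrt_continuous.
by apply: measurable_funD; exact: measurable_funX.
Qed.

Lemma normc_ge0 (z : R[i]) : 0 <= normc z.
Proof. by case: z => *; exact: sqrtr_ge0. Qed.

Lemma cmeasurableD f g : cmeasurable f -> cmeasurable g -> cmeasurable (f + g).
Proof.
move=> [fr fi] [gr gi]; split.
- rewrite (_ : (fun=> _) = (fun x => complex.Re (f x)) \+
    (fun x => complex.Re (g x))); first exact: measurable_funD.
  by apply/funext => x; rewrite -[(f + g) x]/(f x + g x) /=; case: (f x) (g x) => [? ?] [].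
- rewrite (_ : (fun=> _) = (fun x => complex.Im (f x)) \+
    (fun x => complex.Im (g x))); first exact: measurable_funD.
  by apply/funext => x; rewrite -[(f + g) x]/(f x + g x) /=; case: (f x) (g x) => [? ?] [].
Qed.

Lemma cmeasurableZ a f : cmeasurable f -> cmeasurable (a *: f).
Proof.
case: a => a b [fr fi]; split.
- rewrite (_ : (fun=> _) = fun x =>
    a * complex.Re (f x) - b * complex.Im (f x)).
    by apply: measurable_funB; exact: measurable_funM.
  by apply/funext => x; rewrite -[(_ *: f) x]/(_ * f x); case: (f x).
- rewrite (_ : (fun=> _) = fun x =>
    a * complex.Im (f x) + b * complex.Re (f x)).
    by apply: measurable_funD; exact: measurable_funM.
  by apply/funext => x; rewrite -[(_ *: f) x]/(_ * f x); case: (f x).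
Qed.

Lemma cLnormD f g : cmeasurable f -> cmeasurable g ->
  (cLnorm (f + g)%R <= cLnorm f + cLnorm g)%E.
Proof.
move=> mf mg.
have mnf := measurable_normc mf; have mng := measurable_normc mg.
have mnfg := measurable_normc (cmeasurableD mf mg).
apply: le_trans (@eminkowski _ _ _ mu (@normc R \o f) (@normc R \o g) p%:E mnf mng _).
  rewrite /cLnorm unlock; apply: gt0_ler_poweR.
  - by rewrite invr_ge0 ltW.
  - by rewrite in_itv/= leey andbT integral_ge0// => x _; exact: poweR_ge0.
  - by rewrite in_itv/= leey andbT integral_ge0// => x _; exact: poweR_ge0.
  - apply: ge0_le_integral => //.
    + by move=> x _; exact: poweR_ge0.
    + apply/measurable_EFinP.
      apply: (@measurableT_comp _ _ _ _ _ _ (fun x : R => x `^ p)) => //.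
      exact: measurableT_comp mnfg.
    + apply/measurable_EFinP.
      apply: (@measurableT_comp _ _ _ _ _ _ (fun x : R => x `^ p)) => //.
      by apply: measurableT_comp => //; exact: measurable_funD.
    + move=> x _; rewrite lee_fin ge0_ler_powR ?nnegrE ?(ltW p0)//.
      rewrite !ger0_norm ?addr_ge0 ?normc_ge0//. exact: (@le_normcD R (f x) (g x)).
by rewrite lee_fin.
Qed.

Lemma cLnormZ a f : cmeasurable f -> cLnorm (a *: f) = ((normc a)%:E * cLnorm f)%E.
Proof.
move=> mf; rewrite /cLnorm unlock.
transitivity ((\int[mu]_x ((normc a `^ p)%:E * (normc (f x) `^ p)%:E)) `^ p^-1)%E.
  congr poweR; apply: eq_integral => x _; rewrite -EFinM -powRM ?normc_ge0//.
  by rewrite -normcM /= ger0_norm ?normc_ge0.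
rewrite ge0_integralZl//; last 3 first.
- apply/measurable_EFinP.
  apply: (@measurableT_comp _ _ _ _ _ _ (fun x : R => x `^ p)) => //.
  exact: measurable_normc.
- by move=> x _; rewrite lee_fin powR_ge0.
- by rewrite lee_fin powR_ge0.
rewrite poweRM ?lee_fin ?powR_ge0//; last first.
  by apply: integral_ge0 => x _; rewrite lee_fin powR_ge0.
congr (_ * _)%E.
  by rewrite poweR_EFin -powRrM mulfV ?gt_eqF// powRr1 ?normc_ge0.
congr poweR; apply: eq_integral => x _ /=.
by rewrite ger0_norm ?normc_ge0.
Qed.

Definition cLfun : {pred T -> R[i]} :=
  [pred f | `[< cmeasurable f /\ (cLnorm f < +oo)%E >]].

Lemma cLfunP f : reflect (cmeasurable f /\ (cLnorm f < +oo)%E) (f \in cLfun).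
Proof. exact: asboolP. Qed.

Let cLfun_submod : submod_closed cLfun.
Proof.
split=> [|a f g /cLfunP[mf lf] /cLfunP[mg lg]]; apply/cLfunP; split.
- by split; exact: measurable_cst.
- rewrite /cLnorm (_ : (fun=> _) = cst 0%E) ?Lnorm0//.
    by rewrite eqe gt_eqF.
  by apply/funext => x; congr EFin; exact: (@normc0 R).
- by apply: cmeasurableD => //; exact: cmeasurableZ.
- rewrite (le_lt_trans (cLnormD _ _))//; first exact: cmeasurableZ.
  by rewrite lte_add_pinfty// cLnormZ// lte_mul_pinfty// lee_fin normc_ge0.
Qed.

HB.instance Definition _ :=
  GRing.isSubmodClosed.Build R[i] (T -> R[i]) cLfun cLfun_submod.

Record cLfunType (q1 : 1 <= p) : Type := CLfun {
  cLfun_val :> T -> R[i] ;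
  cLfun_valP : cLfun_val \in cLfun }.

Local Notation LT := (cLfunType p1).

HB.instance Definition _ := [isSub of LT for @cLfun_val p1].
HB.instance Definition _ := [Choice of LT by <:].
HB.instance Definition _ := [SubChoice_isSubLmodule of LT by <:].

Definition cLnorm_fine (f : LT) : R := fine (cLnorm f).

Let cLnorm_fineK (f : LT) : (cLnorm_fine f)%:E = cLnorm f.
Proof.
have /cLfunP[_ lf] := cLfun_valP f.
by rewrite fineK// ge0_fin_numE// Lnorm_ge0.
Qed.

Let cLnorm_fineD (f g : LT) : cLnorm_fine (f + g) <= cLnorm_fine f + cLnorm_fine g.
Proof.
have /cLfunP[mf _] := cLfun_valP f; have /cLfunP[mg _] := cLfun_valP g.
by rewrite -lee_fin EFinD !cLnorm_fineK cLnormD.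
Qed.

Let cLnorm_fineZ a (f : LT) : cLnorm_fine (a *: f) = normc a * cLnorm_fine f.
Proof.
have /cLfunP[mf _] := cLfun_valP f.
by apply: EFin_inj; rewrite EFinM !cLnorm_fineK cLnormZ.
Qed.

Definition Lp_seminorm : seminorm LT := Seminorm cLnorm_fineD cLnorm_fineZ.

Definition Lp : Type := normed_quot Lp_seminorm.

HB.instance Definition _ := NormedModule.on Lp.

(* A representative, determined up to a null set. *)
Definition Lp_fun (f : Lp) : T -> R[i] := repr (f : normed_quot Lp_seminorm).

Definition to_Lp (f : LT) : Lp := normed_proj Lp_seminorm f.

End ComplexLp.

(* The library puts on n.-tuple T the product sigma-algebra, generated by the
   coordinates. *)
Section PowerMeasure.
Context {disp} {T : measurableType disp} {R : realType} (P : probability T R).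

Definition cons_pair n (x : T * n.-tuple T) : n.+1.-tuple T :=
  [tuple of x.1 :: x.2].

Let measurable_cons_pair n : measurable_fun setT (@cons_pair n).
Proof. exact: measurable_cons. Qed.

HB.instance Definition _ n := isMeasurableFun.Build _ _ _ _ (@cons_pair n)
  (@measurable_cons_pair n).

Fixpoint power_measure n : probability (n.-tuple T) R :=
  if n is m.+1 then distribution (P \x power_measure m)%E (@cons_pair m)
  else \d_([tuple] : 0.-tuple T).

Lemma power_measureE n (A : 'I_n -> set T) : (forall i, measurable (A i)) ->
  power_measure n [set x | forall i, A i (tnth x i)] = (\prod_(i < n) P (A i))%E.
Proof.
elim: n A => [A _|n IH A mA] /=.
  by rewrite big_ord0 diracE mem_set// => -[].
rewrite big_ord_recl /= /distribution /pushforward.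
pose A' := fun i : 'I_n => A (fintype.lift ord0 i).
rewrite (_ : _ @^-1` _ = A ord0 `*` [set x | forall i, A' i (tnth x i)]); last first.
  apply/seteqP; split => -[x t] /=.
    move=> h; split => [|i]; first by have := h ord0.
    by have := h (fintype.lift ord0 i); rewrite tnthS.
  move=> [h0 h] i; have [j ->|->//] := unliftP ord0 i.
  by rewrite tnthS; exact: h.
have mB : measurable [set x : n.-tuple T | forall i, A' i (tnth x i)].
  rewrite (_ : [set x | _] =
    \bigcap_(i in [set: 'I_n]) ((fun x : n.-tuple T => tnth x i) @^-1` A' i)).
    apply: fin_bigcap_measurable => // i _.
    by rewrite -[X in measurable X]setTI; apply: measurable_tnth => //; exact: mA.
  by apply/seteqP; split => x /= h i; [move=> _; exact: h|exact: h].
rewrite product_measure1E ?mA//; congr (_ * _)%E.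
by apply: IH => i; exact: mA.
Qed.

End PowerMeasure.

(* Lebesgue spaces in the sense of Rokhlin: complete, and isomorphic mod 0 to the
   disjoint union of an interval `[0, c] with Lebesgue measure (on all the
   Lebesgue-measurable sets) and of countably many atoms.  At is the set of
   atoms; f is the isomorphism mod 0 from the complement of At to `[0, c], defined
   on the conull subset A of that complement, with image the conull subset B
   of `[0, c]. *)
Definition standard_probability {disp} {T : measurableType disp} {R : realType}
    (mu : probability T R) : Prop :=
  measure_is_complete mu /\
  exists (At A : set T) (B : set R) (c : R) (f : T -> R),
    [/\ countable At, forall x, At x -> measurable [set x],
        measurable A, A `&` At = set0 & mu (~` (A `|` At)) = 0%E] /\
    [/\ B `<=` `[0, c],
        (@lebesgue_measure R).-negligible (`[0, c] `\` B),
        set_bij A B f,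
        forall E, E `<=` B ->
          (measurable (A `&` f @^-1` E) <->
           completed_algebra_gen (@lebesgue_measure R) E) &
        forall E, E `<=` B -> completed_algebra_gen (@lebesgue_measure R) E ->
          mu (A `&` f @^-1` E) = completed_lebesgue_measure E].

Definition op_norm {R : realType} {V W : normedModType R[i]} (f : V -> W) : \bar R :=
  ereal_sup [set (rnorm (f x))%:E | x in [set x | rnorm x <= 1]].

(* Main.v *)
(* J is an injection because L_p has the metric approximation property.  For a
   finite measurable partition of X, the conditional expectation E has finite
   rank and norm at most 2, and it tends to the identity as the partition gets
   finer.  So E (x) ... (x) E is bounded by 2^d for the projective norm, tends
   pointwise to the identity, and, having finite rank, is controlled by the norm
   of L_p(mu^d).  Hence a sequence of tensors that is Cauchy for the projective
   norm and tends to 0 in L_p(mu^d) tends to 0 for the projective norm.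

   The projective norm, a supremum over cross norms, dominates every seminorm M
   with M(f_1 (x) ... (x) f_d) <= prod |f_i|, as soon as one cross norm N0
   exists: max(N0, M) is then a cross norm.  For N0 one takes the norm of
   L_p(mu^d), which is a norm on the algebraic tensor product since finitely many
   elements of L_p are fixed by a finite rank operator given by integrals.

   The bound on D_d is Hoelder's inequality, obtained by integrating the
   inequality between arithmetic and geometric means.  Density of the range of J
   follows from Dynkin's theorem applied to the boxes. *)

Require Import Defs.
From HB Require Import structures.
From mathcomp Require Import all_boot all_order all_algebra.
From mathcomp Require Import ring lra finmap.
From mathcomp Require Import generic_quotient ring_quotient complex freeg.
From mathcomp Require Import all_classical all_reals all_analysis.
From mathcomp Require Import measurable_realfun.
Import Order.TTheory GRing.Theory Num.Theory.
Import numFieldNormedType.Exports.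
Import Normc.

Set Implicit Arguments.
Unset Strict Implicit.
Unset Printing Implicit Defensive.

Local Open Scope classical_set_scope.
Local Open Scope ring_scope.

(** * Extension to the completion *)

(** The delicate clause is injectivity: an injective contraction on the algebraic tensor product may
    acquire a kernel when it is extended to the completion. Injectivity is therefore reduced to a
    statement on Cauchy sequences, the third clause of [completion_extend]. The tensor powers of the
    conditional expectations satisfy two different bounds. Against the projective norm the constant
    [2 ^+ d] is independent of the partition; against the norm of L_p(mu^d) the constant depends on
    it. The partition is fixed before the second bound is applied along the sequence, so only the
    first has to be uniform.

    The 2 arises because a complex integral is estimated through its real and imaginary parts
    separately.

    The existence of one cross norm is more than a convenience: a supremum over an empty family is 0
    here, and the projective norm would vanish identically. *)

Section RNorm.
Context {R : realType} {V : normedModType R[i]}.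
Implicit Types x y : V.

Lemma rnormE x : `|x| = (rnorm x)%:C%C.
Proof. by rewrite RRe_real// ger0_real. Qed.

Lemma rnormD x y : rnorm (x + y) <= rnorm x + rnorm y.
Proof. by rewrite -lecR rmorphD /= -!rnormE ler_normD. Qed.

Lemma rnormZ a x : rnorm (a *: x) = Normc.normc a * rnorm x.
Proof.
apply: (@complexI R).
by rewrite -rnormE normrZ rnormE rmorphM.
Qed.

Definition rnorm_seminorm : seminorm V := Seminorm rnormD rnormZ.

Lemma rnorm_eq0 x : rnorm x = 0 -> x = 0.
Proof. by move=> x0; apply/eqP; rewrite -normr_eq0 rnormE x0. Qed.

Lemma rnorm0 : rnorm (0 : V) = 0.
Proof. exact: (seminorm0 rnorm_seminorm). Qed.

Lemma rnorm_ge0 x : 0 <= rnorm x.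
Proof. exact: (seminorm_ge0 rnorm_seminorm). Qed.

Lemma rnorm_distrC x y : rnorm (x - y) = rnorm (y - x).
Proof. exact: (seminorm_distrC rnorm_seminorm). Qed.

End RNorm.
Arguments rnorm_seminorm {R} V.

Definition seq_complete {R : realType} (W : normedModType R[i]) :=
  forall w : nat -> W, is_cauchy (rnorm_seminorm W) w ->
    exists l, rnorm (w n - l) @[n --> \oo] --> (0 : R).

Section CompletionExtension.
Context {R : realType} {V : lmodType R[i]} (N : seminorm V).
Context {W : normedModType R[i]} (Wc : seq_complete W).
Context (T : {linear V -> W}) (TN : forall v, rnorm (T v) <= N v).

(** A relation instead of a function: any representative of [q] may be used, which makes linearity
    immediate and leaves uniqueness to [is_lim0]. *)
Let is_lim (q : completion N) (l : W) := exists u : cauchy_seq N,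
  normed_proj (lim_seminorm N) u = q /\
  rnorm (T (u n) - l) @[n --> \oo] --> (0 : R).

Lemma cvg0_le (x y : nat -> R) : (forall n, 0 <= x n <= y n) ->
  y n @[n --> \oo] --> (0 : R) -> x n @[n --> \oo] --> (0 : R).
Proof.
move=> xy y0; apply: squeeze_cvgr y0; last exact: (@cvg_cst R 0).
exact: nearW.
Qed.

Let is_lim_ex q : exists l, is_lim q l.
Proof.
have [|l Tl] := @Wc (fun n => T (repr q n)).
  move=> e /(cauchy_seq_cauchy (repr q))[n0 h]; exists n0 => m n m0 nn0.
  by rewrite -linearB /= (le_lt_trans (TN _))// h.
by exists l, (repr q); split => //; exact: normed_proj_repr.
Qed.

Let is_lim_lin a q1 l1 q2 l2 : is_lim q1 l1 -> is_lim q2 l2 ->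
  is_lim (a *: q1 + q2) (a *: l1 + l2).
Proof.
move=> [u1 [<- h1]] [u2 [<- h2]]; exists (a *: u1 + u2); split.
  by rewrite linearP.
apply: (@cvg0_le _ (fun n => Normc.normc a * rnorm (T (u1 n) - l1) +
  rnorm (T (u2 n) - l2))).
  move=> n; rewrite rnorm_ge0/=.
  rewrite [X in rnorm X](_ : _ =
    a *: (T (u1 n) - l1) + (T (u2 n) - l2)); last first.
    by rewrite linearP scalerBr opprD addrACA.
  by rewrite (le_trans (rnormD _ _))// rnormZ.
rewrite -[X in _ --> X](addr0 (0 : R)); apply: cvgD h2.
by rewrite -[X in _ --> X](mulr0 (Normc.normc a)); apply: cvgM h1; exact: cvg_cst.
Qed.

(** Independence of the representative: if [u] represents 0 then [N (u n)] tends to 0, and [TN]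
    drags [T (u n)] along. *)
Let is_lim0 l : is_lim 0 l -> l = 0.
Proof.
move=> [u [u0 Tl]].
have Nu : N (u n) @[n --> \oo] --> (0 : R).
  have := @normed_projE _ _ (lim_seminorm N) u.
  rewrite u0 normr0 => /esym [] /= <-; exact: is_cvg_cauchy_seq.
apply: rnorm_eq0; apply/eqP; rewrite eq_le rnorm_ge0 andbT.
have h : (N (u n) + rnorm (T (u n) - l)) @[n --> \oo] --> (0 : R).
  by rewrite -[X in _ --> X](addr0 (0 : R)); exact: cvgD.
rewrite -(cvg_lim _ h)//; apply: limr_ge; first by apply/cvg_ex; exists 0.
apply: nearW => n /=; rewrite -[X in rnorm X](subrK (T (u n))).
rewrite (le_trans (rnormD _ _))// addrC lerD//.
by rewrite rnorm_distrC.
Qed.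

(** The last clause is conditional because the extension of an injective [T] can have a kernel; the
    premise says that a Cauchy sequence whose image tends to 0 is itself null. *)
Lemma completion_extend : exists J : {linear completion N -> W},
  [/\ forall v, J (to_completion N v) = T v,
      forall q, rnorm (J q) <= rnorm q &
      (forall u, is_cauchy N u -> rnorm (T (u n)) @[n --> \oo] --> (0 : R) ->
        N (u n) @[n --> \oo] --> (0 : R)) -> injective J].
Proof.
have [J JP] := choice is_lim_ex.
have Juniq q l : is_lim q l -> l = J q.
  move=> ql; apply/eqP; rewrite -subr_eq0; apply/eqP; apply: is_lim0.
  by have := is_lim_lin (-1) (JP q) ql; rewrite !scaleN1r addNr addrC.
have Jlin : linear J.
  by move=> a x y; apply/esym/Juniq; exact: is_lim_lin.
pose JL : {linear completion N -> W} :=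
  HB.pack J (GRing.isLinear.Build R[i] (completion N) W *:%R J Jlin).
exists JL; split => [v|q|h].
(* The representative is the constant sequence [v]. *)
- apply/esym/Juniq; eexists; split; first reflexivity.
  rewrite [X in X @ _](_ : _ = cst 0); first exact: cvg_cst.
  by apply/funext => n /=; rewrite subrr rnorm0.
- have [u [<- Tu]] := JP q.
  have -> : rnorm (normed_proj (lim_seminorm N) u) = lim_fun u.
    by rewrite /rnorm normed_projE.
  set q' := normed_proj _ _ in Tu *.
  have h : N (u n) + rnorm (T (u n) - J q') @[n --> \oo] --> lim_fun u + 0.
    by apply: cvgD Tu; exact: is_cvg_cauchy_seq.
  rewrite addr0 in h; rewrite -(cvg_lim _ h)//.
  apply: limr_ge; first by apply/cvg_ex; eexists; exact: h.
  apply: nearW => n /=; rewrite -[X in rnorm X](subrK (T (u n))).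
  rewrite (le_trans (rnormD _ _))// addrC lerD//.
  by rewrite rnorm_distrC.
- apply: raddf_inj => q /= Jq0; have [u [uq Tu]] := JP q.
  have Tu0 : rnorm (T (u n)) @[n --> \oo] --> (0 : R).
    by move: Tu; rewrite Jq0; under eq_fun do rewrite subr0.
  have Nu := h _ (cauchy_seq_cauchy u) Tu0.
  apply: rnorm_eq0; rewrite -uq /rnorm normed_projE /= /lim_fun.
  exact: (cvg_lim _ Nu).
Qed.

End CompletionExtension.

(** * Complex L_p spaces *)

Section LpBasics.
Context {disp} {T : measurableType disp} {R : realType}.
Context (mu : {measure set T -> \bar R}) (p : R) (p1 : 1 <= p).
Implicit Types f g : T -> R[i].

Let p0 : 0 < p. Proof. exact: lt_le_trans p1. Qed.

(** The p-th power of the L_p norm. Estimates are made on it, since integrals compare and add up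
    directly, and carried back by [cLnorm_le]. *)
Definition cmass f : \bar R := (\int[mu]_x (normc (f x) `^ p)%:E)%E.

Lemma cmass_ge0 f : (0 <= cmass f)%E.
Proof. by apply: integral_ge0 => x _; rewrite lee_fin powR_ge0. Qed.

Lemma cLnormE f : cLnorm mu p f = (cmass f `^ p^-1)%E.
Proof.
rewrite /cLnorm /cmass unlock; congr (_ `^ _)%E; apply: eq_integral => x _ /=.
by rewrite ger0_norm ?normc_ge0.
Qed.

Lemma cLnorm_powR f : (cLnorm mu p f `^ p)%E = cmass f.
Proof. by rewrite cLnormE -poweRrM mulVf ?gt_eqF// poweRe1// cmass_ge0. Qed.

Lemma cLnorm_ge0 f : (0 <= cLnorm mu p f)%E.
Proof. exact: Lnorm_ge0. Qed.

Lemma cLnorm_le f e : 0 <= e ->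
  (cLnorm mu p f <= e%:E)%E = (cmass f <= (e `^ p)%:E)%E.
Proof.
move=> e0; apply/idP/idP => h.
  rewrite -cLnorm_powR -poweR_EFin; apply: gt0_ler_poweR => //.
  - exact: ltW.
  - by rewrite in_itv/= leey andbT cLnorm_ge0.
  - by rewrite in_itv/= leey andbT lee_fin.
rewrite cLnormE [e%:E](_ : _ = ((e `^ p)%:E `^ p^-1)%E); last first.
  by rewrite poweR_EFin -powRrM mulfV ?gt_eqF// powRr1.
apply: gt0_ler_poweR => //.
- by rewrite invr_ge0 ltW.
- by rewrite in_itv/= leey andbT cmass_ge0.
- by rewrite in_itv/= leey andbT lee_fin powR_ge0.
Qed.

Lemma cLnorm_lty f : (cLnorm mu p f < +oo)%E = (cmass f < +oo)%E.
Proof.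
apply/idP/idP => h.
  by rewrite -cLnorm_powR; apply: poweR_lty.
by rewrite cLnormE; apply: poweR_lty.
Qed.

Lemma measurable_normcX f : cmeasurable f ->
  measurable_fun setT (fun x => (normc (f x) `^ p)%:E).
Proof.
move=> mf; apply/measurable_EFinP.
apply: (@measurableT_comp _ _ _ _ _ _ (fun x : R => x `^ p)) => //.
exact: measurable_normc.
Qed.

Lemma le_cmass f g : cmeasurable f -> cmeasurable g ->
  {ae mu, forall x, normc (f x) <= normc (g x)} ->
  (cmass f <= cmass g)%E.
Proof.
move=> mf mg fg; apply: ae_ge0_le_integral => //.
- by move=> x _; rewrite lee_fin powR_ge0.
- exact: measurable_normcX.
- by move=> x _; rewrite lee_fin powR_ge0.
- exact: measurable_normcX.
- by apply: filterS fg => x h _; rewrite lee_fin ge0_ler_powR ?nnegrE ?normc_ge0// ltW.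
Qed.

Lemma ae_eq_cLnorm f g : cmeasurable f -> cmeasurable g ->
  {ae mu, forall x, f x = g x} -> cLnorm mu p f = cLnorm mu p g.
Proof.
move=> mf mg fg; rewrite !cLnormE; congr (_ `^ _)%E; apply/eqP.
by rewrite eq_le; apply/andP; split; apply: le_cmass => //;
  apply: filterS fg => x ->.
Qed.

Lemma cmeasurable0 : cmeasurable (0 : T -> R[i]).
Proof. by split; exact: measurable_cst. Qed.

Lemma cmeasurableN f : cmeasurable f -> cmeasurable (- f).
Proof. by move=> mf; rewrite -scaleN1r; exact: cmeasurableZ. Qed.

Lemma cmeasurableB f g : cmeasurable f -> cmeasurable g -> cmeasurable (f - g).
Proof. by move=> mf mg; apply: cmeasurableD => //; exact: cmeasurableN. Qed.

Lemma cLnorm0 : cLnorm mu p (0 : T -> R[i]) = 0%E.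
Proof.
rewrite cLnormE (_ : cmass _ = 0%E) ?poweR0r ?invr_eq0 ?gt_eqF//.
apply: integral0_eq => x _.
rewrite (_ : normc ((0 : T -> R[i]) x) = 0); last exact: normc0.
by rewrite powR0 ?gt_eqF.
Qed.

Lemma cLnorm_eq0P f : cmeasurable f ->
  cLnorm mu p f = 0%E <-> {ae mu, forall x, f x = 0}.
Proof.
move=> mf; split => [f0|f0]; last first.
  by rewrite (ae_eq_cLnorm mf cmeasurable0)// cLnorm0.
have := @Lnorm_eq0_eq0 _ _ _ mu (fun x => (normc (f x))%:E) p%:E.
move=> /(_ _ _ f0) h; have : \forall x \ae mu, setT x -> (normc (f x))%:E = 0%E.
  apply: h; last by rewrite lte_fin.
  by apply/measurable_EFinP; exact: measurable_normc.
by apply: filterS => x /(_ I)[]; exact: eq0_normc.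
Qed.

End LpBasics.

Section LpElements.
Context {disp} {T : measurableType disp} {R : realType}.
Context {mu : {measure set T -> \bar R}} {p : R} {p1 : 1 <= p}.
Local Notation Lp := (Lp mu p1).
Implicit Types (F G : Lp) (f g : T -> R[i]).

Lemma Lp_fun_cLfun F : Lp_fun F \in cLfun mu p.
Proof. exact: cLfun_valP. Qed.

Lemma cmeasurable_Lp_fun F : cmeasurable (Lp_fun F).
Proof. by have /cLfunP[] := Lp_fun_cLfun F. Qed.

Lemma rnorm_LpE F : (rnorm F)%:E = cLnorm mu p (Lp_fun F).
Proof.
have /cLfunP[_ lf] := Lp_fun_cLfun F.
have -> : rnorm F = fine (cLnorm mu p (Lp_fun F)).
  by rewrite -[in LHS](normed_proj_repr F) /rnorm normed_projE.
by rewrite fineK// ge0_fin_numE// cLnorm_ge0.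
Qed.

Definition mkLp f (fL : f \in cLfun mu p) : Lp := to_Lp (CLfun p1 fL).

Lemma to_Lp_fun F : mkLp (Lp_fun_cLfun F) = F.
Proof.
rewrite -[RHS]normed_proj_repr /mkLp /to_Lp; congr normed_proj; exact/val_inj.
Qed.

Lemma rnorm_mkLp f (fL : f \in cLfun mu p) :
  (rnorm (mkLp fL))%:E = cLnorm mu p f.
Proof.
have /cLfunP[_ lf] := fL.
by rewrite /rnorm normed_projE /= fineK// ge0_fin_numE// cLnorm_ge0.
Qed.

Lemma mkLp_lin a f g (fL : f \in cLfun mu p) (gL : g \in cLfun mu p)
   (hL : a *: f + g \in cLfun mu p) :
  mkLp hL = a *: mkLp fL + mkLp gL.
Proof.
rewrite /mkLp /to_Lp -[RHS]linearP; congr normed_proj; exact/val_inj.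
Qed.

Lemma mkLpP f g (fL : f \in cLfun mu p) (gL : g \in cLfun mu p) :
  mkLp fL = mkLp gL <-> {ae mu, forall x, f x = g x}.
Proof.
have mB : cmeasurable (f - g).
  by apply: cmeasurableB; [have /cLfunP[] := fL|have /cLfunP[] := gL].
have gfL : (-1) *: g + f \in cLfun mu p.
  by rewrite rpredD// rpredZ.
have -> : (mkLp fL = mkLp gL) <-> cLnorm mu p (f - g) = 0%E.
  rewrite addrC -scaleN1r -(rnorm_mkLp gfL) (mkLp_lin gL fL gfL).
  rewrite scaleN1r addrC; split => [->|[]]; first by rewrite subrr rnorm0.
  by move=> /rnorm_eq0/eqP; rewrite subr_eq0 => /eqP.
rewrite (cLnorm_eq0P mu p1 mB); split; apply: filterS => x.
  by move=> /eqP; rewrite -[(f - g) x]/(f x - g x) subr_eq0 => /eqP.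
by rewrite -[(f - g) x]/(f x - g x) => ->; rewrite subrr.
Qed.

Lemma mkLpK f (fL : f \in cLfun mu p) : {ae mu, forall x, Lp_fun (mkLp fL) x = f x}.
Proof. by apply/(mkLpP (Lp_fun_cLfun _) fL); exact: to_Lp_fun. Qed.

Lemma LpP F G : F = G <-> {ae mu, forall x, Lp_fun F x = Lp_fun G x}.
Proof. by rewrite -(mkLpP (Lp_fun_cLfun F) (Lp_fun_cLfun G)) !to_Lp_fun. Qed.

Lemma Lp_fun_lin a F G :
  {ae mu, forall x, Lp_fun (a *: F + G) x = a * Lp_fun F x + Lp_fun G x}.
Proof.
have hL : a *: Lp_fun F + Lp_fun G \in cLfun mu p.
  by rewrite rpredD ?rpredZ// Lp_fun_cLfun.
have -> : a *: F + G = mkLp hL.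
  by rewrite (mkLp_lin (Lp_fun_cLfun F) (Lp_fun_cLfun G) hL) !to_Lp_fun.
exact: mkLpK.
Qed.

Lemma Lp_funZ a F : {ae mu, forall x, Lp_fun (a *: F) x = a * Lp_fun F x}.
Proof.
have hL : a *: Lp_fun F \in cLfun mu p by rewrite rpredZ// Lp_fun_cLfun.
have -> : a *: F = mkLp hL.
  rewrite -[in LHS](to_Lp_fun F) /mkLp /to_Lp -[LHS]linearZ; congr normed_proj.
  exact/val_inj.
exact: mkLpK.
Qed.

Lemma Lp_fun_sum (I : Type) (s : seq I) (F : I -> Lp) :
  {ae mu, forall x, Lp_fun (\sum_(i <- s) F i) x = \sum_(i <- s) Lp_fun (F i) x}.
Proof.
elim: s => [|i s IH].
  have hL : 0 \in cLfun mu p by rewrite rpred0.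
  have := mkLpK hL; rewrite (_ : mkLp hL = 0); last first.
    apply: rnorm_eq0; have := rnorm_mkLp hL; rewrite cLnorm0//.
    by case.
  by apply: filterS => x; rewrite !big_nil.
have := Lp_fun_lin 1 (F i) (\sum_(j <- s) F j).
apply: filterS2 IH => x h; rewrite !big_cons scale1r mul1r => ->.
by rewrite h.
Qed.

Lemma Lp_funB F G : {ae mu, forall x, Lp_fun (F - G) x = Lp_fun F x - Lp_fun G x}.
Proof.
have := Lp_fun_lin (-1) G F; apply: filterS => x.
by rewrite scaleN1r mulN1r addrC => ->; rewrite addrC.
Qed.

End LpElements.
Arguments mkLp {disp T R mu p} p1 {f} fL.
Arguments mkLpK {disp T R mu p} p1 {f} fL.
Arguments rnorm_mkLp {disp T R mu p} p1 {f} fL.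

(** * Completeness of the complex L_p spaces (Riesz-Fischer) *)

Section RieszFischer.
Context {disp} {T : measurableType disp} {R : realType}.
Context (mu : {measure set T -> \bar R}) (p : R) (p1 : 1 <= p).

Let p0 : 0 < p. Proof. exact: lt_le_trans p1. Qed.

Lemma limn_einf_le (u : nat -> \bar R) (c : \bar R) n0 :
  (forall n, (n0 <= n)%N -> (u n <= c)%E) -> (limn_einf u <= c)%E.
Proof.
move=> h; rewrite limn_einf_lim; apply: lime_le; first exact: is_cvg_einfs.
exists 0%N => // n _; apply: (@le_trans _ _ (u (maxn n n0))).
  by apply: ereal_inf_lbound; exists (maxn n n0) => //=; rewrite leq_maxl.
by apply: h; rewrite leq_maxr.
Qed.

Lemma normc_Re_le (z : R[i]) : `|complex.Re z| <= normc z.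
Proof.
case: z => a b /=; rewrite -sqrtr_sqr; apply: ler_wsqrtr.
by rewrite lerDl sqr_ge0.
Qed.

Lemma normc_Im_le (z : R[i]) : `|complex.Im z| <= normc z.
Proof.
case: z => a b /=; rewrite -sqrtr_sqr; apply: ler_wsqrtr.
by rewrite lerDr sqr_ge0.
Qed.

Lemma cmeasurable_real (h : T -> R) : measurable_fun setT h ->
  cmeasurable (fun x => (h x)%:C%C).
Proof. by move=> mh; split => //; exact: measurable_cst. Qed.

Lemma normc_real (a : R) : normc a%:C%C = `|a|.
Proof. by rewrite /normc /= expr0n addr0 sqrtr_sqr. Qed.

(** [f] stands for the real or the imaginary part: the increments of [f (z n)] form an absolutely
    convergent series, whose partial sums telescope. *)
Lemma cvg_sum_normc (z : nat -> R[i]) (f : R[i] -> R) (M : R) :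
  {morph f : x y / x - y} -> (forall x, `|f x| <= normc x) ->
  (forall n, \sum_(k < n) normc (z k.+1 - z k) <= M) -> cvgn (fun n => f (z n)).
Proof.
move=> fB fle zM.
have cs : cvgn [normed series (fun k => f (z k.+1 - z k))].
  apply: nondecreasing_is_cvgn.
    by apply: nondecreasing_series => k _ _ /=.
  exists M => _ [n _ <-].
  rewrite /= /series /= big_mkord.
  by apply: le_trans (zM n); apply: ler_sum.
have {cs} := normed_cvg cs => cs.
rewrite (_ : (fun n => _) = (series (fun k => f (z k.+1 - z k)) \+ cst (f (z 0)))).
  by apply: is_cvgD => //; exact: is_cvg_cst.
apply/funext => n; rewrite /series /=.
under eq_bigr do rewrite fB.
by rewrite telescope_sumr// subrK.
Qed.

Lemma ReB : {morph @complex.Re R : x y / x - y}.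
Proof. by move=> [? ?] []. Qed.

Lemma ImB : {morph @complex.Im R : x y / x - y}.
Proof. by move=> [? ?] []. Qed.

Lemma cLnorm_sum_real (h : nat -> T -> R) (c : nat -> R) n :
  (forall k, measurable_fun setT (h k)) ->
  (forall k, cLnorm mu p (fun x => (h k x)%:C%C) <= (c k)%:E)%E ->
  (cLnorm mu p (fun x => (\sum_(k < n) h k x)%:C%C) <= (\sum_(k < n) c k)%:E)%E.
Proof.
move=> mh hc; elim: n => [|n IH].
  rewrite big_ord0 (_ : (fun=> _) = 0) ?cLnorm0//.
  by apply/funext => x; rewrite big_ord0.
rewrite big_ord_recr /= (_ : (fun=> _) =
    (fun x => (\sum_(k < n) h k x)%:C%C) + (fun x => (h n x)%:C%C)); last first.
  by apply/funext => x; rewrite big_ord_recr /= rmorphD.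
rewrite EFinD (le_trans (cLnormD mu p1 _ _))//.
- apply: cmeasurable_real; apply: measurable_sum => k; exact: mh.
- exact: cmeasurable_real.
- by apply: leeD.
Qed.

(* The partial sums of the [z k.+1 - z k] are bounded in L_p, so by monotone
   convergence they converge absolutely almost everywhere. *)
Lemma ae_bounded_variation (z : nat -> T -> R[i]) (c : nat -> R) (M : R) :
  0 <= M -> (forall n, cmeasurable (z n)) ->
  (forall n, \sum_(k < n) c k <= M) ->
  (forall k, cLnorm mu p (z k.+1 - z k)%R <= (c k)%:E)%E ->
  {ae mu, forall x, exists B : R,
     forall n, \sum_(k < n) normc (z k.+1 x - z k x) <= B}.
Proof.
move=> M0 mz cM zc.
pose h k x := normc (z k.+1 x - z k x).
have mh k : measurable_fun setT (h k).
  exact: (measurable_normc (cmeasurableB (mz k.+1) (mz k))).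
have h0 k x : 0 <= h k x by exact: normc_ge0.
pose G n x : \bar R := ((\sum_(k < n) h k x) `^ p)%:E.
have mG n : measurable_fun setT (G n).
  apply/measurable_EFinP.
  apply: (@measurableT_comp _ _ _ _ _ _ (fun x : R => x `^ p)) => //.
  by apply: measurable_sum => k; exact: mh.
have ndG x : {homo G^~ x : n m / (n <= m)%N >-> (n <= m)%E}.
  move=> n m nm; rewrite lee_fin ge0_ler_powR ?nnegrE ?sumr_ge0 ?(ltW p0)//.
  rewrite -(subnKC nm) big_split_ord /= lerDl.
  by rewrite sumr_ge0.
have Gle n : (\int[mu]_x G n x <= (M `^ p)%:E)%E.
  have : (cLnorm mu p (fun x => (\sum_(k < n) h k x)%:C%C) <= M%:E)%E.
    apply: (le_trans (cLnorm_sum_real (c := c) n mh _)).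
      move=> k; rewrite (le_trans _ (zc k))// /cLnorm.
      by under [X in (Lnorm mu _ X <= _)%E]eq_fun do
        rewrite normc_real ger0_norm ?h0//.
    by rewrite lee_fin.
  rewrite (cLnorm_le mu p1 _ M0) /cmass.
  by under eq_integral => x _ do rewrite normc_real ger0_norm ?sumr_ge0//.
have Gl : (\int[mu]_x limn (G^~ x) <= (M `^ p)%:E)%E.
  have := @cvg_monotone_convergence _ _ _ mu setT measurableT G mG.
  move=> /(_ _ _) h'; rewrite -(cvg_lim _ (h' _ _))//.
  - apply: lime_le; last exact: nearW.
    by apply/cvg_ex; eexists; apply: h' => // n x _; rewrite lee_fin powR_ge0.
  - by move=> n x _; rewrite lee_fin powR_ge0.
have : mu.-integrable setT (fun x => limn (G^~ x)).
  apply/integrableP; split.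
    apply: (emeasurable_fun_cvg G) => // x _; exact: ereal_nondecreasing_is_cvgn.
  under eq_integral => x _.
    rewrite gee0_abs; last first.
      apply: lime_ge; first exact: ereal_nondecreasing_is_cvgn.
      by apply: nearW => n; rewrite lee_fin powR_ge0.
    over.
  by rewrite (le_lt_trans Gl)// ltry.
move=> /integrable_ae -/(_ measurableT); apply: filterS => x /(_ I) lfin.
exists ((fine (limn (G^~ x))) `^ p^-1) => n.
have : (G n x <= limn (G^~ x))%E.
  apply: lime_ge; first exact: ereal_nondecreasing_is_cvgn.
  by exists n => // m /= nm; exact: ndG.
rewrite -(fineK lfin) lee_fin => le.
have S0 : 0 <= \sum_(k < n) normc (z k.+1 x - z k x).
  by apply: sumr_ge0 => k _; exact: normc_ge0.
rewrite [leLHS](_ : _ = ((\sum_(k < n) normc (z k.+1 x - z k x)) `^ p) `^ p^-1); last first.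
  by rewrite -powRrM mulfV ?gt_eqF// powRr1.
apply: ge0_ler_powR => //.
- by rewrite invr_ge0 ltW.
- by rewrite nnegrE powR_ge0.
- by rewrite nnegrE (le_trans _ le)// powR_ge0.
Qed.

Lemma expn2V_le (e : R) : 0 < e -> exists k : nat, 2^-1 ^+ k <= e.
Proof.
move=> e0; have [k _ h] := near_infty_natSinv_lt (PosNum e0).
exists k; apply: le_trans (ltW (h k (leqnn k))).
rewrite exprVn lef_pV2 ?posrE ?exprn_gt0// -natrX ler_nat.
exact: ltn_expl.
Qed.

Lemma limn_einf_ge0 (u : nat -> \bar R) :
  (forall n, 0 <= u n)%E -> (0 <= limn_einf u)%E.
Proof.
move=> u0; rewrite limn_einf_lim; apply: lime_ge; first exact: is_cvg_einfs.
by apply: nearW => n; apply: le_ereal_inf_tmp => _ [m _ <-].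
Qed.

(** Only the lower bound on the inferior limit is stated, this being the form that feeds Fatou's
    lemma. *)
Lemma limn_einf_powR (s : nat -> R) (l : R) : (forall n, 0 <= s n) ->
  s n @[n --> \oo] --> l -> ((l `^ p)%:E <= limn_einf (fun n => (s n `^ p)%:E))%E.
Proof.
move=> s0 sl; 
have l0 : 0 <= l.
  by rewrite -(cvg_lim _ sl)//; apply: limr_ge; [apply/cvg_ex; exists l|exact: nearW].
(* Continuity of the power is deduced from its derivability at positive points; at 0 the bound is
   just nonnegativity. *)
move: l0; rewrite le_eqVlt => /predU1P[<-|l0].
  by rewrite powR0 ?gt_eqF// limn_einf_ge0// => n; rewrite lee_fin powR_ge0.
have h : (s n `^ p)%:E @[n --> \oo] --> (l `^ p)%:E.
  suff h : s n `^ p @[n --> \oo] --> l `^ p by apply: cvg_EFin; [exact: nearW|exact: h].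
  apply: (@cvg_comp _ _ _ s (fun x : R => x `^ p) _ _ _ sl).
  have cp : {for l, continuous (fun x : R => x `^ p)}.
    apply: differentiable_continuous; apply/derivable1_diffP.
    by apply: derivable_powR; rewrite in_itv/= l0.
  exact: cp.
rewrite is_cvg_limn_einfE; last by apply/cvg_ex; eexists; exact: h.
by rewrite (cvg_lim _ h).
Qed.

Lemma cvg_normc (z : nat -> R[i]) (w : R[i]) :
  complex.Re (z n) @[n --> \oo] --> complex.Re w ->
  complex.Im (z n) @[n --> \oo] --> complex.Im w ->
  normc (z n) @[n --> \oo] --> normc w.
Proof.
move=> zr zi.
have nE (v : R[i]) : normc v = Num.sqrt (complex.Re v ^+ 2 + complex.Im v ^+ 2).
  by case: v.
under eq_fun do rewrite nE; rewrite nE.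
apply: continuous_cvg; first exact: sqrt_continuous.
by apply: cvgD; rewrite expr2; under eq_fun do rewrite expr2; exact: cvgM.
Qed.

(** Geometric speed gives bounded variation almost everywhere, hence a pointwise limit [g]; Fatou's
    lemma applied to [z n - z k] turns the Cauchy bounds into bounds on [g - z k]. *)
Lemma fast_cauchy_cvg (z : nat -> T -> R[i]) :
  (forall n, cmeasurable (z n)) ->
  (forall k n, (k <= n)%N -> cLnorm mu p (z n - z k)%R <= (2^-1 ^+ k)%:E)%E ->
  exists2 g, cmeasurable g &
    forall k, (cLnorm mu p (g - z k)%R <= (2^-1 ^+ k)%:E)%E.
Proof.
move=> mz zc.
have c2 n : \sum_(k < n) 2^-1 ^+ k <= 2 :> R.
  have -> : \sum_(k < n) (2^-1 : R) ^+ k = 2 * (1 - 2^-1 ^+ n).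
    elim: n => [|n IH]; first by rewrite big_ord0 expr0 subrr mulr0.
    by rewrite big_ord_recr /= IH exprS; lra.
  by rewrite ler_piMr// gerBl exprn_ge0.
have zB := @ae_bounded_variation z (fun k => 2^-1 ^+ k) 2 _ mz c2 (fun k => zc k _ (leqnSn k)).
(* A superior limit is measurable on the whole space and agrees with the limit wherever the latter
   exists, so the divergent points need no separate treatment. *)
pose part (f : R[i] -> R) x := fine (limn_esup (fun n => (f (z n x))%:E)).
have mpart f : (forall n, measurable_fun setT (fun x => f (z n x))) ->
    measurable_fun setT (part f).
  move=> mf; apply: (measurableT_comp (@fine_measurable R _ measurableT)).
  by apply: measurable_fun_limn_esup => n; exact/measurable_EFinP.
pose g x := ((part (@complex.Re R) x) +i* (part (@complex.Im R) x))%C.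
have mg : cmeasurable g.
  by split; apply: mpart => n; have [] := mz n.
have partP f x : cvgn (fun n => f (z n x)) -> f (z n x) @[n --> \oo] --> part f x.
  move=> cf; rewrite /part is_cvg_limn_esupE; last first.
    by apply/cvg_ex; eexists; apply: cvg_EFin; [exact: nearW|exact: cf].
  suff -> : limn (fun n => (f (z n x))%:E) = (limn (fun n => f (z n x)))%:E by [].
  by apply/cvg_lim => //; apply: cvg_EFin; [exact: nearW|exact: cf].
exists g => // k; rewrite cLnorm_le//.
have mzk n : measurable_fun setT (fun x => (normc ((z n - z k) x) `^ p)%:E).
  exact: (measurable_normcX p (cmeasurableB (mz n) (mz k))).
have ae_lim : {ae mu, forall x, setT x -> ((normc ((g - z k) x) `^ p)%:E <=
    limn_einf (fun n => (normc ((z n - z k) x) `^ p)%:E))%E}.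
  apply: filterS (zB (ler0n R 2)) => x [B xB] _.
  apply: limn_einf_powR => [n|]; first exact: normc_ge0.
  apply: cvg_normc.
    have cRe := partP _ _ (cvg_sum_normc ReB normc_Re_le xB).
    under eq_fun do rewrite ReB; rewrite ReB.
    by apply: cvgB => //; exact: cvg_cst.
  have cIm := partP _ _ (cvg_sum_normc ImB normc_Im_le xB).
  under eq_fun do rewrite ImB; rewrite ImB.
  by apply: cvgB => //; exact: cvg_cst.
rewrite /cmass; apply: le_trans (ae_ge0_le_integral _ _ _ _ _ ae_lim) _ => //.
- by move=> x _; rewrite lee_fin powR_ge0.
- exact: (measurable_normcX p (cmeasurableB mg (mz k))).
- move=> x _; apply: limn_einf_ge0 => n; by rewrite lee_fin powR_ge0.
- rewrite (_ : (fun _ => _) = (fun x =>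
      - limn_esup (fun n => - (normc ((z n - z k) x) `^ p)%:E))%E).
    apply: measurableT_comp => //; apply: measurable_fun_limn_esup => n.
    exact: measurableT_comp.
  by apply/funext => x; rewrite -[LHS]oppeK -limn_esupN.
apply: (le_trans (fatou mu measurableT mzk _)).
  by move=> n x _; rewrite lee_fin powR_ge0.
apply: (@limn_einf_le _ _ k) => n kn.
rewrite -[leLHS]/(cmass mu p (z n - z k)%R) -cLnorm_le//.
exact: zc.
Qed.

Lemma Lp_complete : seq_complete (Lp mu p1).
Proof.
move=> w cw.
have Nex k : exists N, forall m n, (N <= m)%N -> (N <= n)%N ->
    rnorm (w m - w n) < 2^-1 ^+ k by apply: cw; rewrite exprn_gt0.
have [N hN] := choice Nex.
(* Summing the thresholds makes [phi n] at least [N k] for every k <= n, without choosing a monotone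
   [N]. *)
pose phi k := (\sum_(j < k.+1) N j)%N.
have phiN k n : (k <= n)%N -> (N k <= phi n)%N.
  by move=> kn; rewrite /phi (bigD1 (Ordinal (kn : k < n.+1)%N)) //= leq_addr.
pose z k := Lp_fun (w (phi k)).
have mz n : cmeasurable (z n) by exact: cmeasurable_Lp_fun.
have zE m (f : T -> R[i]) (fL : f \in cLfun mu p) :
    cLnorm mu p (f - z m)%R = (rnorm (mkLp p1 fL - w (phi m)))%:E.
  rewrite rnorm_LpE; apply: ae_eq_cLnorm => //.
  - by have /cLfunP[mf _] := fL; exact: cmeasurableB.
  - exact: cmeasurable_Lp_fun.
  - apply: filterS2 (Lp_funB (mkLp p1 fL) (w (phi m))) (mkLpK p1 fL) => x -> ->.
    by [].
have zc k n : (k <= n)%N -> (cLnorm mu p (z n - z k)%R <= (2^-1 ^+ k)%:E)%E.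
  move=> kn; rewrite (zE k _ (Lp_fun_cLfun _)) to_Lp_fun lee_fin ltW// hN//.
    exact: phiN.
  exact: phiN.
have [g mg gz] := fast_cauchy_cvg mz zc.
have gL : g \in cLfun mu p.
  apply/cLfunP; split => //; rewrite -(subrK (z 0%N) g).
  rewrite (le_lt_trans (cLnormD mu p1 _ _))//; first exact: cmeasurableB.
  rewrite lte_add_pinfty// ?(le_lt_trans (gz _)) ?ltry//.
  by have /cLfunP[] := Lp_fun_cLfun (w (phi 0%N)).
exists (mkLp p1 gL); apply/cvgrPdist_le => e e0.
have [k ke] := @expn2V_le (e / 2) ltac:(by rewrite divr_gt0).
exists (N k) => // n /= kn.
rewrite sub0r normrN ger0_norm ?rnorm_ge0// -(subrK (w (phi k)) (w n)) -addrA.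
rewrite (le_trans (rnormD _ _))// [leRHS]splitr lerD//.
  by rewrite (le_trans _ ke)// ltW// hN// phiN.
by rewrite rnorm_distrC (le_trans _ ke)// -lee_fin -(zE k g gL).
Qed.

End RieszFischer.

(** * Tensor products and cross norms *)

Section Multilinear.
Context {R : realType} {d : nat}.

Definition multilinear (B : 'I_d -> normedModType R[i]) (W : lmodType R[i])
    (M : (forall i, B i) -> W) :=
  forall f i a (x y : B i), M (dfwith f i (a *: x + y)) =
    a *: M (dfwith f i x) + M (dfwith f i y).

Section universal.
Context {B : 'I_d -> normedModType R[i]} {W : lmodType R[i]}.
Implicit Type M : (forall i, B i) -> W.

Local Notation free := {freeg (forall i, B i) / R[i]}.

Lemma fglift_linear M : linear (fglift M : free -> W).
Proof.
have lB : {morph (fglift M : free -> W) : x y / x - y}.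
  exact: lift_is_additive.
have l0 : (fglift M : free -> W) 0 = 0 by rewrite -(subr0 0) lB subrr.
have lN x : (fglift M : free -> W) (- x) = - fglift M x by rewrite -sub0r lB l0 sub0r.
have lD : {morph (fglift M : free -> W) : x y / x + y}.
  by move=> x y; rewrite -[y in LHS]opprK lB lN opprK.
have lsum (I : Type) (s : seq I) (F : I -> free) :
    fglift M (\sum_(i <- s) F i) = \sum_(i <- s) fglift M (F i).
  by elim/big_rec2: _ => [|i x y _ <-]; rewrite ?l0// lD.
move=> a u v; rewrite lD; congr (_ + _).
rewrite -[a *: u]/(fgscale a u) /fgscale lsum.
rewrite -[in RHS](freeg_sumE u) lsum scaler_sumr.
by apply: eq_bigr => f _; rewrite !liftU scalerA.
Qed.

(** Universal property of the algebraic tensor product: the lift of [M] to the free space kills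
    [tensor_rel], so its value at a representative depends only on the class. *)
Lemma tensor_lift M : multilinear M ->
  exists T : {linear tensor B -> W}, forall f, T (elem_tensor f) = M f.
Proof.
move=> mM; pose L : {linear free -> W} :=
  HB.pack (fglift M : free -> W) (GRing.isLinear.Build R[i] free W *:%R _ (fglift_linear M)).
have L0 u : tensor_rel u -> L u = 0.
  elim=> [|a x y _ Lx _ Ly|f i a x y]; first exact: linear0.
    by rewrite linearP Lx Ly scaler0 addr0.
  rewrite !linearB linearZ /= !liftU !scale1r mM.
  by rewrite -addrA -opprD subrr.
have Lpi u : L (repr (lmod_proj (tensor_predZ (B := B)) u)) = L u.
  apply/eqP; rewrite -subr_eq0 -linearB; apply/eqP/L0/tensor_predP.
  apply/(lmod_quot_eqP (tensor_predZ (B := B))).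
  exact: (reprK (lmod_proj (tensor_predZ (B := B)) u)).
pose T (t : tensor B) := L (repr t).
have Tlin : linear T.
  move=> a x y; rewrite /T -[x in LHS]reprK -[y in LHS]reprK.
  by rewrite -pi_lmod_quotZ -pi_lmod_quotD Lpi linearP.
pose TL : {linear tensor B -> W} :=
  HB.pack T (GRing.isLinear.Build R[i] (tensor B) W *:%R T Tlin).
by exists TL => f; rewrite /= /T Lpi /= liftU scale1r.
Qed.

End universal.

Section cross.
Context {B : 'I_d -> normedModType R[i]}.
(** Otherwise [proj_norm] would be the supremum of the empty set, that is 0, and would dominate
    nothing. *)
Hypothesis cross_ex : exists N0, cross_norm (B := B) N0.

Lemma le_proj_norm (M : seminorm (tensor B)) :
  (forall f, M (elem_tensor f) <= \prod_(i < d) rnorm (f i)) ->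
  forall u, M u <= proj_norm B u.
Proof.
move=> Mle u; have [N0 [[ND NZ Nd] Ne]] := cross_ex.
have cN : cross_norm (fun v => Num.max (N0 v) (M v)).
  split; [split|] => [x y|a x|x|f].
  - rewrite ge_max; apply/andP; split.
      by rewrite (le_trans (ND _ _))// lerD// le_max lexx.
    by rewrite (le_trans (seminormD _ _ _))// lerD// le_max lexx orbT.
  - by rewrite NZ seminormZ maxr_pMr// normc_ge0.
  - move=> mx; apply: Nd; apply/eqP; rewrite eq_le.
    rewrite -{1}mx le_max lexx/=.
    exact: (seminorm_ge0 (Seminorm ND NZ)).
  - by rewrite Ne; apply/max_idPl.
apply: le_trans (cross_norm_le u cN).
by rewrite le_max lexx orbT.
Qed.

Lemma proj_norm_elem f :
  proj_norm B (elem_tensor f) = \prod_(i < d) rnorm (f i).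
Proof.
have [N0 cN] := cross_ex; apply/eqP; rewrite eq_le; apply/andP; split.
  apply: proj_norm_le => [|N [_ ->]//].
  by apply: prodr_ge0 => i _; exact: rnorm_ge0.
by rewrite -cN.2; exact: cross_norm_le.
Qed.

(** The seminorm [rnorm (T u)] is controlled on elementary tensors, so [le_proj_norm] makes [T] a
    contraction on all tensors and [completion_extend] applies. *)
Lemma proj_tensor_extend (W : normedModType R[i]) (T : {linear tensor B -> W}) :
  seq_complete W ->
  (forall f, rnorm (T (elem_tensor f)) <= \prod_(i < d) rnorm (f i)) ->
  exists J : {linear proj_tensor B -> W},
    [/\ forall f, J (elem_proj_tensor f) = T (elem_tensor f),
        forall u, rnorm (J u) <= rnorm u &
        (forall u, is_cauchy (proj_norm B) u ->
           rnorm (T (u n)) @[n --> \oo] --> (0 : R) ->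
           proj_norm B (u n) @[n --> \oo] --> (0 : R)) -> injective J].
Proof.
move=> Wc Tle.
have MD x y : rnorm (T (x + y)) <= rnorm (T x) + rnorm (T y).
  by rewrite linearD rnormD.
have MZ a x : rnorm (T (a *: x)) = normc a * rnorm (T x).
  by rewrite linearZZ rnormZ.
have TN u : rnorm (T u) <= proj_norm B u.
  exact: (le_proj_norm (M := Seminorm MD MZ)) Tle u.
have [J [JE JC Ji]] := completion_extend Wc TN.
by exists J; split => // f; exact: JE.
Qed.

End cross.

Section expansion.
Context {V : normedModType R[i]} {W : lmodType R[i]} {I : finType}.

Lemma multilinear_sum (M : ('I_d -> V) -> W) (mM : multilinear M) f i
    (J : Type) (s : seq J) (x : J -> V) :
  M (dfwith f i (\sum_(j <- s) x j)) = \sum_(j <- s) M (dfwith f i (x j)).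
Proof.
(* Multilinearity with scalar -1 at two zero vectors; the same trick gives the value at 0 of other
   maps known only through this identity. *)
have M0 : M (dfwith f i 0) = 0.
  have := mM f i (-1) 0 0; rewrite scaler0 addr0 scaleN1r.
  by rewrite addNr.
elim: s => [|j s IH]; first by rewrite !big_nil.
by rewrite !big_cons -[x j]scale1r mM scale1r IH scale1r.
Qed.

(** The list [ks] of multi-indices is chosen before [M] and [g], so that one list serves all tensors
    in [tensor_finite_rankE]. *)
Lemma multilinear_expand : exists ks : seq ('I_d -> I),
  forall (M : ('I_d -> V) -> W) (g : 'I_d -> I -> V), multilinear M ->
    M (fun i => \sum_k g i k) = \sum_(k <- ks) M (fun i => g i (k i)).
Proof.
have [I0|/card_gt0P[k0 _]] := posnP #|I|.
  (* With [I] empty there is a single multi-index if d = 0 and none otherwise; in the latter case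
     some argument of [M] is an empty sum. *)
  have [d0|d0] := posnP d.
    have dF (i : 'I_d) : False by have := ltn_ord i; rewrite {2}d0.
    exists [:: fun i => False_rect I (dF i)] => M g _.
    by rewrite big_seq1; congr M; apply/funext => i; case: (dF i).
  exists [::] => M g mM; rewrite big_nil.
  pose i0 := Ordinal d0.
  rewrite [X in M X](_ : _ = dfwith (fun i => \sum_k g i k) i0 0).
    have := @multilinear_sum M mM (fun i => \sum_k g i k) i0 void [::] (fun=> 0).
    by rewrite !big_nil.
  apply/funext => i; case: dfwithP => //.
  by apply: big1 => k _; have := fintype0 k I0.
(* Expand only the coordinates of a sublist, the others being filled by an arbitrary [f]; this
   allows induction on the sublist. *)
suff [ks h] : exists ks : seq ('I_d -> I), forall (M : ('I_d -> V) -> W) f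
    (g : 'I_d -> I -> V), multilinear M ->
    M (fun i => if i \in enum 'I_d then \sum_k g i k else f i) =
    \sum_(k <- ks) M (fun i => if i \in enum 'I_d then g i (k i) else f i).
  exists ks => M g mM; have := h M (fun=> 0) g mM.
  under [X in M X]eq_fun do rewrite mem_enum.
  move=> ->; apply: eq_bigr => k _; congr M.
  by apply/funext => i; rewrite mem_enum.
elim: (enum 'I_d) => [|j s [ks IH]].
  by exists [:: fun=> k0] => M f g _; rewrite big_seq1.
have [js|js] := boolP (j \in s).
  exists ks => M f g mM.
  have e i : (i \in j :: s) = (i \in s).
    by rewrite in_cons; case: eqP => // ->.
  under [X in M X]eq_fun do rewrite e; rewrite IH//.
  by apply: eq_bigr => k _; congr M; apply/funext => i; rewrite e.
(* Each multi-index for [s] yields one for [j :: s] per value of its j-th entry. *)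
pose upd (k : 'I_d -> I) l : 'I_d -> I := fun i => if i == j then l else k i.
exists [seq upd k l | k <- ks, l <- enum I] => M f g mM.
rewrite big_allpairs_dep.
(* The unexpanded sum at [j] is moved into the filler, to which the induction hypothesis applies. *)
rewrite [X in M X](_ : _ = fun i => if i \in s then \sum_k g i k else
  (if i == j then \sum_k g j k else f i)); last first.
  by apply/funext => i; rewrite in_cons; case: eqP => [->|]//=; rewrite (negbTE js).
rewrite IH//; apply: eq_bigr => k _.
pose h := fun i => if i \in s then g i (k i) else f i.
rewrite [X in M X](_ : _ = dfwith h j (\sum_k g j k)); last first.
  apply/funext => i; rewrite /h; case: dfwithP => [|l jl].
    by rewrite (negbTE js) eqxx.
  by rewrite eq_sym (negbTE jl).
rewrite multilinear_sum// big_enum/=; apply: eq_bigr => l _; congr M.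
apply/funext => i; rewrite /h /upd; case: dfwithP => [|m jm].
  by rewrite in_cons eqxx.
by rewrite in_cons eq_sym (negbTE jm).
Qed.

End expansion.
End Multilinear.

(** * Complex integrals and product measures *)

Section ComplexIntegral.
Context {disp} {T : measurableType disp} {R : realType}.
Implicit Types (mu : {measure set T -> \bar R}) (f g : T -> R[i]).

Definition cintegrable mu f :=
  mu.-integrable setT (fun x => (complex.Re (f x))%:E) /\
  mu.-integrable setT (fun x => (complex.Im (f x))%:E).

Definition cint mu f : R[i] :=
  ((\int[mu]_x complex.Re (f x))%R +i* (\int[mu]_x complex.Im (f x))%R)%C.

Lemma integrable_lin mu (a b : R) (h k : T -> R) :
  mu.-integrable setT (EFin \o h) -> mu.-integrable setT (EFin \o k) ->
  mu.-integrable setT (fun x => (a * h x + b * k x)%:E).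
Proof.
move=> ih ik; have := integrableD measurableT (integrableZl measurableT a ih)
  (integrableZl measurableT b ik).
by apply: eq_integrable => // x _ /=; rewrite -!EFinM -EFinD.
Qed.

Lemma Rintegral_lin mu (a b : R) (h k : T -> R) :
  mu.-integrable setT (EFin \o h) -> mu.-integrable setT (EFin \o k) ->
  \int[mu]_x (a * h x + b * k x) = a * \int[mu]_x h x + b * \int[mu]_x k x.
Proof.
move=> ih ik; rewrite -!RintegralZl//; apply: RintegralD => //.
  by have := integrableZl measurableT a ih; apply: eq_integrable.
by have := integrableZl measurableT b ik; apply: eq_integrable.
Qed.

Lemma ReM (z w : R[i]) : complex.Re (z * w) =
  complex.Re z * complex.Re w + -1 * (complex.Im z * complex.Im w).
Proof. by case: z w => [? ?] [? ?] /=; rewrite mulN1r. Qed.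

Lemma ImM (z w : R[i]) : complex.Im (z * w) =
  complex.Re z * complex.Im w + complex.Im z * complex.Re w.
Proof. by case: z w => [? ?] [? ?]. Qed.

Lemma cintegrable_measurable mu f : cintegrable mu f -> cmeasurable f.
Proof.
by move=> [/measurable_int/measurable_EFinP fr /measurable_int/measurable_EFinP fi].
Qed.

Lemma cintegrableD mu f g : cintegrable mu f -> cintegrable mu g ->
  cintegrable mu (fun x => f x + g x).
Proof.
move=> [fr fi] [gr gi]; split.
  apply: eq_integrable (integrable_lin 1 1 fr gr) => // x _ /=.
  by rewrite !mul1r; case: (f x) (g x) => [? ?] [].
apply: eq_integrable (integrable_lin 1 1 fi gi) => // x _ /=.
by rewrite !mul1r; case: (f x) (g x) => [? ?] [].
Qed.

Lemma cintegrableZ mu a f : cintegrable mu f -> cintegrable mu (fun x => a * f x).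
Proof.
move=> [fr fi]; split.
  apply: eq_integrable (integrable_lin (complex.Re a) (- complex.Im a) fr fi) => // x _ /=.
  by rewrite ReM mulN1r mulNr.
apply: eq_integrable (integrable_lin (complex.Re a) (complex.Im a) fi fr) => // x _ /=.
by rewrite ImM.
Qed.

Lemma cintD mu f g : cintegrable mu f -> cintegrable mu g ->
  cint mu (fun x => f x + g x) = cint mu f + cint mu g.
Proof.
move=> [fr fi] [gr gi]; rewrite /cint; apply/eqP; rewrite eq_complex /=.
apply/andP; split; apply/eqP.
  rewrite -RintegralD//; apply: eq_Rintegral => x _.
  by case: (f x) (g x) => [? ?] [].
rewrite -RintegralD//; apply: eq_Rintegral => x _.
by case: (f x) (g x) => [? ?] [].
Qed.

Lemma cintZ mu a f : cintegrable mu f ->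
  cint mu (fun x => a * f x) = a * cint mu f.
Proof.
move=> [fr fi]; rewrite /cint; apply/eqP; rewrite eq_complex.
rewrite ReM ImM /= mulN1r -mulNr -!Rintegral_lin//.
apply/andP; split; apply/eqP; apply: eq_Rintegral => x _.
  by rewrite ReM mulN1r mulNr.
by rewrite ImM.
Qed.

Lemma ae_eq_cint mu f g : cmeasurable f -> cmeasurable g ->
  {ae mu, forall x, f x = g x} -> cint mu f = cint mu g.
Proof.
move=> [fr fi] [gr gi] fg; rewrite /cint /Rintegral; congr ((fine _) +i* (fine _))%C.
  by apply: ae_eq_integral => //; [exact/measurable_EFinP|exact/measurable_EFinP|
    apply: filterS fg => x -> _].
by apply: ae_eq_integral => //; [exact/measurable_EFinP|exact/measurable_EFinP|
  apply: filterS fg => x -> _].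
Qed.

Lemma le_cintegrable mu f (h : T -> R) : cmeasurable f ->
  mu.-integrable setT (EFin \o h) -> (forall x, normc (f x) <= h x) ->
  cintegrable mu f.
Proof.
move=> [fr fi] ih fh; split; apply: (le_integrable measurableT _ _ ih).
- exact/measurable_EFinP.
- move=> x _ /=; rewrite lee_fin (le_trans (normc_Re_le _))//.
  by rewrite (le_trans (fh x))// ler_norm.
- exact/measurable_EFinP.
- move=> x _ /=; rewrite lee_fin (le_trans (normc_Im_le _))//.
  by rewrite (le_trans (fh x))// ler_norm.
Qed.

Lemma normc_le_ReIm (z : R[i]) : normc z <= `|complex.Re z| + `|complex.Im z|.
Proof.
case: z => a b /=; rewrite -[leRHS]ger0_norm ?addr_ge0// -sqrtr_sqr.
apply: ler_wsqrtr; rewrite sqrrD !real_normK ?num_real//.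
by rewrite lerD2r lerDl mulrn_wge0// mulr_ge0.
Qed.

(** The factor 2 counts the real and the imaginary part, each at most the integral of [h]. It is the
    source of the 2 in [rnorm_cond_exp] and of [2 ^+ d] in [proj_norm_cond_exp]. *)
Lemma normc_cint_le mu f (h : T -> R) : cmeasurable f ->
  mu.-integrable setT (EFin \o h) -> (forall x, normc (f x) <= h x) ->
  normc (cint mu f) <= 2 * \int[mu]_x h x.
Proof.
move=> mf ih fh; have [fr fi] := le_cintegrable mf ih fh.
rewrite (le_trans (normc_le_ReIm _))//= mulr2n mulrDl !mul1r lerD//.
  rewrite (le_trans (le_normr_Rintegral _ _))//; apply: le_Rintegral => //.
    exact: integrable_norm.
  by move=> x _; rewrite (le_trans (normc_Re_le _)).
rewrite (le_trans (le_normr_Rintegral _ _))//; apply: le_Rintegral => //.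
  exact: integrable_norm.
by move=> x _; rewrite (le_trans (normc_Im_le _)).
Qed.

Lemma cmeasurableM f g : cmeasurable f -> cmeasurable g ->
  cmeasurable (fun x => f x * g x).
Proof.
move=> [fr fi] [gr gi]; split.
  under eq_fun do rewrite ReM mulN1r.
  by apply: measurable_funB; exact: measurable_funM.
under eq_fun do rewrite ImM.
by apply: measurable_funD; exact: measurable_funM.
Qed.

Lemma cmeasurable_cst (c : R[i]) : cmeasurable (fun _ : T => c).
Proof. by split; exact: measurable_cst. Qed.

Lemma cmeasurable_prod (I : Type) (s : seq I) (F : I -> T -> R[i]) :
  (forall i, cmeasurable (F i)) -> cmeasurable (fun x => \prod_(i <- s) F i x).
Proof.
move=> mF; elim: s => [|i s IH].
  by under eq_fun do rewrite big_nil; exact: cmeasurable_cst.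
by under eq_fun do rewrite big_cons; exact: cmeasurableM.
Qed.

End ComplexIntegral.

Lemma cmeasurable_comp {disp disp'} {T : measurableType disp}
    {T' : measurableType disp'} {R : realType} (f : T' -> R[i]) (h : T -> T') :
  measurable_fun setT h -> cmeasurable f -> cmeasurable (f \o h).
Proof.
by move=> mh [fr fi]; split;
  [exact: (measurableT_comp fr mh)|exact: (measurableT_comp fi mh)].
Qed.

Section Fubini2.
Context {d1 d2} {T1 : measurableType d1} {T2 : measurableType d2} {R : realType}.
Context (m1 : {sigma_finite_measure set T1 -> \bar R}).
Context (m2 : {sigma_finite_measure set T2 -> \bar R}).

Lemma integrable_prodM (f : T1 -> R) (g : T2 -> R) :
  m1.-integrable setT (EFin \o f) -> m2.-integrable setT (EFin \o g) ->
  (m1 \x m2)%E.-integrable setT (fun z => (f z.1 * g z.2)%:E).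
Proof.
move=> f_int g_int.
have mf : measurable_fun setT f by exact/measurable_EFinP/(measurable_int m1).
have mg : measurable_fun setT g by exact/measurable_EFinP/(measurable_int m2).
have mfg : measurable_fun setT (fun z : T1 * T2 => (f z.1 * g z.2)%:E).
  apply/measurable_EFinP; apply: measurable_funM.
    exact: measurableT_comp.
  exact: measurableT_comp.
apply/integrable12ltyP => //=.
have -> : (fun x => \int[m2]_y `|(f x * g y)%:E|)%E =
    (fun x => `|(f x)%:E| * \int[m2]_y `|(g y)%:E|)%E.
  apply/funext => x; rewrite -ge0_integralZl//; last first.
    by apply: measurableT_comp => //; exact/measurable_EFinP.
  by apply: eq_integral => y _; rewrite EFinM abseM.
have /integrableP[_ gy] := g_int; have /integrableP[_ fy] := f_int.
rewrite ge0_integralZr//.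
- rewrite lte_mul_pinfty// ?integral_ge0//.
  by rewrite ge0_fin_numE// integral_ge0.
- by apply: measurableT_comp => //; exact/measurable_EFinP.
- by rewrite integral_ge0.
Qed.

Lemma Rintegral_prodM (f : T1 -> R) (g : T2 -> R) :
  m1.-integrable setT (EFin \o f) -> m2.-integrable setT (EFin \o g) ->
  \int[(m1 \x m2)%E]_z (f z.1 * g z.2) = (\int[m1]_x f x) * (\int[m2]_y g y).
Proof.
move=> f_int g_int.
rewrite /Rintegral -(integral12_prod_meas1 (integrable_prodM f_int g_int)).
rewrite /fubini_F /=.
have -> : (fun x => \int[m2]_y (f x * g y)%:E)%E =
    (fun x => (f x)%:E * (fine (\int[m2]_y (g y)%:E))%:E)%E.
  apply/funext => x; rewrite fineK; last exact: integrable_fin_num.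
  by rewrite -integralZl//; apply: eq_integral => y _; rewrite EFinM.
by rewrite integralZr// fineM//; exact: integrable_fin_num.
Qed.

Lemma cint_prodM (f : T1 -> R[i]) (g : T2 -> R[i]) :
  cintegrable m1 f -> cintegrable m2 g ->
  cintegrable (m1 \x m2)%E (fun z => f z.1 * g z.2) /\
  cint (m1 \x m2)%E (fun z => f z.1 * g z.2) = cint m1 f * cint m2 g.
Proof.
move=> [fr fi] [gr gi].
have rr := integrable_prodM fr gr; have ii := integrable_prodM fi gi.
have ri := integrable_prodM fr gi; have ir := integrable_prodM fi gr.
split.
  split; under eq_fun do rewrite ?ReM ?ImM.
    by apply: eq_integrable (integrable_lin 1 (-1) rr ii) => // x _; rewrite mul1r.
  by apply: eq_integrable (integrable_lin 1 1 ri ir) => // x _; rewrite !mul1r.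
rewrite /cint; apply/eqP; rewrite eq_complex ReM ImM/=.
rewrite -!Rintegral_prodM//; apply/andP; split; apply/eqP.
  rewrite -[X in X + _]mul1r -Rintegral_lin//.
  by apply: eq_Rintegral => x _; rewrite ReM mul1r.
rewrite -[X in X + _]mul1r -[X in _ + X]mul1r -Rintegral_lin//.
by apply: eq_Rintegral => x _; rewrite ImM !mul1r.
Qed.

End Fubini2.

Section ProbabilityIntegral.
Context {disp} {T : measurableType disp} {R : realType} (P : probability T R).

Lemma cint_distribution {d'} {Y : measurableType d'}
    (X : {mfun T >-> Y}) (f : Y -> R[i]) : cmeasurable f ->
  cintegrable P (f \o X) ->
  cintegrable (distribution P X) f /\ cint (distribution P X) f = cint P (f \o X).
Proof.
move=> [fr fi] [ir ii]; split.
  by split; apply: integrable_pushforward => //; exact/measurable_EFinP.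
rewrite /cint /Rintegral; congr ((fine _) +i* (fine _))%C.
  by rewrite integral_distribution//; exact/measurable_EFinP.
by rewrite integral_distribution//; exact/measurable_EFinP.
Qed.

Lemma cintegrable_cst (c : R[i]) : cintegrable P (fun=> c).
Proof.
by split; apply: finite_measure_integrable_cst.
Qed.

Lemma cint_cst (c : R[i]) : cint P (fun=> c) = c.
Proof.
have h (a : R) : \int[P]_(_ in setT) a = a.
  by rewrite Rintegral_cst// -[X in fine X]/(P setT) probability_setT mulr1.
by rewrite /cint !h; case: c.
Qed.

Lemma measurable_tnth_fun n (i : 'I_n) :
  measurable_fun setT (fun x : n.-tuple T => tnth x i).
Proof. exact: measurable_tnth. Qed.

End ProbabilityIntegral.

(** * Integrals and null sets for the power measure *)

Section PowerIntegral.
Context {disp} {T : measurableType disp} {R : realType} (P : probability T R).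

(** Fubini, one coordinate at a time: [power_measure] at n + 1 is the image of a product measure
    under [cons_pair]. *)
Lemma cint_power n (f : 'I_n -> T -> R[i]) : (forall i, cintegrable P (f i)) ->
  cintegrable (power_measure P n) (fun x => \prod_(i < n) f i (tnth x i)) /\
  cint (power_measure P n) (fun x => \prod_(i < n) f i (tnth x i)) =
    \prod_(i < n) cint P (f i).
Proof.
elim: n f => [|n IH] f fP.
  under eq_fun do rewrite big_ord0; rewrite big_ord0.
  by split; [exact: cintegrable_cst|exact: cint_cst].
set F := (fun x : n.+1.-tuple T => _).
have mF : cmeasurable F.
  apply: cmeasurable_prod => i.
  apply: (cmeasurable_comp (f := f i)); first exact: measurable_tnth_fun.
  exact: cintegrable_measurable (fP i).
pose G (y : n.-tuple T) := \prod_(i < n) f (fintype.lift ord0 i) (tnth y i).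
have [iG cG] := IH (fun i => f (fintype.lift ord0 i)) (fun i => fP _).
have FE : F \o @cons_pair _ _ n = (fun z => f ord0 z.1 * G z.2).
  apply/funext => -[x y] /=; rewrite /F big_ord_recl; congr (_ * _).
  by apply: eq_bigr => i _; rewrite tnthS.
have [i2 c2] := cint_prodM (fP ord0) iG.
have [i3 c3] := @cint_distribution _ _ _ (P \x power_measure P n)%E _ _
  (@cons_pair _ _ n) F mF ltac:(by rewrite FE).
by split => //=; rewrite big_ord_recl -cG -c2 -FE.
Qed.

(** The exceptional set lies in a box with one null side. This is what lets identities between
    representatives in L_p(mu) pass to products of them. *)
Lemma ae_tnth n (i : 'I_n) (Q : T -> Prop) : {ae P, forall x, Q x} ->
  {ae power_measure P n, forall x : n.-tuple T, Q (tnth x i)}.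
Proof.
move=> [N [mN N0 QN]]; exists ((fun x : n.-tuple T => tnth x i) @^-1` N); split.
- by rewrite -[X in measurable X]setTI; exact: measurable_tnth_fun.
- have := @power_measureE _ _ _ P n (fun j => if j == i then N else setT).
  rewrite (bigD1 i) //= eqxx N0 mul0e => <-.
    congr (power_measure _ _ _); apply/seteqP; split => x /=.
      by move=> Nx j; case: eqP => // ->.
    by move=> /(_ i); rewrite eqxx.
  by move=> j; case: ifP.
- by move=> x /= Qx; apply: QN.
Qed.

End PowerIntegral.

(** * Jensen's inequality, and the pairing of L_p with bounded functions *)

Section Jensen.
Context {disp} {T : measurableType disp} {R : realType}.
Context (mu : {measure set T -> \bar R}) (p : R) (p1 : 1 <= p).

Let p0 : 0 < p. Proof. exact: lt_le_trans p1. Qed.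

(** Hoelder's inequality for [h \* \1_A] against [\1_A]. Without a division by [mu A] the statement
    also covers null sets. *)
Lemma jensen_powR (A : set T) (h : T -> R) : measurable A ->
  measurable_fun setT h -> (forall x, 0 <= h x) ->
  ((\int[mu]_(x in A) (h x)%:E) `^ p <=
   (mu A) `^ (p - 1) * \int[mu]_(x in A) (h x `^ p)%:E)%E.
Proof.
move=> mA mh h0.
have hA0 : (0 <= \int[mu]_(x in A) (h x)%:E)%E.
  by apply: integral_ge0 => x _; rewrite lee_fin.
have [p_eq1|p_neq1] := eqVneq p 1.
  rewrite p_eq1 subrr poweRe0 mul1e poweRe1//.
  by under [leRHS]eq_integral => x _ do rewrite powRr1//.
have p_gt1 : 1 < p by rewrite lt_neqAle eq_sym p_neq1.
have pB0 : 0 < p - 1 by rewrite subr_gt0.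
pose q := p / (p - 1).
have q0 : 0 < q by rewrite divr_gt0.
have pq : p^-1 + q^-1 = 1.
  rewrite /q invf_div -[X in X + _]mul1r -mulrDl addrC subrK divff//.
  by rewrite gt_eqF.
have mI : measurable_fun setT (\1_A : T -> R) by exact: measurable_indic.
have mhI : measurable_fun setT (h \* \1_A) by exact: measurable_funM.
have := hoelder mu mhI mI p0 q0 pq; rewrite Lnorm1.
have -> : (\int[mu]_x `|(EFin \o ((h \* \1_A) \* \1_A)%R) x| =
    \int[mu]_(x in A) (h x)%:E)%E.
  rewrite [RHS]integral_mkcond; apply: eq_integral => x _ /=.
  rewrite patchE indicE; case: ifPn => xA.
    by rewrite !mulr1 ger0_norm.
  by rewrite !mulr0 normr0.
have -> : ('N[mu]_p%:E[EFin \o (h \* \1_A)%R] =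
    (\int[mu]_(x in A) (h x `^ p)%:E) `^ p^-1)%E.
  rewrite unlock; congr (_ `^ _)%E; rewrite [RHS]integral_mkcond.
  apply: eq_integral => x _ /=; rewrite patchE indicE; case: ifPn => xA.
    by rewrite mulr1 ger0_norm.
  by rewrite mulr0 normr0 powR0// gt_eqF.
have -> : ('N[mu]_q%:E[EFin \o \1_A] = (mu A) `^ q^-1)%E.
  rewrite unlock; congr (_ `^ _)%E; rewrite -[in RHS](setIT A) -integral_indic//.
  apply: eq_integral => x _ /=; rewrite indicE; case: (_ \in _) => /=.
    by rewrite normr1 powR1.
  by rewrite normr0 powR0// gt_eqF.
move=> le; have int0 : (0 <= \int[mu]_(x in A) (h x `^ p)%:E)%E.
  by apply: integral_ge0 => x _; rewrite lee_fin powR_ge0.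
have := gt0_ler_poweR (ltW p0) _ _ le; rewrite !in_itv/= !leey !andbT.
move=> /(_ hA0 _); rewrite mule_ge0 ?poweR_ge0// => /(_ isT).
rewrite poweRM ?poweR_ge0// -!poweRrM mulVf ?gt_eqF// poweRe1//.
rewrite muleC; congr (_ <= _ `^ _ * _)%E.
by rewrite /q invf_div -mulrA mulVf ?mulr1// gt_eqF.
Qed.

End Jensen.

Section ProbabilityLp.
Context {disp} {T : measurableType disp} {R : realType}.
Context (P : probability T R) (p : R) (p1 : 1 <= p).
Local Notation Lp := (Lp P p1).
Implicit Types (F G : Lp) (f g : T -> R[i]).

Let p0 : 0 < p. Proof. exact: lt_le_trans p1. Qed.

Lemma integral_normc_le f : cmeasurable f ->
  (\int[P]_x (normc (f x))%:E <= cLnorm P p f)%E.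
Proof.
move=> mf.
have i0 : (0 <= \int[P]_x (normc (f x))%:E)%E.
  by apply: integral_ge0 => x _; rewrite lee_fin normc_ge0.
have := jensen_powR P p1 measurableT (measurable_normc mf) (fun x => normc_ge0 (f x)).
rewrite /= probability_setT poweR1r mul1e -/(cmass P p f) => le.
have := @gt0_ler_poweR R p^-1 _ _ _ _ _ le.
rewrite !in_itv/= !leey !andbT poweR_ge0 invr_ge0 (ltW p0) cmass_ge0 -cLnormE//.
by move=> /(_ isT isT isT); rewrite -poweRrM mulfV ?gt_eqF// poweRe1.
Qed.

Lemma integrable_normc f : f \in cLfun P p ->
  P.-integrable setT (fun x => (normc (f x))%:E).
Proof.
move=> /cLfunP[mf lf]; apply/integrableP; split.
  by apply/measurable_EFinP; exact: measurable_normc.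
under eq_integral => x _ do rewrite /= ger0_norm ?normc_ge0//.
exact: le_lt_trans (integral_normc_le mf) lf.
Qed.

(** Test functions, bounded at every point and not merely almost everywhere: products over
    coordinates then stay bounded with no null set to follow. *)
Definition cbounded g := cmeasurable g /\ exists M, forall x, normc (g x) <= M.

Lemma cbounded_lin a g h : cbounded g -> cbounded h -> cbounded (fun x => a * g x + h x).
Proof.
move=> [mg [M hM]] [mh [N hN]]; split.
  by apply: (@cmeasurableD _ _ _ (a *: g) h) => //; exact: cmeasurableZ.
exists (normc a * M + N) => x.
by rewrite (le_trans (le_normcD _ _))// lerD// normcM ler_wpM2l ?normc_ge0.
Qed.

Lemma cbounded_cst c : cbounded (fun _ : T => c).
Proof. by split; [exact: cmeasurable_cst|exists (normc c)]. Qed.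

Lemma cbounded_sum (I : Type) (s : seq I) (g : I -> T -> R[i]) :
  (forall i, cbounded (g i)) -> cbounded (fun x => \sum_(i <- s) g i x).
Proof.
move=> bg; elim: s => [|i s IH].
  by under eq_fun do rewrite big_nil; exact: cbounded_cst.
under eq_fun do rewrite big_cons -[g i _]mul1r.
exact: cbounded_lin.
Qed.

Lemma cbounded_indic (A : set T) : measurable A -> cbounded (\1_A : T -> R[i]).
Proof.
move=> mA; have -> : (\1_A : T -> R[i]) = (fun x => ((\1_A x : R))%:C%C).
  by apply/funext => x; rewrite !indicE; case: (_ \in _).
split; first by apply: cmeasurable_real; exact: measurable_indic.
exists 1 => x; rewrite normc_real indicE; case: (_ \in _); rewrite /= ?normr1//.
by rewrite normr0.
Qed.

Lemma cintegrable_pair f g : f \in cLfun P p -> cbounded g ->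
  cintegrable P (fun x => f x * g x).
Proof.
move=> fL [mg [M hM]].
have M0 : 0 <= M by exact: le_trans (normc_ge0 _) (hM point).
apply: (@le_cintegrable _ _ _ _ _ (fun x => M * normc (f x))).
- apply: cmeasurableM => //; by have /cLfunP[] := fL.
- have := integrableZl measurableT M (integrable_normc fL).
  by apply: eq_integrable => // x _ /=; rewrite EFinM.
- by move=> x; rewrite normcM mulrC ler_wpM2r// normc_ge0.
Qed.

Definition pairing F g : R[i] := cint P (fun x => Lp_fun F x * g x).

Lemma pair_lin g : cbounded g -> forall a F G,
  pairing (a *: F + G) g = a * pairing F g + pairing G g.
Proof.
move=> bg a F G; have [mg _] := bg.
have iF := cintegrable_pair (Lp_fun_cLfun F) bg.
have iG := cintegrable_pair (Lp_fun_cLfun G) bg.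
rewrite /pairing -cintZ// -cintD//; last exact: cintegrableZ.
apply: ae_eq_cint.
- by apply: cmeasurableM => //; exact: cmeasurable_Lp_fun.
- apply: cintegrable_measurable (cintegrableD (cintegrableZ a iF) iG).
- by apply: filterS (Lp_fun_lin a F G) => x ->; rewrite mulrDl mulrA.
Qed.

Lemma pair_linr F a g h : cbounded g -> cbounded h ->
  pairing F (fun x => a * g x + h x) = a * pairing F g + pairing F h.
Proof.
move=> bg bh.
have ig := cintegrable_pair (Lp_fun_cLfun F) bg.
have ih := cintegrable_pair (Lp_fun_cLfun F) bh.
rewrite /pairing -cintZ// -cintD//; last exact: cintegrableZ.
by congr cint; apply/funext => x; rewrite mulrDr mulrCA.
Qed.

Lemma pair0r F : pairing F (fun=> 0) = 0.
Proof.
rewrite /pairing; under eq_fun do rewrite mulr0; exact: cint_cst.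
Qed.

Lemma pair_sumr F (I : Type) (s : seq I) (a : I -> R[i]) (g : I -> T -> R[i]) :
  (forall i, cbounded (g i)) ->
  pairing F (fun x => \sum_(i <- s) a i * g i x) = \sum_(i <- s) a i * pairing F (g i).
Proof.
move=> bg; elim: s => [|i s IH].
  by under eq_fun do rewrite big_nil; rewrite big_nil pair0r.
under eq_fun do rewrite big_cons.
rewrite pair_linr ?IH ?big_cons//; apply: cbounded_sum => j.
under eq_fun do rewrite -[_ * _]addr0.
by apply: cbounded_lin => //; exact: cbounded_cst.
Qed.

Lemma pair_sum (I : Type) (s : seq I) (a : I -> R[i]) (F : I -> Lp) g :
  cbounded g -> pairing (\sum_(i <- s) a i *: F i) g = \sum_(i <- s) a i * pairing (F i) g.
Proof.
move=> bg; elim: s => [|i s IH].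
  rewrite !big_nil; have := pair_lin bg (-1) 0 0.
  by rewrite scaler0 addr0 mulN1r addNr.
by rewrite !big_cons pair_lin// IH.
Qed.

Lemma normc_pair_le g M : cmeasurable g -> (forall x, normc (g x) <= M) ->
  forall F, normc (pairing F g) <= 2 * M * rnorm F.
Proof.
move=> mg hM F.
have M0 : 0 <= M by exact: le_trans (normc_ge0 _) (hM point).
have iF := integrable_normc (Lp_fun_cLfun F).
have := @normc_cint_le _ _ _ P (fun x => Lp_fun F x * g x)
  (fun x => M * normc (Lp_fun F x)).
move=> /(_ _ _ _) h; rewrite /pairing; apply: le_trans (h _ _ _) _.
- by apply: cmeasurableM => //; exact: cmeasurable_Lp_fun.
- have := integrableZl measurableT M iF.
  by apply: eq_integrable => // x _ /=; rewrite EFinM.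
- by move=> x; rewrite normcM mulrC ler_wpM2r// normc_ge0.
rewrite RintegralZl// -mulrA ler_pM2l// ler_wpM2l//.
rewrite -lee_fin rnorm_LpE /Rintegral fineK; last exact: integrable_fin_num.
by apply: integral_normc_le; exact: cmeasurable_Lp_fun.
Qed.

(** Indicators suffice: real and imaginary parts whose integrals over all measurable sets vanish are
    0 almost everywhere. *)
Lemma pair_eq0 F : (forall g, cbounded g -> pairing F g = 0) -> F = 0.
Proof.
move=> h.
have iF g : cbounded g -> cintegrable P (fun x => Lp_fun F x * g x).
  by move=> bg; apply: cintegrable_pair => //; exact: Lp_fun_cLfun.
have indicM (A : set T) (a : R) (x : T) : a * \1_A x = ((fun=> a) \_ A) x.
  by rewrite patchE indicE; case: ifPn => _; rewrite ?mulr1 ?mulr0.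
(* Both parts are handled at once through their compatibility with real scalars. *)
have z1 (f : R[i] -> R) : (forall (z : R[i]) (a : R), f (z * a%:C%C) = f z * a) ->
    P.-integrable setT (fun x => (f (Lp_fun F x))%:E) ->
    (forall A, measurable A -> \int[P]_x f (Lp_fun F x * (\1_A x : R)%:C%C) = 0) ->
    {ae P, forall x, f (Lp_fun F x) = 0}.
  move=> fM fi fA.
  have := @integral_ae_eq _ _ _ P setT measurableT (cst 0%E) _ fi.
  move=> /(_ (measurable_cst _)) h'.
  have : ae_eq P setT (fun x => (f (Lp_fun F x))%:E) (cst 0%E).
    apply: h' => E _ mE; rewrite integral0.
    have iE : P.-integrable E (fun x => (f (Lp_fun F x))%:E).
      exact: integrableS fi.
    rewrite -(fineK (integrable_fin_num mE iE)).
    congr EFin; rewrite -[LHS]/(\int[P]_(x in E) f (Lp_fun F x)) Rintegral_mkcond.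
    rewrite -[RHS](fA E mE); apply: eq_Rintegral => x _.
    rewrite fM indicM//.
  by apply: filterS => x /(_ I) [].
have hA A : measurable A -> cint P (fun x => Lp_fun F x * (\1_A x : R)%:C%C) = 0.
  move=> mA; rewrite -(h _ (cbounded_indic mA)); congr cint; apply/funext => x.
  by rewrite !indicE; case: (_ \in _).
have [iR iI] : cintegrable P (fun x => Lp_fun F x).
  have := iF _ (cbounded_cst 1); by under eq_fun do rewrite mulr1.
have r0 : {ae P, forall x, complex.Re (Lp_fun F x) = 0}.
  apply: z1 => // [[a b] c|A mA]; first by rewrite /= mulr0 subr0.
  by have [] := hA A mA.
have i0 : {ae P, forall x, complex.Im (Lp_fun F x) = 0}.
  apply: z1 => // [[a b] c|A mA]; first by rewrite /= mulr0 add0r.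
  by have [] := hA A mA.
apply: rnorm_eq0; apply: EFin_inj; rewrite rnorm_LpE.
apply/(cLnorm_eq0P P p1 (cmeasurable_Lp_fun F)).
apply: filterS2 r0 i0 => x; case: (Lp_fun F x) => a b /= -> ->.
by [].
Qed.

End ProbabilityLp.

(** * Finite rank operators *)

Section LpMaps.
Context {disp} {T : measurableType disp} {R : realType}.
Context (P : probability T R) (p : R) (p1 : 1 <= p) (d : nat).
Local Notation Lp := (Lp P p1).
Local Notation LpB := ((fun _ : 'I_d => Lp : normedModType R[i])).
Local Notation LpW := (Defs.Lp (power_measure P d) p1).

Let p0 : 0 < p. Proof. exact: lt_le_trans p1. Qed.

Lemma dfwith_if (V : Type) (f : 'I_d -> V) i x k :
  dfwith f i x k = if k == i then x else f k.
Proof.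
case: dfwithP => [|l]; first by rewrite eqxx.
by rewrite eq_sym => /negbTE ->.
Qed.

Definition tensor_fun (f : 'I_d -> Lp) (x : d.-tuple T) : R[i] :=
  \prod_(i < d) Lp_fun (f i) (tnth x i).

Lemma cmeasurable_tensor_fun f : cmeasurable (tensor_fun f).
Proof.
apply: cmeasurable_prod => i.
apply: (cmeasurable_comp (f := Lp_fun (f i))); first exact: measurable_tnth_fun.
exact: cmeasurable_Lp_fun.
Qed.

Lemma normc_prod (I : Type) (s : seq I) (z : I -> R[i]) :
  normc (\prod_(i <- s) z i) = \prod_(i <- s) normc (z i).
Proof. by elim/big_rec2: _ => [|i x y _ <-]; rewrite ?normc1 ?normcM. Qed.

Lemma powR_prod (I : Type) (s : seq I) (z : I -> R) q : (forall i, 0 <= z i) ->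
  (\prod_(i <- s) z i) `^ q = \prod_(i <- s) (z i `^ q).
Proof.
move=> z0; elim: s => [|i s IH]; first by rewrite !big_nil powR1.
by rewrite !big_cons powRM ?prodr_ge0// IH.
Qed.

(** Rewrites a real integral as a complex one, so that [cint_power] also computes norms. *)
Lemma cmass_cint {d'} {S : measurableType d'} (Q : probability S R) f :
  cmeasurable f ->
  cintegrable Q (fun x => (normc (f x) `^ p)%:C%C) -> 
  cmass Q p f = (complex.Re (cint Q (fun x => (normc (f x) `^ p)%:C%C)))%:E.
Proof.
move=> mf [iR _]; rewrite /cmass /cint /= /Rintegral fineK//.
exact: integrable_fin_num.
Qed.

Lemma cintegrable_normcX {d'} {S : measurableType d'} (Q : probability S R) f :
  f \in cLfun Q p -> cintegrable Q (fun x => (normc (f x) `^ p)%:C%C).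
Proof.
move=> /cLfunP[mf lf]; split => /=; last exact: integrable0.
apply/integrableP; split; first exact: measurable_normcX.
under eq_integral => x _ do rewrite gee0_abs ?lee_fin ?powR_ge0//.
by rewrite -cLnorm_lty.
Qed.

(** The function |f_1|^p ... |f_d|^p is again a product of functions of separate variables; this is
    the cross norm property of L_p(mu^d). *)
Lemma cmass_tensor_fun f :
  cmass (power_measure P d) p (tensor_fun f) = (\prod_(i < d) (rnorm (f i) `^ p))%:E.
Proof.
pose h (i : 'I_d) x : R[i] := (normc (Lp_fun (f i) x) `^ p)%:C%C.
have ih i : cintegrable P (h i).
  by apply: cintegrable_normcX; exact: Lp_fun_cLfun.
have [iH cH] := cint_power ih.
have HE : (fun x : d.-tuple T => \prod_(i < d) h i (tnth x i)) =
    fun x => (normc (tensor_fun f x) `^ p)%:C%C.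
  apply/funext => x; rewrite normc_prod powR_prod; last by move=> i; exact: normc_ge0.
  by rewrite rmorph_prod.
rewrite HE in iH cH.
rewrite cmass_cint//; last exact: cmeasurable_tensor_fun.
rewrite cH (_ : \prod_(i < d) cint P (h i) = (\prod_(i < d) (rnorm (f i) `^ p))%:C%C)//.
rewrite rmorph_prod; apply: eq_bigr => i _.
have := cmass_cint (cmeasurable_Lp_fun (f i)) (ih i).
rewrite -cLnorm_powR// -rnorm_LpE poweR_EFin => -[->].
rewrite /cint /=; congr (_ +i* _)%C.
rewrite /Rintegral; under eq_integral do rewrite /=.
by rewrite integral0.
Qed.

Lemma cLnorm_tensor_fun f :
  cLnorm (power_measure P d) p (tensor_fun f) = (\prod_(i < d) rnorm (f i))%:E.
Proof.
rewrite cLnormE// cmass_tensor_fun -powR_prod; last by move=> i; exact: rnorm_ge0.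
rewrite poweR_EFin -powRrM mulfV ?gt_eqF// powRr1//.
by apply: prodr_ge0 => i _; exact: rnorm_ge0.
Qed.

Lemma tensor_fun_cLfun f : tensor_fun f \in cLfun (power_measure P d) p.
Proof.
apply/cLfunP; split; first exact: cmeasurable_tensor_fun.
by rewrite cLnorm_tensor_fun ltry.
Qed.

Lemma ae_forall_fin (I : finType) {d'} {S : measurableType d'}
    (mu : {measure set S -> \bar R}) (Q : I -> S -> Prop) : (forall i, {ae mu, forall x, Q i x}) ->
  {ae mu, forall x, forall i, Q i x}.
Proof.
move=> h; suff : {ae mu, forall x, forall i, i \in enum I -> Q i x}.
  by apply: filterS => x hx i; apply: hx; rewrite mem_enum.
elim: (enum I) => [|j s IH]; first by apply: aeW.
apply: filterS2 (h j) IH => x Qj Qs i.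
by rewrite in_cons => /predU1P[->|]; [|exact: Qs].
Qed.

Lemma prod_dfwith (f : 'I_d -> Lp) i F (x : 'I_d -> T) :
  \prod_(k < d) Lp_fun (dfwith f i F k) (x k) =
    Lp_fun F (x i) * \prod_(k < d | k != i) Lp_fun (f k) (x k).
Proof.
rewrite (bigD1 i)//= dfwith_if eqxx; congr (_ * _).
by apply: eq_bigr => k /negbTE ki; rewrite dfwith_if ki.
Qed.

Definition tensor_map (f : forall i, LpB i) : LpW := mkLp p1 (tensor_fun_cLfun f).

Lemma tensor_map_multilinear : multilinear tensor_map.
Proof.
move=> f i a F G.
have hL : a *: tensor_fun (dfwith f i F) + tensor_fun (dfwith f i G)
    \in cLfun (power_measure P d) p.
  by rewrite rpredD ?rpredZ// tensor_fun_cLfun.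
rewrite /tensor_map -(mkLp_lin _ _ hL).
apply/mkLpP; have := ae_tnth i (Lp_fun_lin a F G).
apply: filterS => x h.
rewrite -[X in _ = X]/(a * tensor_fun (dfwith f i F) x + tensor_fun (dfwith f i G) x).
rewrite /tensor_fun !(prod_dfwith f i _ (tnth x)) h.
by rewrite mulrDl mulrA.
Qed.

Lemma rnorm_tensor_map f : rnorm (tensor_map f) = \prod_(i < d) rnorm (f i).
Proof. by apply: EFin_inj; rewrite rnorm_mkLp cLnorm_tensor_fun. Qed.

Section finite_rank.
Context {I : finType} (g : I -> T -> R[i]) (e : I -> Lp).
Hypothesis bg : forall k, cbounded (g k).

(** Used with two families: operators fixing given vectors ([finite_rank_fixing]) and conditional
    expectations ([cond_exp]). *)
Definition finite_rank (F : Lp) : Lp := \sum_k pairing F (g k) *: e k.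

Lemma finite_rank_lin a F G :
  finite_rank (a *: F + G) = a *: finite_rank F + finite_rank G.
Proof.
rewrite /finite_rank scaler_sumr -big_split; apply: eq_bigr => k _ /=.
by rewrite pair_lin// scalerDl scalerA.
Qed.

(** The tensor product of the functionals attached to [g (k i)], defined on all of L_p(mu^d) and not
    only on tensors. *)
Definition pair_power (u : LpW) (k : 'I_d -> I) : R[i] :=
  pairing u (fun x => \prod_(i < d) g (k i) (tnth x i)).

Lemma prod_bound k : exists M, forall x : d.-tuple T,
  normc (\prod_(i < d) g (k i) (tnth x i)) <= M.
Proof.
have [M hM] : exists M : 'I_d -> R, forall i x, normc (g (k i) x) <= M i.
  by have [M hM] := choice (fun i => (bg (k i)).2); exists M.
exists (\prod_(i < d) M i) => x; rewrite normc_prod; apply: ler_prod => i _.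
by rewrite normc_ge0 hM.
Qed.

Lemma cbounded_prod k : cbounded (fun x : d.-tuple T => \prod_(i < d) g (k i) (tnth x i)).
Proof.
split; last exact: prod_bound.
apply: cmeasurable_prod => i.
apply: (cmeasurable_comp (f := g (k i))); first exact: measurable_tnth_fun.
by have [] := bg (k i).
Qed.

Lemma pair_tensor_map f k :
  pair_power (tensor_map f) k = \prod_(i < d) pairing (f i) (g (k i)).
Proof.
pose h (i : 'I_d) x := Lp_fun (f i) x * g (k i) x.
have ih i : cintegrable P (h i).
  exact: (cintegrable_pair p1 (Lp_fun_cLfun (f i)) (bg (k i))).
have [iH cH] := cint_power ih.
rewrite /pair_power /pairing -cH; apply: ae_eq_cint.
- apply: cmeasurableM; first exact: cmeasurable_Lp_fun.
  by have [] := cbounded_prod k.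
- exact: cintegrable_measurable iH.
- by apply: filterS (mkLpK p1 (tensor_fun_cLfun f)) => x ->; rewrite -big_split.
Qed.

Lemma elem_tensor_scale (V : normedModType R[i]) (c : 'I_d -> R[i]) (f : 'I_d -> V) :
  elem_tensor (B := fun=> V) (fun i => c i *: f i) =
  (\prod_(i < d) c i) *: elem_tensor (B := fun=> V) f.
Proof.
(* Scale only the coordinates in a sublist and induct on it. *)
suff h : elem_tensor (B := fun=> V)
      (fun i => if i \in index_enum 'I_d then c i *: f i else f i) =
    (\prod_(i < d) c i) *: elem_tensor (B := fun=> V) f.
  by rewrite -h; congr elem_tensor; apply/funext => i; rewrite mem_index_enum.
have := index_enum_uniq 'I_d.
elim: (index_enum 'I_d) => [_|j s IH /= /andP[js us]].
  by rewrite big_nil scale1r.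
rewrite big_cons -scalerA -IH//.
set h := (fun i => if i \in s then _ else _).
have hj : dfwith h j (f j) = h.
  apply/funext => i; rewrite dfwith_if; case: eqP => [->|//].
  by rewrite /h (negbTE js).
have -> : (fun i => if i \in j :: s then c i *: f i else f i) = dfwith h j (c j *: f j).
  apply/funext => i; rewrite dfwith_if in_cons; case: eqP => [->//|//].
have z : elem_tensor (B := fun=> V) (dfwith h j 0) = 0.
  have := elem_tensor_multilinear (B := fun=> V) h (i := j) (-1) 0 0.
  by rewrite scaler0 addr0 scaleN1r addNr.
have := elem_tensor_multilinear (B := fun=> V) h (i := j) (c j) (f j) 0.
by rewrite addr0 z addr0 hj.
Qed.

Lemma tensor_finite_rank : exists Tt : {linear tensor LpB -> tensor LpB},
  forall f, Tt (elem_tensor f) = elem_tensor (B := LpB) (fun i => finite_rank (f i)).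
Proof.
apply: (@tensor_lift _ _ _ _
  (fun f : forall i, LpB i => elem_tensor (B := LpB) (fun i => finite_rank (f i)))).
move=> f i a F G.
have hd H : (fun k => finite_rank (dfwith f i H k)) =
    dfwith (fun k => finite_rank (f k)) i (finite_rank H).
  by apply/funext => k; rewrite !dfwith_if; case: eqP.
rewrite (hd (a *: F + G)) (hd F) (hd G) finite_rank_lin.
exact: elem_tensor_multilinear.
Qed.

Lemma tensor_ind (B : 'I_d -> normedModType R[i]) (Q : tensor B -> Prop) :
  Q 0 -> (forall a u v, Q u -> Q v -> Q (a *: u + v)) ->
  (forall f, Q (elem_tensor f)) -> forall u, Q u.
Proof.
move=> Q0 Ql Qe u; rewrite (tensor_sumE u).
elim: (dom _) => [|f s IH]; first by rewrite big_nil.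
by rewrite big_cons; exact: Ql.
Qed.

(** The tensor power of a finite rank operator sees [u] only through integrals of [j u]. Both the
    injectivity of [j] and the bound by [rnorm (j u)] rest on this formula. *)
Lemma tensor_finite_rankE (j : {linear tensor LpB -> LpW})
    (Tt : {linear tensor LpB -> tensor LpB}) :
  (forall f, j (elem_tensor f) = tensor_map f) ->
  (forall f, Tt (elem_tensor f) = elem_tensor (B := LpB) (fun i => finite_rank (f i))) ->
  exists ks : seq ('I_d -> I), forall u,
    Tt u = \sum_(k <- ks) pair_power (j u) k *: elem_tensor (B := LpB) (fun i => e (k i)).
Proof.
move=> jE TE; have [ks hks] := @multilinear_expand R d Lp (tensor LpB) I.
exists ks; apply: tensor_ind => [|a u v IHu IHv|f].
- rewrite linear0 big1// => k _; rewrite linear0.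
  have := pair_lin (cbounded_prod k) (-1) (0 : LpW) 0.
  rewrite scaler0 addr0 mulN1r addNr => h.
  by rewrite /pair_power h scale0r.
- rewrite !linearP IHu IHv scaler_sumr -big_split; apply: eq_bigr => k _ /=.
  rewrite /pair_power pair_lin; last exact: cbounded_prod.
  by rewrite scalerDl scalerA.
- rewrite TE (hks (fun f => elem_tensor (B := LpB) f)
    (fun i k => pairing (f i) (g k) *: e k)); last first.
    by move=> h i a F G; exact: elem_tensor_multilinear.
  apply: eq_bigr => k _.
  rewrite (elem_tensor_scale (fun i => pairing (f i) (g (k i)))).
  by rewrite jE pair_tensor_map.
Qed.

End finite_rank.
End LpMaps.

(** * The norm of L_p(mu^d) is a cross norm on tensors *)

Section CrossNorm.
Context {disp} {T : measurableType disp} {R : realType}.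
Context (P : probability T R) (p : R) (p1 : 1 <= p).
Local Notation Lp := (Lp P p1).

(** Induction on the list. If [S] fixes [L] but not [F0], put v = F0 - S F0, separate [v] from 0 by
    a test function [h], and add the rank one term F |-> c <F - S F, h> v with c = 1 / <v, h>. It
    vanishes on whatever [S] fixes and sends [F0] to the missing [v]. *)
Lemma finite_rank_fixing (L : seq Lp) :
  exists n (g : 'I_n -> T -> R[i]) (e : 'I_n -> Lp),
    (forall k, cbounded (g k)) /\ forall F, F \in L -> finite_rank g e F = F.
Proof.
elim: L => [|F0 L [n [g [e [bg ge]]]]].
  by exists 0%N, (fun=> fun=> 0), (fun=> 0); split => // -[].
set S := finite_rank g e in ge.
have [v0|v0] := eqVneq ((-1) *: S F0 + F0) 0.
  exists n, g, e; split => // F; rewrite in_cons => /predU1P[->|/ge//].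
  by move/eqP: v0; rewrite scaleN1r addrC subr_eq0 => /eqP.
have [h [bh hv]] : exists h, cbounded h /\ pairing ((-1) *: S F0 + F0) h != 0.
  apply: contrapT => nh; move/eqP: v0; apply; apply: pair_eq0 => h bh.
  by apply/eqP/negPn/negP => hv; apply: nh; exists h.
set v := _ + F0 in v0 hv; pose c := (pairing v h)^-1.
(* The bounded function representing F |-> c <F - S F, h>: the adjoint of [S] has been moved onto
   [h]. *)
pose g0 x := c * h x + \sum_k (- c * pairing (e k) h) * g k x.
have bs : cbounded (fun x => \sum_k (- c * pairing (e k) h) * g k x).
  apply: cbounded_sum => k; under eq_fun do rewrite -[_ * _]addr0.
  by apply: cbounded_lin => //; exact: cbounded_cst.
have pair_g0 F : pairing F g0 = c * (pairing F h - pairing (S F) h).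
  rewrite pair_linr// pair_sumr// pair_sum// mulrBr; congr (_ + _).
  rewrite mulr_sumr -sumrN; apply: eq_bigr => k _.
  by rewrite !mulNr -mulrA; congr (- (_ * _)); rewrite mulrC.
pose g' (k : 'I_n.+1) := if unlift ord0 k is Some k' then g k' else g0.
pose e' (k : 'I_n.+1) := if unlift ord0 k is Some k' then e k' else v.
exists n.+1, g', e'; split.
  rewrite /g' => k; case: (unlift ord0 k) => [k'|]; first exact: bg.
  exact: cbounded_lin.
have S'E F : finite_rank g' e' F = (c * (pairing F h - pairing (S F) h)) *: v + S F.
  rewrite /finite_rank big_ord_recl /g' /e' unlift_none -pair_g0; congr (_ + _).
  by apply: eq_bigr => k _; rewrite liftK.
move=> F; rewrite S'E in_cons => /predU1P[->|/ge SF]; last first.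
  by rewrite SF subrr mulr0 scale0r add0r.
have -> : pairing F0 h - pairing (S F0) h = pairing v h.
  by rewrite /v pair_lin// mulN1r addrC.
by rewrite mulVf// scale1r /v scaleN1r addrAC addNr add0r.
Qed.

Context (d : nat).
Local Notation LpB := ((fun _ : 'I_d => Lp : normedModType R[i])).
Local Notation LpW := (Defs.Lp (power_measure P d) p1).
Context (j : {linear tensor LpB -> LpW}).
Hypothesis jE : forall f, j (elem_tensor f) = tensor_map f.

(* A finite rank operator fixing the finitely many functions occurring in u
   writes u in terms of integrals of j u. *)
Lemma tensor_map_inj u : j u = 0 -> u = 0.
Proof.
move=> ju.
pose L := [seq f i | f <- dom (repr u), i <- enum 'I_d] : seq Lp.
have [n [g [e [bg ge]]]] := finite_rank_fixing L.
have [Tt TE] := tensor_finite_rank d e bg.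
have [ks hks] := tensor_finite_rankE bg jE TE.
have Tu : Tt u = u.
  rewrite {2}(tensor_sumE u) {1}(tensor_sumE u) linear_sum.
  apply: eq_big_seq => f fu; rewrite linearZ /= TE; congr (_ *: elem_tensor _).
  apply/funext => i; apply: ge; apply/allpairsP; exists (f, i) => /=.
  by rewrite mem_enum.
rewrite -Tu hks ju big1// => k _.
have := pair_lin (cbounded_prod bg k) (-1) (0 : LpW) 0.
by rewrite scaler0 addr0 mulN1r addNr /pair_power => ->; rewrite scale0r.
Qed.

Lemma cross_norm_ex : exists N0, cross_norm (B := LpB) N0.
Proof.
exists (fun u => rnorm (j u)); split; [split|] => [u v|a u|u ju|f].
- by rewrite linearD rnormD.
- by rewrite linearZ rnormZ.
- by apply: tensor_map_inj; exact: rnorm_eq0.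
- by rewrite jE rnorm_tensor_map.
Qed.

End CrossNorm.

(** * Simple functions and conditional expectations *)

Import HBNNSimple.

Section SimpleDense.
Context {disp} {T : measurableType disp} {R : realType}.
Context (P : probability T R) (p : R) (p1 : 1 <= p).

Let p0 : 0 < p. Proof. exact: lt_le_trans p1. Qed.

(** The cells are the fibres of [q], possibly empty; simple functions become [c \o q], and a common
    refinement is the pair of two maps. *)
Definition measurable_partition (I : finType) (q : T -> I) :=
  forall k, measurable (q @^-1` [set k]).

Lemma cbounded_partition (I : finType) (q : T -> I) (c : I -> R[i]) :
  measurable_partition q -> cbounded (c \o q).
Proof.
move=> mq.
have -> : c \o q = (fun x => \sum_k c k * (\1_(q @^-1` [set k]) x)).
  apply/funext => x /=; rewrite (bigD1 (q x))//= big1 => [|k /negP qk].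
    by rewrite addr0 indicE mem_set//= mulr1.
  rewrite indicE memNset ?mulr0//= => qx; apply: qk; exact/eqP.
apply: cbounded_sum => k; under eq_fun do rewrite -[_ * _]addr0.
by apply: cbounded_lin; [exact: cbounded_indic|exact: cbounded_cst].
Qed.

Lemma cbounded_cLfun (g : T -> R[i]) : cbounded g -> g \in cLfun P p.
Proof.
move=> [mg [M hM]]; apply/cLfunP; split => //.
have M0 : 0 <= M by exact: le_trans (normc_ge0 _) (hM point).
have : (cLnorm P p g <= M%:E)%E.
  rewrite cLnorm_le// /cmass.
  have <- : (\int[P]_x (M `^ p)%:E = (M `^ p)%:E)%E.
    by rewrite integral_cst//= probability_setT mule1.
  apply: ge0_le_integral => //.
  - by move=> x _; rewrite lee_fin powR_ge0.
  - exact: measurable_normcX.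
  - by move=> x _; rewrite lee_fin ge0_ler_powR ?nnegrE ?normc_ge0// ltW.
by move=> /le_lt_trans -> //; rewrite ltry.
Qed.

Definition simple_approx (f : T -> R[i]) := forall e : R, 0 < e ->
  exists (I : finType) (q : T -> I) (c : I -> R[i]), measurable_partition q /\
    (cLnorm P p (f - (c \o q))%R <= e%:E)%E.

Lemma measurable_partition_pair (I J : finType) (q : T -> I) (r : T -> J) :
  measurable_partition q -> measurable_partition r ->
  measurable_partition (fun x => (q x, r x)).
Proof.
move=> mq mr [k l].
rewrite (_ : _ @^-1` _ = q @^-1` [set k] `&` r @^-1` [set l]).
  exact: measurableI.
by apply/seteqP; split => x /= [-> ->].
Qed.

Lemma simple_approx_lin a f g : cmeasurable f -> cmeasurable g ->
  simple_approx f -> simple_approx g -> simple_approx (a *: f + g).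
Proof.
move=> mf mg hf hg e e0.
(* The 1 keeps the divisor positive when [a] is 0. *)
have a0 : 0 < normc a + 1 by rewrite ltr_wpDl// normc_ge0.
have [I [q [c [mq qe]]]] := hf (e / 2 / (normc a + 1)) ltac:(by rewrite !divr_gt0).
have [J [r [b [mr re]]]] := hg (e / 2) ltac:(by rewrite divr_gt0).
exists (I * J)%type, (fun x => (q x, r x)), (fun k => a * c k.1 + b k.2).
split; first exact: measurable_partition_pair.
have [mc _] := cbounded_partition c mq; have [mb _] := cbounded_partition b mr.
rewrite (_ : _ - _ = a *: (f - (c \o q)) + (g - (b \o r))); last first.
  apply/funext => x; rewrite !fctE /= scalerBr opprD addrACA.
  by [].
have mfc := cmeasurableB mf mc; have mgb := cmeasurableB mg mb.
apply: (le_trans (cLnormD P p1 (cmeasurableZ a mfc) mgb)).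
rewrite [e]splitr EFinD leeD// cLnormZ//.
apply: (@le_trans _ _ ((normc a)%:E * (e / 2 / (normc a + 1))%:E)%E).
  by apply: lee_wpmul2l => //; rewrite lee_fin normc_ge0.
rewrite -EFinM lee_fin mulrA ler_pdivrMr// [leLHS]mulrC ler_wpM2l ?lerDl//.
by rewrite divr_ge0// ltW.
Qed.

(** As p >= 1, the power is at most [s n] as soon as [s n] is at most 1. *)
Lemma cvg0_powR (s : nat -> R) : (forall n, 0 <= s n) ->
  s n @[n --> \oo] --> (0 : R) -> s n `^ p @[n --> \oo] --> (0 : R).
Proof.
move=> s0 sl; apply: (squeeze_cvgr _ (cvg_cst (0 : R)) sl).
have := sl => /cvgrPdist_le /(_ 1 ltr01); apply: filterS => n /=.
rewrite sub0r normrN ger0_norm// => sn1; rewrite powR_ge0/=.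
have := s0 n; rewrite le_eqVlt => /predU1P[<-|sn0].
  by rewrite powR0// gt_eqF.
by rewrite -[leRHS]powRr1// ger_powR// sn0.
Qed.

Lemma nnsfun_partition (s : {nnsfun T >-> R}) :
  exists (I : finType) (q : T -> I) (c : I -> R),
    measurable_partition q /\ s = c \o q :> (T -> R).
Proof.
have fs x : s x \in fset_set (range s) by rewrite in_fset_set ?inE.
exists (fset_set (range s)), (fun x => [` fs x]%fset), val; split=> [k|].
  rewrite (_ : _ @^-1` _ = s @^-1` [set val k]); first exact: measurable_sfunP.
  by apply/seteqP; split => x /= => [<-//|xk]; apply/val_inj.
by apply/funext.
Qed.

(** Dominated convergence for (h - s_n)^p, bounded by h^p, with [s] simple functions increasing to
    [h]. *)
Lemma simple_approx_ge0 (h : T -> R) : measurable_fun setT h ->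
  (forall x, 0 <= h x) -> (fun x => (h x)%:C%C) \in cLfun P p ->
  simple_approx (fun x => (h x)%:C%C).
Proof.
move=> mh h0 hL e e0.
have [s [nds sh]] := @approximation _ T R setT measurableT (EFin \o h)
  ltac:(exact/measurable_EFinP) (fun t _ => h0 t).
have {}sh x : s n x @[n --> \oo] --> h x.
  by have /fine_cvgP[_] := sh x I.
have s_le n x : s n x <= h x.
  rewrite -(cvg_lim _ (sh x))//; apply: nondecreasing_cvgn_le.
    by move=> m k mk; have /lefP := nds _ _ mk; exact.
  by apply/cvg_ex; exists (h x).
pose F n x := ((h x - s n x) `^ p)%:E.
have mF n : measurable_fun setT (F n).
  apply/measurable_EFinP.
  apply: (@measurableT_comp _ _ _ _ _ _ (fun x : R => x `^ p)) => //.
  exact: measurable_funB.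
have ih : P.-integrable setT (fun x => (h x `^ p)%:E).
  apply/integrableP; split.
    apply/measurable_EFinP.
    exact: (@measurableT_comp _ _ _ _ _ _ (fun x : R => x `^ p)).
  have /cLfunP[_] := hL; rewrite cLnorm_lty// /cmass.
  under eq_integral => x _ do rewrite normc_real (ger0_norm (h0 x)).
  by under [X in _ -> (X < _)%E]eq_integral => x _ do
    rewrite gee0_abs ?lee_fin ?powR_ge0//.
have F0 : {ae P, forall x, setT x -> F n x @[n --> \oo] --> (cst 0%E : T -> \bar R) x}.
  apply: aeW => x _; apply: cvg_EFin; first exact: nearW.
  apply: cvg0_powR => [n|]; first by rewrite subr_ge0.
  by rewrite -(subrr (h x)); apply: cvgB => //; exact: cvg_cst.
have Fh : {ae P, forall x n, setT x -> (`|F n x| <= (h x `^ p)%:E)%E}.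
  apply: aeW => x n _; rewrite gee0_abs ?lee_fin ?powR_ge0//.
  by rewrite ge0_ler_powR ?nnegrE ?subr_ge0 ?(ltW p0)// gerBl.
have [_ _ dc] := dominated_convergence measurableT mF (measurable_cst _) F0 ih Fh.
have {}dc : (\int[P]_x F n x)%E @[n --> \oo] --> 0%E.
  by move: dc; rewrite integral0.
have ep0 : 0 < e `^ p by rewrite powR_gt0.
have [n le_n] : exists n, (\int[P]_x F n x <= (e `^ p)%:E)%E.
  have /fine_cvgP[fin /cvgrPdist_le /(_ _ ep0) le] := dc.
  have [n [/= fn]] := filter_ex (filterI fin le).
  rewrite sub0r normrN => len; exists n; rewrite -(fineK fn) lee_fin.
  by rewrite (le_trans (ler_norm _)).
have [I [q [c [mq sE]]]] := nnsfun_partition (s n).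
exists I, q, (fun k => (c k)%:C%C); split => //.
rewrite (cLnorm_le P p1 _ (ltW e0)) /cmass.
rewrite (_ : (fun x => _) = F n)//; apply/funext => x; rewrite /F.
rewrite -[X in normc X]/((h x)%:C%C - (c (q x))%:C%C) -rmorphB normc_real.
by have /(congr1 (@^~ x)) /= <- := sE; rewrite ger0_norm// subr_ge0.
Qed.

Lemma simple_approx_cLfun f : f \in cLfun P p -> simple_approx f.
Proof.
move=> fL; have /cLfunP[[fr fi] lf] := fL.
pose pos (h : T -> R) x := Num.max (h x) 0.
have mpos (h : T -> R) : measurable_fun setT h -> measurable_fun setT (pos h).
  by move=> mh; apply: measurable_maxr => //; exact: measurable_cst.
have posC (h : T -> R) : measurable_fun setT h -> (forall x, `|h x| <= normc (f x)) ->
    (fun x => (pos h x)%:C%C) \in cLfun P p.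
  move=> mh hf; apply/cLfunP; split; first exact/cmeasurable_real/mpos.
  rewrite (cLnorm_lty P p1); move: lf; rewrite (cLnorm_lty P p1); apply: le_lt_trans.
  apply: le_cmass => //; first exact/cmeasurable_real/mpos.
  apply: aeW => x; rewrite normc_real (le_trans _ (hf x))// /pos ger0_norm.
    by rewrite ge_max normr_ge0 ler_norm.
  by rewrite le_max lexx orbT.
have posA (h : T -> R) : measurable_fun setT h -> (forall x, `|h x| <= normc (f x)) ->
    simple_approx (fun x => (pos h x)%:C%C).
  move=> mh hf; apply: simple_approx_ge0; [exact: mpos| |exact: posC].
  by move=> x; rewrite le_max lexx orbT.
pose re x := complex.Re (f x); pose im x := complex.Im (f x).
have [rf imf] : (forall x, `|re x| <= normc (f x)) /\ (forall x, `|im x| <= normc (f x)).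
  by split => x; [exact: normc_Re_le|exact: normc_Im_le].
have [nrf nimf] : (forall x, `|- re x| <= normc (f x)) /\ (forall x, `|- im x| <= normc (f x)).
  by split => x; rewrite normrN.
have mr : measurable_fun setT re by [].
have mi : measurable_fun setT im by [].
have mnr : measurable_fun setT (fun x => - re x) by exact: measurable_funN.
have mni : measurable_fun setT (fun x => - im x) by exact: measurable_funN.
(* Positive and negative parts of the real and imaginary parts. The final zero gives every layer the
   shape [a *: _ + g] treated by [L] and [M]. *)
have -> : f = 1 *: (fun x => (pos re x)%:C%C) +
   ((-1) *: (fun x => (pos (fun x => - re x) x)%:C%C) +
   ('i%C *: (fun x => (pos im x)%:C%C) +
   ((- 'i%C) *: (fun x => (pos (fun x => - im x) x)%:C%C) + (0 : T -> R[i])))).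
  apply/funext => x; rewrite !fctE addr0.
  have posB (a : R) : a = Num.max a 0 - Num.max (- a) 0.
    case: (leP a 0) => a0.
      have na : 0 <= - a by rewrite oppr_ge0.
      by rewrite (max_l na) sub0r opprK.
    have na : - a <= 0 by rewrite oppr_le0 ltW.
    by rewrite (max_r na) subr0.
  rewrite scale1r scaleN1r /GRing.scale /= mulNr addrA -rmorphB -mulrBr -rmorphB.
  rewrite /pos -!posB /re /im; case: (f x) => a b /=.
  by apply/eqP; rewrite eq_complex/= !mul0r !mul1r !subr0 ?addr0 ?add0r !eqxx.
have zA : simple_approx (0 : T -> R[i]).
  move=> e e0; exists unit, (fun=> tt), (fun=> 0); split.
    move=> k; rewrite (_ : _ @^-1` _ = setT)//.
    by apply/seteqP; split => // x _ /=; case: k.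
  rewrite (_ : _ - _ = 0); first by rewrite cLnorm0// lee_fin ltW.
  by apply/funext => x; rewrite !fctE /= subr0.
have cm (h : T -> R) : measurable_fun setT h -> cmeasurable (fun x => (pos h x)%:C%C).
  by move=> mh; exact/cmeasurable_real/mpos.
have z : cmeasurable (0 : T -> R[i]) by exact: cmeasurable0.
have L (a : R[i]) (h : T -> R) g : measurable_fun setT h ->
    (forall x, `|h x| <= normc (f x)) -> cmeasurable g -> simple_approx g ->
    simple_approx (a *: (fun x => (pos h x)%:C%C) + g).
  by move=> mh hf mg; apply: simple_approx_lin => //; [exact: cm|exact: posA].
have M (a : R[i]) (h : T -> R) g : measurable_fun setT h -> cmeasurable g ->
    cmeasurable (a *: (fun x => (pos h x)%:C%C) + g).
  by move=> mh mg; apply: cmeasurableD => //; apply: cmeasurableZ; exact: cm.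
have m4 := M (- 'i%C) _ _ mni z.
have m3 := M 'i%C _ _ mi m4; have m2 := M (-1) _ _ mnr m3.
exact: (L 1 _ _ mr rf m2 (L (-1) _ _ mnr nrf m3 (L 'i%C _ _ mi imf m4
  (L (- 'i%C) _ _ mni nimf z zA)))).
Qed.

End SimpleDense.

(** * Conditional expectations on finite partitions *)

Section ConditionalExpectation.
Context {disp} {T : measurableType disp} {R : realType}.
Context (P : probability T R) (p : R) (p1 : 1 <= p).
Local Notation Lp := (Lp P p1).

Let p0 : 0 < p. Proof. exact: lt_le_trans p1. Qed.

Section partition.
Context {I : finType} (q : T -> I) (mq : measurable_partition q).

Let A k := q @^-1` [set k].
Let a k : R := fine (P (A k)).

Let aE k : (a k)%:E = P (A k).
Proof. by rewrite fineK//; apply: fin_num_measure; exact: mq. Qed.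

Let a0 k : 0 <= a k.
Proof. by rewrite -lee_fin aE. Qed.

(** Pairing with it averages over the cell. On a null cell the inverse of 0 is 0, so the weight is
    0. *)
Definition cell_weight k x : R[i] := (a k)^-1%:C%C * \1_(A k) x.

Definition cell_indic k : Lp :=
  mkLp p1 (cbounded_cLfun P p1 (cbounded_indic (R := R) (mq k))).

Lemma cbounded_cell_weight k : cbounded (cell_weight k).
Proof.
rewrite /cell_weight; under eq_fun do rewrite -[_ * _]addr0.
by apply: cbounded_lin; [exact: cbounded_indic (mq k)|exact: cbounded_cst].
Qed.

(** The conditional expectation given the algebra generated by [q]: on each cell, the average over
    that cell. *)
Definition cond_exp : Lp -> Lp := finite_rank cell_weight cell_indic.

Lemma cond_exp_ae F :
  {ae P, forall x, Lp_fun (cond_exp F) x = pairing F (cell_weight (q x))}.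
Proof.
have h1 := Lp_fun_sum (index_enum I) (fun k => pairing F (cell_weight k) *: cell_indic k).
have h2 : {ae P, forall x, forall k, Lp_fun (pairing F (cell_weight k) *: cell_indic k) x =
    pairing F (cell_weight k) * Lp_fun (cell_indic k) x}.
  by apply: ae_forall_fin => k; exact: Lp_funZ.
have h3 : {ae P, forall x, forall k, Lp_fun (cell_indic k) x = \1_(A k) x}.
  by apply: ae_forall_fin => k; exact: mkLpK.
apply: filterS3 h1 h2 h3 => x e1 e2 e3; rewrite e1.
under eq_bigr do rewrite e2 e3.
rewrite (bigD1 (q x))//= big1 => [|k /negP qk].
  by rewrite addr0 indicE mem_set//= mulr1.
by rewrite indicE memNset ?mulr0//= => qx; apply: qk; exact/eqP.
Qed.

(** Jensen's inequality on one cell. Multiplying by [P (A k)] puts it in the form that is summed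
    over the cells in [rnorm_cond_exp]. *)
Lemma cell_bound (F : Lp) k :
  ((normc (pairing F (cell_weight k)) `^ p)%:E * P (A k) <=
   (2 `^ p)%:E * \int[P]_(x in A k) (normc (Lp_fun F x) `^ p)%:E)%E.
Proof.
have Fint := integrable_normc p1 (Lp_fun_cLfun F).
have FpL := cintegrable_normcX p1 (Lp_fun_cLfun F).
have iA : P.-integrable (A k) (fun x => (normc (Lp_fun F x))%:E).
  by apply: integrableS Fint => //; exact: mq.
have ipA : P.-integrable (A k) (fun x => (normc (Lp_fun F x) `^ p)%:E).
  by apply: integrableS FpL.1 => //; exact: mq.
have J := jensen_powR P p1 (mq k) (measurable_normc (cmeasurable_Lp_fun F))
  (fun x => normc_ge0 (Lp_fun F x)).
set s := (\int[P]_(x in A k) _)%E.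
have sfin : s \is a fin_num by apply: integrable_fin_num => //; exact: mq.
have s0 : 0 <= fine s.
  by apply/fine_ge0/integral_ge0 => x _; rewrite lee_fin powR_ge0.
pose m := \int[P]_(x in A k) normc (Lp_fun F x).
have m0 : 0 <= m by apply: Rintegral_ge0 => x _; exact: normc_ge0.
have {}J : m `^ p <= a k `^ (p - 1) * fine s.
  move: J; rewrite -/(A k) -/s -(fineK sfin) -[X in (_ <= X `^ _ * _)%E](aE k).
  rewrite -[X in (X `^ _ <= _)%E]fineK; last by apply: integrable_fin_num => //; exact: mq.
  by rewrite !poweR_EFin -EFinM lee_fin.
rewrite -(fineK sfin) -aE -!EFinM lee_fin.
have [ak0|ak0] := eqVneq (a k) 0.
  by rewrite ak0 mulr0 mulr_ge0// powR_ge0.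
have akp : 0 < a k by rewrite lt_neqAle eq_sym ak0 a0.
have b_le : normc (pairing F (cell_weight k)) <= 2 * ((a k)^-1 * m).
  have [mg _] := cbounded_cell_weight k.
  have ih : P.-integrable setT (EFin \o (fun x => (a k)^-1 *
      ((fun x => normc (Lp_fun F x)) \_ (A k)) x)).
    have := integrableZl measurableT (a k)^-1
      ((integrable_mkcond _ (mq k)).1 iA).
    apply: eq_integrable => // x _ /=; rewrite EFinM; congr (_ * _)%E.
    by rewrite !patchE; case: ifP.
  apply: le_trans (normc_cint_le _ ih _) _.
  - by apply: cmeasurableM => //; exact: cmeasurable_Lp_fun.
  - move=> x; rewrite /cell_weight normcM normcM normc_real ger0_norm ?invr_ge0//.
    rewrite mulrCA ler_wpM2l ?invr_ge0// patchE indicE.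
    by case: ifP => _; rewrite ?normc1 ?normc0 ?mulr1 ?mulr0.
  rewrite ler_pM2l//.
  rewrite RintegralZl//; last first.
    have := (integrable_mkcond _ (mq k)).1 iA.
    by apply: eq_integrable => // x _ /=; rewrite !patchE; case: ifP.
  by rewrite -Rintegral_mkcond.
apply: (@le_trans _ _ ((2 * ((a k)^-1 * m)) `^ p * a k)).
  rewrite ler_pM2r// ge0_ler_powR ?nnegrE ?(ltW p0) ?normc_ge0//.
  by rewrite !mulr_ge0// invr_ge0.
rewrite powRM ?mulr_ge0 ?invr_ge0// -mulrA ler_pM2l ?powR_gt0//.
rewrite powRM ?invr_ge0// mulrAC.
apply: (@le_trans _ _ ((a k)^-1 `^ p * a k * (a k `^ (p - 1) * fine s))).
  by rewrite ler_wpM2l// mulr_ge0// powR_ge0.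
(* The exponents of [a k] are -p from averaging, 1 from the measure of the cell and p - 1 from
   Jensen. *)
rewrite mulrA; suff -> : (a k)^-1 `^ p * a k * a k `^ (p - 1) = 1 by rewrite mul1r.
rewrite -mulrA -[X in _ * (X * _)](powRr1 (a0 k)) -powRD; last by rewrite ak0 implybT.
rewrite addrC subrK -powRM ?invr_ge0//.
by rewrite mulVf// powR1.
Qed.

Lemma rnorm_cond_exp F : rnorm (cond_exp F) <= 2 * rnorm F.
Proof.
rewrite -lee_fin rnorm_LpE cLnorm_le ?mulr_ge0 ?rnorm_ge0//.
rewrite powRM ?rnorm_ge0// EFinM -[X in (_ * X)%E]poweR_EFin rnorm_LpE cLnorm_powR//.
have -> : cmass P p (Lp_fun (cond_exp F)) =
    (\sum_k (normc (pairing F (cell_weight k)) `^ p)%:E * P (A k))%E.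
  transitivity (\int[P]_x (\sum_k (normc (pairing F (cell_weight k)) `^ p)%:E *
      (\1_(A k) x)%:E))%E.
    apply: ae_eq_integral => //.
    - by apply: measurable_normcX; exact: cmeasurable_Lp_fun.
    - apply: emeasurable_sum => k; apply: measurable_funeM.
      by apply/measurable_EFinP; exact: measurable_indic (mq k).
    - apply: filterS (cond_exp_ae F) => x -> _.
      rewrite (bigD1 (q x))//= big1 => [|k /negP qk].
        by rewrite adde0 indicE mem_set//= mule1.
      by rewrite indicE memNset ?mule0//= => qx; apply: qk; exact/eqP.
  rewrite ge0_integral_sum//.
  - apply: eq_bigr => k _; rewrite ge0_integralZl ?lee_fin ?powR_ge0//.
    + by rewrite integral_indic ?setIT//; exact: mq.
    + by apply/measurable_EFinP; exact: measurable_indic (mq k).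
  - move=> k; apply: measurable_funeM.
    by apply/measurable_EFinP; exact: measurable_indic (mq k).
  - by move=> k x _; rewrite mule_ge0 ?lee_fin ?powR_ge0.
apply: (@le_trans _ _
  (\sum_k (2 `^ p)%:E * \int[P]_(x in A k) (normc (Lp_fun F x) `^ p)%:E)%E).
  by apply: lee_sum => k _; exact: cell_bound.
rewrite -ge0_sume_distrr; last first.
  by move=> k _; apply: integral_ge0 => x _; rewrite lee_fin powR_ge0.
rewrite le_eqVlt; apply/orP; left; apply/eqP; congr (_ * _)%E.
under eq_bigr do rewrite integral_mkcond.
rewrite -ge0_integral_sum//.
- apply: eq_integral => x _; rewrite (bigD1 (q x))//= big1 => [|k /negP qk].
    by rewrite adde0 patchE mem_set.
  by rewrite patchE memNset//= => qx; apply: qk; exact/eqP.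
- move=> k; apply/(measurable_restrictT _ (mq k)).
  apply: measurable_funTS.
  by apply: measurable_normcX; exact: cmeasurable_Lp_fun.
- by move=> k x _; rewrite patchE; case: ifP => // _; rewrite lee_fin powR_ge0.
Qed.

Lemma cond_exp_simple (c : I -> R[i]) (cL : c \o q \in cLfun P p) :
  cond_exp (mkLp p1 cL) = mkLp p1 cL.
Proof.
have pE k : pairing (mkLp p1 cL) (cell_weight k) = c k * ((a k)^-1 * a k)%:C%C.
  transitivity (cint P (fun x => (c k * (a k)^-1%:C%C) * \1_(A k) x)).
    apply: ae_eq_cint.
    - apply: cmeasurableM; first exact: cmeasurable_Lp_fun.
      by have [] := cbounded_cell_weight k.
    - apply: cmeasurableM; first exact: cmeasurable_cst.
      by have [] := cbounded_indic (R := R) (mq k).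
    apply: filterS (mkLpK p1 cL) => x ->; rewrite /cell_weight mulrA /= indicE.
    have [xk|xk] := boolP (x \in A k); last by rewrite !mulr0.
    by move: xk; rewrite inE => <-.
  have iA : P.-integrable setT (EFin \o (\1_(A k) : T -> R)).
    exact: integrable_indic (mq k).
  have indE : (\1_(A k) : T -> R[i]) = (fun x => (\1_(A k) x : R)%:C%C).
    by apply/funext => x; rewrite !indicE; case: (_ \in _).
  have i1 : cintegrable P (\1_(A k) : T -> R[i]).
    by rewrite indE; split => //=; exact: integrable0.
  rewrite cintZ// rmorphM mulrA; congr (_ * _).
  rewrite indE /cint /=; congr (_ +i* _)%C.
    by rewrite /Rintegral integral_indic ?setIT//; exact: mq.
  by rewrite /Rintegral integral0.
apply/LpP.
(* On a null cell the average is 0 instead of [c k], but almost no point lies in one. *)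
have h0 : {ae P, forall x, forall k, a k = 0 -> ~ A k x}.
  apply: ae_forall_fin => k; have [ak0|ak0] := eqVneq (a k) 0; last first.
    by apply: aeW => x /eqP; rewrite (negbTE ak0).
  exists (A k); split; [exact: mq|by rewrite -[LHS](aE k) ak0|].
  by move=> x /= /existsNP[_ /contrapT].
apply: filterS3 (cond_exp_ae (mkLp p1 cL)) (mkLpK p1 cL) h0 => x -> -> h.
rewrite pE mulVf ?mulr1//; apply/eqP => /h; exact.
Qed.

End partition.

Lemma joint_partition (L : seq Lp) (e : R) : 0 < e ->
  exists (I : finType) (q : T -> I), measurable_partition q /\
    forall F, F \in L -> exists c : I -> R[i],
      (cLnorm P p (Lp_fun F - (c \o q))%R <= e%:E)%E.
Proof.
move=> e0; elim: L => [|F L [I [q [mq h]]]].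
  exists unit, (fun=> tt); split => // k; rewrite (_ : _ @^-1` _ = setT)//.
  by apply/seteqP; split => // x _ /=; case: k.
have [J [r [b [mr hb]]]] := simple_approx_cLfun p1 (Lp_fun_cLfun F) e0.
exists (I * J)%type, (fun x => (q x, r x)); split.
  exact: measurable_partition_pair.
move=> G; rewrite in_cons => /predU1P[->|/h[c hc]].
  by exists (fun k => b k.2).
by exists (fun k => c k.1).
Qed.

Lemma cond_exp_approx (L : seq Lp) (e : R) : 0 < e ->
  exists (I : finType) (q : T -> I) (mq : measurable_partition q),
    forall F, F \in L -> rnorm (cond_exp mq F - F) <= e.
Proof.
(* With [S] constant on the cells and E S = S, the error E F - F = E (F - S) + (S - F) costs 2 e / 3
   + e / 3. *)
move=> e0; have [I [q [mq h]]] := joint_partition L (e := e / 3) ltac:(by rewrite divr_gt0).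
exists I, q, mq => F /h[c hc].
have cL := cbounded_cLfun P p1 (cbounded_partition c mq).
pose S := mkLp p1 cL.
have FS : rnorm (F - S) <= e / 3.
  rewrite -lee_fin rnorm_LpE (le_trans _ hc)// le_eqVlt; apply/orP; left; apply/eqP.
  apply: ae_eq_cLnorm => //.
  - exact: cmeasurable_Lp_fun.
  - apply: cmeasurableB; first exact: cmeasurable_Lp_fun.
    by have [] := cbounded_partition c mq.
  - by apply: filterS2 (Lp_funB F S) (mkLpK p1 cL) => x -> ->.
have ES : cond_exp mq S = S by exact: cond_exp_simple.
have -> : cond_exp mq F - F = cond_exp mq (F - S) + (S - F).
  have := finite_rank_lin (cell_indic mq) (cbounded_cell_weight mq) (-1) S F.
  rewrite scaleN1r [- S + F]addrC -/(cond_exp mq) => ->.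
  by rewrite -/(cond_exp mq S) ES scaleN1r addrACA addNr add0r.
rewrite (le_trans (rnormD _ _))//.
have := rnorm_cond_exp mq (F - S); rewrite (rnorm_distrC S); lra.
Qed.

End ConditionalExpectation.

(** * From convergence in L_p(mu^d) to convergence for the projective norm *)

Section InjectivityCriterion.
Context {disp} {T : measurableType disp} {R : realType}.
Context (P : probability T R) (p : R) (p1 : 1 <= p) (d : nat).
Local Notation Lp := (Lp P p1).
Local Notation LpB := ((fun _ : 'I_d => Lp : normedModType R[i])).
Local Notation LpW := (Defs.Lp (power_measure P d) p1).
Local Notation N := (proj_norm LpB).

Lemma seminorm_sum (V : lmodType R[i]) (M : seminorm V) (I : Type) (s : seq I)
  (x : I -> V) : M (\sum_(i <- s) x i) <= \sum_(i <- s) M (x i).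
Proof.
elim: s => [|i s IH]; first by rewrite !big_nil seminorm0.
by rewrite !big_cons (le_trans (seminormD _ _ _))// lerD.
Qed.

Context (j : {linear tensor LpB -> LpW}).
Hypothesis jE : forall f, j (elem_tensor f) = tensor_map f.

Let Nelem (f : 'I_d -> Lp) : N (elem_tensor (B := LpB) f) = \prod_(i < d) rnorm (f i).
Proof. exact: proj_norm_elem (cross_norm_ex jE) f. Qed.

(** Replace the factors one at a time: each replacement changes one factor by at most [e] and leaves
    d - 1 factors bounded by [K]. Since K >= 1, its cost is at most [e * K ^+ d]. *)
Lemma elem_tensor_dist (f f' : 'I_d -> Lp) (K e : R) : 1 <= K -> 0 <= e ->
  (forall i, rnorm (f i) <= K) -> (forall i, rnorm (f' i) <= K) ->
  (forall i, rnorm (f' i - f i) <= e) ->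
  N (elem_tensor (B := LpB) f' - elem_tensor (B := LpB) f) <= d%:R * (e * K ^+ d).
Proof.
move=> K1 e0 fK fK' ff'.
have K0 : 0 <= K by exact: le_trans K1.
suff h : forall s : seq 'I_d, uniq s ->
    N (elem_tensor (B := LpB) (fun i => if i \in s then f' i else f i) -
       elem_tensor (B := LpB) f) <= (size s)%:R * (e * K ^+ d).
  have := h _ (enum_uniq 'I_d); rewrite size_enum_ord; congr (N (elem_tensor _ - _) <= _).
  by apply/funext => i; rewrite mem_enum.
elim=> [_|i s IH]; first by rewrite mul0r subrr seminorm0.
rewrite cons_uniq => /andP[si us].
set h := (fun k => if k \in s then f' k else f k) in IH.
have hi : dfwith h i (f i) = h.
  apply/funext => k; rewrite dfwith_if; case: eqP => [->|//].
  by rewrite /h (negbTE si).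
have -> : (fun k => if k \in i :: s then f' k else f k) = dfwith h i (f' i).
  by apply/funext => k; rewrite dfwith_if in_cons; case: eqP => [->|].
have -> : elem_tensor (B := LpB) (dfwith h i (f' i)) =
    elem_tensor (B := LpB) (dfwith h i ((-1) *: f i + f' i)) + elem_tensor (B := LpB) h.
  by rewrite elem_tensor_multilinear hi scaleN1r addrAC addNr add0r.
rewrite -addrA (le_trans (seminormD _ _ _))//.
rewrite [size (i :: s)]/= -add1n natrD mulrDl mul1r lerD ?IH//.
rewrite Nelem scaleN1r addrC (bigD1 i)//= dfwith_if eqxx ler_pM ?rnorm_ge0//.
  by apply: prodr_ge0 => k _; exact: rnorm_ge0.
apply: (@le_trans _ _ (\prod_(k < d | k != i) K)).
  apply: ler_prod => k /negbTE ki; rewrite rnorm_ge0 dfwith_if ki /h /=.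
  by case: ifP => _; [exact: fK'|exact: fK].
rewrite prodr_const ler_weXn2l// -[leqRHS]card_ord.
exact: max_card.
Qed.

Section cond_exp_tensor.
Context {I : finType} (q : T -> I) (mq : measurable_partition q).
Context (Tt : {linear tensor LpB -> tensor LpB}).
Hypothesis TE : forall f, Tt (elem_tensor f) =
  elem_tensor (B := LpB) (fun i => cond_exp mq (f i)).

(** After division by [2 ^+ d] the left side is a seminorm dominated on elementary tensors, so
    [le_proj_norm] extends the bound to all tensors. *)
Lemma proj_norm_cond_exp u : N (Tt u) <= 2 ^+ d * N u.
Proof.
pose M u := 2 ^- d * N (Tt u).
have MD x y : M (x + y) <= M x + M y.
  by rewrite /M -mulrDr ler_wpM2l ?invr_ge0 ?exprn_ge0// linearD seminormD.
have MZ a x : M (a *: x) = normc a * M x.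
  by rewrite /M linearZ seminormZ mulrCA.
rewrite -ler_pdivrMl ?exprn_gt0//.
apply: (le_proj_norm (cross_norm_ex jE) (M := Seminorm MD MZ)) => f.
rewrite -[leLHS]/(M _) /M TE Nelem ler_pdivrMl ?exprn_gt0//.
rewrite -[X in 2 ^+ X]card_ord -prodr_const -big_split /=; apply: ler_prod => i _.
by rewrite rnorm_ge0 rnorm_cond_exp.
Qed.

(** [C] sums over multi-indices of cells and depends on the partition; it is used with the partition
    fixed and the sequence index going to infinity. *)
Lemma proj_norm_cond_exp_le : exists2 C, 0 <= C &
  forall u, N (Tt u) <= C * rnorm (j u).
Proof.
have bg := cbounded_cell_weight P mq.
have [ks hks] := tensor_finite_rankE bg jE TE.
have [M hM] := choice (prod_bound (d := d) bg).
have M0 k : 0 <= M k by exact: le_trans (normc_ge0 _) (hM k point).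
exists (\sum_(k <- ks) 2 * M k * N (elem_tensor (B := LpB) (fun i => cell_indic P p1 mq (k i)))).
  by apply: sumr_ge0 => k _; rewrite !mulr_ge0// seminorm_ge0.
move=> u; rewrite hks (le_trans (seminorm_sum _ _ _))// mulr_suml.
apply: ler_sum => k _; rewrite seminormZ mulrAC ler_wpM2r ?seminorm_ge0//.
apply: normc_pair_le => //.
by have [] := cbounded_prod bg k.
Qed.

End cond_exp_tensor.

(* The tensor powers of the conditional expectations on finite partitions are
   uniformly bounded for N and converge pointwise to the identity; being of
   finite rank, each of them is controlled by the norm of L_p(mu^d). *)
Lemma proj_norm_cvg0 (u : nat -> tensor LpB) : is_cauchy N u ->
  rnorm (j (u n)) @[n --> \oo] --> (0 : R) -> N (u n) @[n --> \oo] --> (0 : R).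
Proof.
move=> cu ju; apply/cvgrPdist_le => e e0.
have e4 : 0 < e / 4 by rewrite divr_gt0.
have e42 : 0 < e / 4 / 2 ^+ d by rewrite divr_gt0// exprn_gt0.
(* The tolerance allows for the factor [2 ^+ d] lost when [Tt] is applied to [u n0 - u n]. *)
have [n0 hn0] := cu _ e42.
pose s := dom (repr (u n0)).
pose L := [seq f i | f <- s, i <- enum 'I_d] : seq Lp.
(* Bounds the factors of [u n0] and also their conditional expectations, whence the 2; the 1 ensures
   the condition K >= 1 of [elem_tensor_dist]. *)
pose K := 1 + 2 * \sum_(F <- L) rnorm F.
have S0 (L' : seq Lp) : 0 <= \sum_(F <- L') rnorm F.
  by apply: sumr_ge0 => F _; exact: rnorm_ge0.
have K1 : 1 <= K by rewrite lerDl mulr_ge0.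
have LK F : F \in L -> 2 * rnorm F <= K.
  move=> FL; rewrite /K -[leLHS]add0r lerD// ler_pM2l//.
  rewrite (big_rem F)//= lerDl.
  exact: S0.
(* If every factor moves by at most delta, then [u n0] moves by at most C0 delta; hence the delta e
   / 4 / (C0 + 1) below. *)
pose C0 := \sum_(f <- s) normc (coeff f (repr (u n0))) * (d%:R * K ^+ d).
have C00 : 0 <= C0.
  apply: sumr_ge0 => f _; rewrite !mulr_ge0 ?normc_ge0// exprn_ge0//.
  exact: le_trans K1.
have dl0 : 0 < e / 4 / (C0 + 1) by rewrite divr_gt0// ltr_wpDl.
have [I [q [mq hq]]] := cond_exp_approx L dl0.
have [Tt TE] := tensor_finite_rank d (cell_indic P p1 mq) (cbounded_cell_weight P mq).
have Tu : N (Tt (u n0) - u n0) <= e / 4.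
  rewrite {1}(tensor_sumE (u n0)) [X in _ - X](tensor_sumE (u n0)) linear_sum -sumrB.
  rewrite (le_trans (seminorm_sum _ _ _))//.
  apply: (@le_trans _ _ (C0 * (e / 4 / (C0 + 1)))); last first.
    rewrite mulrA ler_pdivrMr ?ltr_wpDl// [leLHS]mulrC ler_wpM2l ?lerDl//.
    exact: ltW.
  rewrite /C0 mulr_suml big_seq [leRHS]big_seq; apply: ler_sum => f fs.
  rewrite linearZZ TE -scalerBr seminormZ -mulrA ler_wpM2l ?normc_ge0//.
  have fL i : (f i : Lp) \in L.
    by apply/allpairsP; exists (f, i) => /=; rewrite mem_enum.
  rewrite -[leRHS]mulrA (mulrC (K ^+ d)); apply: elem_tensor_dist => //.
  - exact: ltW.
  - move=> i; apply: le_trans (LK _ (fL i)).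
    by rewrite mulr2n mulrDl mul1r lerDl rnorm_ge0.
  - move=> i; apply: le_trans (LK _ (fL i)); exact: rnorm_cond_exp.
  - by move=> i; exact: hq.
have [C C_ge0 hC] := proj_norm_cond_exp_le TE.
have dC0 : 0 < e / 4 / (C + 1) by rewrite divr_gt0// ltr_wpDl.
have /cvgrPdist_le /(_ _ dC0) [n1 _ hn1] := ju.
exists (maxn n0 n1) => // n nn.
have /andP[n0n n1n] : (n0 <= n)%N && (n1 <= n)%N by rewrite -geq_max.
rewrite sub0r normrN ger0_norm ?seminorm_ge0//.
(* The four terms are bounded by the Cauchy property, the approximation at the fixed [u n0], the
   uniform bound on [Tt], and the control by [rnorm (j (u n))]. *)
have -> : u n = (u n - u n0) + ((u n0 - Tt (u n0)) + (Tt (u n0 - u n) + Tt (u n))).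
  by rewrite linearB /= subrK !subrK.
have h1 : N (u n - u n0) <= e / 4.
  rewrite ltW// (lt_le_trans (hn0 _ _ n0n (leqnn _)))//.
  rewrite ler_pdivrMr ?exprn_gt0// ler_peMr ?(ltW e4)//.
  by rewrite exprn_ege1// ler1n.
have h2 : N (u n0 - Tt (u n0)) <= e / 4 by rewrite seminorm_distrC.
have h3 : N (Tt (u n0 - u n)) <= e / 4.
  rewrite (le_trans (proj_norm_cond_exp TE _))// mulrC -ler_pdivlMr ?exprn_gt0//.
  by rewrite ltW// hn0.
have h4 : N (Tt (u n)) <= e / 4.
  rewrite (le_trans (hC _))//; have := hn1 _ n1n.
  rewrite sub0r normrN ger0_norm ?rnorm_ge0// => h.
  rewrite (@le_trans _ _ (C * (e / 4 / (C + 1))))//; first by rewrite ler_wpM2l.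
  rewrite mulrA ler_pdivrMr ?ltr_wpDl// [leLHS]mulrC ler_wpM2l ?lerDl//.
  exact: ltW.
rewrite (le_trans (seminormD _ _ _))// (_ : e = e / 4 + (e / 4 + (e / 4 + e / 4))); last by lra.
rewrite lerD// (le_trans (seminormD _ _ _))// lerD// (le_trans (seminormD _ _ _))//.
by rewrite lerD.
Qed.

End InjectivityCriterion.

(** * Density *)

Section DenseGenerators.
Context {disp} {T : measurableType disp} {R : realType}.
Context (P : probability T R) (p : R) (p1 : 1 <= p).
Local Notation Lp := (Lp P p1).

Let p0 : 0 < p. Proof. exact: lt_le_trans p1. Qed.

Lemma cmass_indic (A : set T) : measurable A ->
  cmass P p (\1_A : T -> R[i]) = P A.
Proof.
move=> mA; rewrite /cmass -[RHS]/(P A) -[in RHS](setIT A) -integral_indic//.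
apply: eq_integral => x _; rewrite !indicE; case: (_ \in _).
  by rewrite normc1 powR1.
by rewrite normc0 powR0// gt_eqF.
Qed.

Lemma mkLp_ext (f g : T -> R[i]) (fL : f \in cLfun P p) (gL : g \in cLfun P p) :
  f =1 g -> mkLp p1 fL = mkLp p1 gL.
Proof. by move=> fg; apply/mkLpP; exact: aeW. Qed.

(** An abstract closed subspace; it is later taken to be the closure of the range of [J]. *)
Context (S : Lp -> Prop).
Hypothesis S_lin : forall a F G, S F -> S G -> S (a *: F + G).
Hypothesis S_closed : forall F, (forall e, 0 < e -> exists2 G, S G & rnorm (F - G) <= e) -> S F.

Let Sset (A : set T) := forall gL : (\1_A : T -> R[i]) \in cLfun P p, S (mkLp p1 gL).

Let indL (A : set T) : measurable A -> (\1_A : T -> R[i]) \in cLfun P p.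
Proof. by move=> mA; exact: (cbounded_cLfun P p1 (cbounded_indic mA)). Qed.

Lemma closed_span_indic (B : set (set T)) : @measurable _ T = <<s B >> -> setI_closed B ->
  Sset setT -> (forall A, B A -> Sset A) -> forall A, measurable A -> Sset A.
Proof.
move=> BE BI ST SB A mA.
have subL (f g : T -> R[i]) (fL : f \in cLfun P p) (gL : g \in cLfun P p)
    (hL : (-1) *: f + g \in cLfun P p) : S (mkLp p1 fL) -> S (mkLp p1 gL) -> S (mkLp p1 hL).
  by move=> Sf Sg; rewrite (mkLp_lin fL gL); exact: S_lin.
apply: (@dynkin_induction _ T B Sset) => //; last by rewrite -BE.
- move=> E mE SE gL.
  have lL : (-1) *: (\1_E : T -> R[i]) + \1_setT \in cLfun P p.
    by rewrite rpredD ?rpredZ// indL.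
  rewrite (mkLp_ext gL lL); first exact: (subL _ _ (indL mE) (indL measurableT)).
  move=> x; rewrite !fctE !indicE in_setT in_setC.
  by case: (_ \in _); rewrite /= /GRing.scale /= ?mulr1 ?mulr0 ?addNr ?add0r.
- move=> F mF tF SF gL; apply: S_closed => e e0.
  (* Finite disjoint unions are reached by adding indicators, and the countable union is their limit
     by continuity of the measure. *)
  pose U n := \big[setU/set0]_(k < n) F k.
  have mU n : measurable (U n) by exact: bigsetU_measurable.
  have UE n : U n = \bigcup_(k < n) F k by rewrite /U bigcup_mkord.
  have mUF : measurable (\bigcup_k F k) by exact: bigcupT_measurable.
  have SU n : Sset (U n).
    elim: n => [|n IH] gnL.
      (* The zero function is written as a combination of indicators, because [S_lin] alone does not
         provide 0. *)
      have zL : (-1) *: (\1_setT : T -> R[i]) + \1_setT \in cLfun P p.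
        by rewrite rpredD ?rpredZ// indL.
      rewrite (mkLp_ext gnL zL); first exact: (subL _ _ (indL measurableT) (indL measurableT)).
      move=> x; rewrite !fctE /U big_ord0 !indicE in_set0 in_setT.
      by rewrite /GRing.scale /= mulr1 addNr.
    have lL : 1 *: (\1_(U n) : T -> R[i]) + \1_(F n) \in cLfun P p.
      by rewrite rpredD ?rpredZ// indL.
    rewrite (mkLp_ext gnL lL).
      rewrite (mkLp_lin (indL (mU n)) (indL (mF n))).
      by apply: S_lin; [exact: IH|exact: SF].
    move=> x; rewrite !fctE scale1r /U big_ord_recr /= -/(U n) !indicE in_setU.
    have [xU|xU] := boolP (x \in U n); have [xF|xF] := boolP (x \in F n);
      rewrite /= ?addr0 ?add0r//.
    move: xU xF; rewrite UE !inE => -[k /= kn Fkx] Fnx.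
    have := tF k n I I; move=> /(_ ltac:(by exists x)) kE.
    by rewrite kE ltnn in kn.
  have Ucvg : P (U n) @[n --> \oo] --> P (\bigcup_k F k).
    have -> : \bigcup_k F k = \bigcup_n U n.
      apply/seteqP; split => x [k _ xk].
        by exists k.+1 => //; rewrite UE; exists k => /=.
      by move: xk; rewrite UE => -[l _ xl]; exists l.
    apply: nondecreasing_cvg_mu => //.
      by rewrite -[X in measurable X](_ : \bigcup_n U n = _)//; exact: bigcupT_measurable.
    by move=> m n mn; rewrite subsetEset; exact: subset_bigsetU.
  have Pfin A' : measurable A' -> P A' \is a fin_num by exact: fin_num_measure.
  (* The norm of an indicator is the p-th root of the measure, so the remainder must have measure at
     most e^p. *)
  have ep0 : 0 < e `^ p by rewrite powR_gt0.
  move: Ucvg; rewrite -(fineK (Pfin _ mUF)).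
  move=> /fine_cvgP[_ /cvgrPdist_le /(_ _ ep0)] [n _ /(_ n (leqnn n)) /= hn].
  exists (mkLp p1 (indL (mU n))); first exact: SU.
  rewrite -lee_fin.
  have dL : (-1) *: (\1_(U n) : T -> R[i]) + \1_(\bigcup_k F k) \in cLfun P p.
    by rewrite rpredD ?rpredZ// indL.
  have mD : measurable (\bigcup_k F k `\` U n) by exact: measurableD.
  have -> : mkLp p1 gL - mkLp p1 (indL (mU n)) = mkLp p1 (indL mD).
    rewrite addrC -scaleN1r -(mkLp_lin _ _ dL); apply: mkLp_ext => x.
    rewrite !fctE !indicE in_setD /GRing.scale /= mulN1r.
    have [xU|xU] := boolP (x \in U n); last by rewrite andbT oppr0 add0r.
    rewrite andbF mem_set ?addNr//.
    by move: xU; rewrite UE inE => -[k _ xk]; exists k.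
  rewrite rnorm_mkLp cLnorm_le ?(ltW e0)// cmass_indic//.
  have UF : \bigcup_k F k `&` U n = U n.
    by apply/setIidr; rewrite UE; apply: bigcup_sub => k _; exact: bigcup_sup.
  have -> : P (\bigcup_k F k `\` U n) = (P (\bigcup_k F k) - P (U n))%E.
    by rewrite -[in RHS]UF; apply: measureD => //; rewrite ltey_eq Pfin.
  rewrite -(fineK (Pfin _ mUF)) -(fineK (Pfin _ (mU n))) -EFinB lee_fin.
  by rewrite (le_trans (ler_norm _)).
Qed.

Lemma closed_span_Lp : (forall A, measurable A -> Sset A) -> forall F, S F.
Proof.
move=> SA F; apply: S_closed => e e0.
have [I [q [c [mq qe]]]] := simple_approx_cLfun p1 (Lp_fun_cLfun F) e0.
have bc := cbounded_partition c mq.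
have cL := cbounded_cLfun P p1 bc.
exists (mkLp p1 cL); last first.
  rewrite -lee_fin rnorm_LpE (le_trans _ qe)// le_eqVlt; apply/orP; left; apply/eqP.
  apply: ae_eq_cLnorm => //; first exact: cmeasurable_Lp_fun.
    by apply: cmeasurableB; [exact: cmeasurable_Lp_fun|have [] := bc].
  by apply: filterS2 (Lp_funB F (mkLp p1 cL)) (mkLpK p1 cL) => x -> ->.
have S0 : S 0.
  have := S_lin (-1) (SA _ measurableT (indL measurableT)) (SA _ measurableT (indL measurableT)).
  by rewrite scaleN1r addNr.
have -> : mkLp p1 cL = \sum_k c k *: mkLp p1 (indL (mq k)).
  apply/LpP.
  have h1 := Lp_fun_sum (index_enum I) (fun k => c k *: mkLp p1 (indL (mq k))).
  have h2 : {ae P, forall x, forall k, Lp_fun (c k *: mkLp p1 (indL (mq k))) x =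
      c k * \1_(q @^-1` [set k]) x}.
    apply: ae_forall_fin => k.
    by apply: filterS2 (Lp_funZ (c k) (mkLp p1 (indL (mq k)))) (mkLpK p1 (indL (mq k)))
      => x -> ->.
  apply: filterS3 h1 h2 (mkLpK p1 cL) => x -> e2 ->.
  under eq_bigr do rewrite e2.
  rewrite (bigD1 (q x))//= big1 => [|k /negP qk].
    by rewrite addr0 indicE mem_set//= mulr1.
  by rewrite indicE memNset ?mulr0//= => qx; apply: qk; exact/eqP.
elim: (index_enum I) => [|k s IH]; first by rewrite big_nil.
by rewrite big_cons; apply: S_lin => //; exact: SA.
Qed.

End DenseGenerators.

Section TensorDense.
Context {disp} {T : measurableType disp} {R : realType}.
Context (P : probability T R) (p : R) (p1 : 1 <= p) (d : nat).

Definition boxes : set (set (d.-tuple T)) :=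
  [set B | exists2 A : 'I_d -> set T, forall i, measurable (A i) &
    B = [set x | forall i, A i (tnth x i)]].

Lemma boxes_setI : setI_closed boxes.
Proof.
move=> _ _ [A mA ->] [B mB ->]; exists (fun i => A i `&` B i).
  by move=> i; exact: measurableI.
apply/seteqP; split => x /= => [[h1 h2] i|h]; first by split; [exact: h1|exact: h2].
by split => i; have [] := h i.
Qed.

(** The product sigma-algebra is generated by cylinders over one coordinate, which are boxes with
    all other sides full. Boxes, unlike cylinders, are stable under intersection. *)
Lemma measurable_boxes : @measurable _ (d.-tuple T) = <<s boxes >>.
Proof.
apply/seteqP; split.
  apply: smallest_sub; first exact: smallest_sigma_algebra.
  elim/big_ind: _ => [//|A B hA hB|i _ B [C mC <-]]; first by rewrite subUset.
  apply: sub_gen_smallest; exists (fun j => if j == i then C else setT).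
    by move=> j; case: ifP.
  apply/seteqP; split => x /=.
    by move=> [_ xC] j; case: eqP => // ->.
  by move=> /(_ i); rewrite eqxx.
apply: smallest_sub; first exact: sigma_algebra_measurable.
move=> _ [A mA ->].
rewrite (_ : [set x | _] =
    \bigcap_(i in [set: 'I_d]) ((fun x : d.-tuple T => tnth x i) @^-1` A i)).
  apply: fin_bigcap_measurable => // i _.
  by rewrite -[X in measurable X]setTI; apply: measurable_tnth => //; exact: mA.
by apply/seteqP; split => x /= h i; [move=> _; exact: h|exact: h].
Qed.

Local Notation LpW := (Lp (power_measure P d) p1).

(** The indicator of a box is the tensor of the indicators of its sides, so [S] contains the
    generators required by Dynkin's theorem. *)
Lemma closed_span_tensor_map (S : LpW -> Prop) :
  (forall a F G, S F -> S G -> S (a *: F + G)) ->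
  (forall F, (forall e, 0 < e -> exists2 G, S G & rnorm (F - G) <= e) -> S F) ->
  (forall f : 'I_d -> Lp P p1, S (tensor_map f)) -> forall F, S F.
Proof.
move=> Sl Sc St.
have SB B : boxes B -> forall gL : (\1_B : d.-tuple T -> R[i]) \in cLfun _ p,
    S (mkLp p1 gL).
  move=> [A mA BE] gL.
  pose f i : Lp P p1 := mkLp p1 (cbounded_cLfun P p1 (cbounded_indic (R := R) (mA i))).
  suff -> : mkLp p1 gL = tensor_map f by exact: St.
  apply/mkLpP.
  have : {ae power_measure P d, forall x : d.-tuple T, forall i,
      Lp_fun (f i) (tnth x i) = \1_(A i) (tnth x i)}.
    apply: ae_forall_fin => i; have := mkLpK p1 (cbounded_cLfun P p1 (cbounded_indic (mA i))).
    exact: (@ae_tnth _ _ _ P d i (fun y => Lp_fun (f i) y = \1_(A i) y)).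
  apply: filterS => x h; rewrite /tensor_fun; under eq_bigr do rewrite h.
  rewrite indicE BE; have [|] := boolP (x \in _).
    by rewrite inE /= => xA; rewrite big1// => i _; rewrite indicE mem_set.
  rewrite notin_setE /= => /existsNP[i xi].
  by rewrite (bigD1 i)//= indicE memNset// mul0r.
apply: (closed_span_Lp Sl Sc); apply: (closed_span_indic Sl Sc measurable_boxes).
- exact: boxes_setI.
- apply: SB; exists (fun=> setT) => //.
  by apply/seteqP; split.
- exact: SB.
Qed.

End TensorDense.

(** * The diagonal map *)

Section Diagonal.
Context {disp} {T : measurableType disp} {R : realType}.
Context (P : probability T R) (d : nat) (d1 : (1 <= d)%N).
Context (p r : R) (p1 : 1 <= p) (r1 : 1 <= r) (dr : d%:R * r = p).
Local Notation Lp := (Lp P p1).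
Local Notation LpB := ((fun _ : 'I_d => Lp : normedModType R[i])).

Let p0 : 0 < p. Proof. exact: lt_le_trans p1. Qed.
Let r0 : 0 < r. Proof. exact: lt_le_trans r1. Qed.

Definition diag_fun (f : 'I_d -> Lp) (x : T) : R[i] := \prod_(i < d) Lp_fun (f i) x.

Lemma cmeasurable_diag_fun f : cmeasurable (diag_fun f).
Proof. by apply: cmeasurable_prod => i; exact: cmeasurable_Lp_fun. Qed.

Lemma cmass_Lp_fun (F : Lp) : cmass P p (Lp_fun F) = (rnorm F `^ p)%:E.
Proof. by rewrite -cLnorm_powR// -rnorm_LpE poweR_EFin. Qed.

(** Arithmetic and geometric means of the numbers t_i^p, which are the d-th powers of t_i^r because
    p = d r. *)
Lemma prod_powR_le_mean (t : 'I_d -> R) : (forall i, 0 <= t i) ->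
  \prod_(i < d) (t i `^ r) <= (\sum_(i < d) t i `^ p) / d%:R.
Proof.
move=> t0; have E0 : {in 'I_d, forall i, 0 <= t i `^ p} by move=> i _; exact: powR_ge0.
have := (leif_AGM E0).1; rewrite card_ord => h.
have pE i : t i `^ p = (t i `^ r) ^+ d.
  by rewrite -powR_mulrn ?powR_ge0// -powRrM mulrC dr.
rewrite -(ler_pXn2r d1) ?nnegrE.
- by rewrite -prodrXl; apply: le_trans h; under [leRHS]eq_bigr do rewrite pE.
- by apply: prodr_ge0 => i _; exact: powR_ge0.
- by rewrite divr_ge0// sumr_ge0// => i _; exact: powR_ge0.
Qed.

Lemma cLnorm_diag_fun f :
  (cLnorm P r (diag_fun f) <= (\prod_(i < d) rnorm (f i))%:E)%E.
Proof.
have N0 i : 0 <= rnorm (f i) by exact: rnorm_ge0.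
(* A factor of norm 0 cannot be normalised, but then the product vanishes almost everywhere. *)
have [[i /eqP fi0]|fn0] := pselect (exists i, rnorm (f i) == 0).
  rewrite (bigD1 i)//= fi0 mul0r le_eqVlt; apply/orP; left; apply/eqP.
  apply/(cLnorm_eq0P P r1 (cmeasurable_diag_fun f)).
  have : cLnorm P p (Lp_fun (f i)) = 0%E by rewrite -rnorm_LpE fi0.
  move=> /(cLnorm_eq0P P p1 (cmeasurable_Lp_fun (f i))); apply: filterS => x fx.
  by rewrite /diag_fun (bigD1 i)//= fx mul0r.
have Np i : 0 < rnorm (f i).
  by rewrite lt_neqAle eq_sym N0 andbT; apply/negP => fi; apply: fn0; exists i.
pose C := (\prod_(i < d) rnorm (f i)) `^ r.
(* The weights obtained from the mean inequality for the normalised |f_i| / ||f_i||, rescaled by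
   [C]; each term c_i |f_i|^p integrates to C / d. *)
pose c i := C / d%:R / rnorm (f i) `^ p.
have C0 : 0 <= C by exact: powR_ge0.
have c0 i : 0 <= c i by rewrite !divr_ge0// powR_ge0.
rewrite cLnorm_le//; last exact: prodr_ge0.
rewrite -/C.
apply: (@le_trans _ _ (\int[P]_x (\sum_(i < d) (c i)%:E * (normc (Lp_fun (f i) x) `^ p)%:E))%E).
  apply: ge0_le_integral => //.
  - by move=> x _; rewrite lee_fin powR_ge0.
  - by apply: measurable_normcX; exact: cmeasurable_diag_fun.
  - apply: emeasurable_sum => i; apply: measurable_funeM.
    by apply: measurable_normcX; exact: cmeasurable_Lp_fun.
  - move=> x _; under eq_bigr do rewrite -EFinM.
    rewrite sumEFin lee_fin /diag_fun normc_prod powR_prod; last first.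
      by move=> i; exact: normc_ge0.
    have := @prod_powR_le_mean (fun i => normc (Lp_fun (f i) x) / rnorm (f i)).
    move=> /(_ (fun i => divr_ge0 (normc_ge0 _) (N0 i))) h.
    have -> : \prod_(i < d) (normc (Lp_fun (f i) x) `^ r) =
        C * \prod_(i < d) ((normc (Lp_fun (f i) x) / rnorm (f i)) `^ r).
      rewrite /C powR_prod// -big_split; apply: eq_bigr => i _ /=.
      rewrite -powRM ?divr_ge0 ?normc_ge0//.
      by rewrite mulrCA divff ?mulr1// gt_eqF.
    apply: le_trans (ler_wpM2l C0 h) _.
    rewrite mulrA mulr_sumr mulr_suml; apply: ler_sum => i _.
    have vE : (rnorm (f i))^-1 `^ p = (rnorm (f i) `^ p)^-1.
      by rewrite -powR_inv1// powRAC powR_inv1 ?powR_ge0.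
    rewrite powRM ?normc_ge0 ?invr_ge0// vE /c le_eqVlt; apply/orP; left; apply/eqP.
    by ring.
rewrite ge0_integral_sum//.
- rewrite (eq_bigr (fun=> (C / d%:R)%:E)) => [|i _].
    rewrite sumEFin sumr_const card_ord lee_fin -(mulr_natr (C / d%:R)) divfK//.
    by rewrite pnatr_eq0 -lt0n.
  rewrite ge0_integralZl//; last 3 first.
  + by apply: measurable_normcX; exact: cmeasurable_Lp_fun.
  + by move=> x _; rewrite lee_fin powR_ge0.
  + by rewrite lee_fin.
  rewrite -/(cmass P p (Lp_fun (f i))) cmass_Lp_fun -EFinM /c mulfVK//.
  by rewrite gt_eqF// powR_gt0.
- move=> i; apply: measurable_funeM.
  by apply: measurable_normcX; exact: cmeasurable_Lp_fun.
- by move=> i x _; rewrite mule_ge0 ?lee_fin ?powR_ge0.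
Qed.

Lemma diag_fun_cLfun f : diag_fun f \in cLfun P r.
Proof.
apply/cLfunP; split; first exact: cmeasurable_diag_fun.
by rewrite (le_lt_trans (cLnorm_diag_fun f))// ltry.
Qed.

Definition diag_map (f : forall i, LpB i) : Defs.Lp P r1 := mkLp r1 (diag_fun_cLfun f).

Lemma diag_map_multilinear : multilinear diag_map.
Proof.
move=> f i a F G.
have hL : a *: diag_fun (dfwith f i F) + diag_fun (dfwith f i G) \in cLfun P r.
  by rewrite rpredD ?rpredZ// diag_fun_cLfun.
rewrite /diag_map -(mkLp_lin _ _ hL).
apply/mkLpP; apply: filterS (Lp_fun_lin a F G) => x h.
rewrite -[X in _ = X]/(a * diag_fun (dfwith f i F) x + diag_fun (dfwith f i G) x).
rewrite /diag_fun !(prod_dfwith f i _ (fun=> x)) h.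
by rewrite mulrDl mulrA.
Qed.

Lemma rnorm_diag_map f : rnorm (diag_map f) <= \prod_(i < d) rnorm (f i).
Proof. by rewrite -lee_fin rnorm_mkLp cLnorm_diag_fun. Qed.

Lemma diag_map_extension : exists D : {linear proj_tensor LpB -> Defs.Lp P r1},
  (forall f, D (elem_proj_tensor f) = diag_map f) /\ forall u, rnorm (D u) <= rnorm u.
Proof.
have [j jE] := tensor_lift (@tensor_map_multilinear _ _ _ P p p1 d).
have [D0 D0E] := tensor_lift diag_map_multilinear.
have D0le f : rnorm (D0 (elem_tensor f)) <= \prod_(i < d) rnorm (f i).
  by rewrite D0E rnorm_diag_map.
have [D [DE DC _]] := proj_tensor_extend (cross_norm_ex jE) (@Lp_complete _ _ _ P r r1) D0le.
by exists D; split => // f; rewrite DE D0E.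
Qed.

Let oneL q (q1 : 1 <= q) : (fun _ : T => 1 : R[i]) \in cLfun P q.
Proof. exact: (cbounded_cLfun P q1 (cbounded_cst 1)). Qed.

Lemma cLnorm_one q (q1 : 1 <= q) : cLnorm P q (fun=> 1 : R[i]) = 1%E.
Proof.
rewrite cLnormE// /cmass.
under eq_integral do rewrite normc1 powR1.
by rewrite integral_cst//= probability_setT mule1 poweR1r.
Qed.

Lemma op_norm_diag (D : {linear proj_tensor LpB -> Defs.Lp P r1}) :
  (forall f, D (elem_proj_tensor f) = diag_map f) ->
  (forall u, rnorm (D u) <= rnorm u) -> op_norm D = 1%E.
Proof.
move=> DE DC; apply/eqP; rewrite eq_le; apply/andP; split.
  apply: ge_ereal_sup => _ [u /= u1 <-]; rewrite lee_fin.
  exact: le_trans (DC u) u1.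
have [j jE] := tensor_lift (@tensor_map_multilinear _ _ _ P p p1 d).
(* The norm is attained at the tensor of constant functions 1, which has norm 1 on both sides as [P]
   is a probability. *)
pose one : Lp := mkLp p1 (oneL p1).
have one1 : rnorm one = 1.
  by apply: EFin_inj; rewrite rnorm_mkLp cLnorm_one.
pose f : forall i, LpB i := fun=> one.
apply: ereal_sup_ubound; exists (elem_proj_tensor f) => /=.
  rewrite /rnorm norm_to_completion.
  rewrite -[leLHS]/(proj_norm LpB (elem_tensor f)) (proj_norm_elem (cross_norm_ex jE)).
  by rewrite big1.
rewrite DE rnorm_mkLp -(cLnorm_one r1); apply: ae_eq_cLnorm => //.
- exact: cmeasurable_diag_fun.
- apply: filterS (mkLpK p1 (oneL p1)) => x h.
  by rewrite /diag_fun big1// => i _; rewrite /f h.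
Qed.

End Diagonal.

(** * The embedding into L_p(mu^d) and the density of its range *)

Section Embedding.
Context {disp} {T : measurableType disp} {R : realType}.
Context (P : probability T R) (d : nat) (p : R) (p1 : 1 <= p).
Local Notation Lp := (Lp P p1).
Local Notation LpB := ((fun _ : 'I_d => Lp : normedModType R[i])).
Local Notation LpW := (Defs.Lp (power_measure P d) p1).

Lemma tensor_map_extension : exists J : {linear proj_tensor LpB -> LpW},
  [/\ forall f, J (elem_proj_tensor f) = tensor_map f,
      forall u, rnorm (J u) <= rnorm u & injective J].
Proof.
have [j jE] := tensor_lift (@tensor_map_multilinear _ _ _ P p p1 d).
have jle f : rnorm (j (elem_tensor f)) <= \prod_(i < d) rnorm (f i).
  by rewrite jE rnorm_tensor_map.
have [J [JE JC Ji]] := proj_tensor_extend (cross_norm_ex jE)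
  (@Lp_complete _ _ _ (power_measure P d) p p1) jle.
exists J; split => // [f|]; first by rewrite JE jE.
by apply: Ji => u; exact: proj_norm_cvg0.
Qed.

Lemma dense_range_tensor_map (J : {linear proj_tensor LpB -> LpW}) :
  (forall f, J (elem_proj_tensor f) = tensor_map f) -> dense (range J).
Proof.
move=> JE.
(* The elements approximable from the range form a closed subspace containing all [tensor_map f]. *)
have JA : forall F : LpW, forall e, 0 < e -> exists u, rnorm (F - J u) <= e.
  apply: closed_span_tensor_map => [a F G SF SG e e0|F h e e0|f e e0].
  - have a0 : 0 < normc a + 1 by rewrite ltr_wpDl// normc_ge0.
    have [u hu] := SF (e / 2 / (normc a + 1)) ltac:(by rewrite !divr_gt0).
    have [v hv] := SG (e / 2) ltac:(by rewrite divr_gt0).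
    exists (a *: u + v); rewrite linearP opprD addrACA -scalerBr.
    rewrite (le_trans (rnormD _ _))// [leRHS]splitr lerD// rnormZ.
    rewrite (le_trans (ler_wpM2l (normc_ge0 a) hu))//.
    rewrite mulrA ler_pdivrMr// [leLHS]mulrC ler_wpM2l ?lerDl//.
    by rewrite divr_ge0// ltW.
  - have e20 : 0 < e / 2 by rewrite divr_gt0.
    have [G SG FG] := h _ e20; have [u hu] := SG _ e20.
    exists u; rewrite -(subrK G F) -addrA (le_trans (rnormD _ _))//.
    by rewrite [leRHS]splitr lerD.
  - by exists (elem_proj_tensor f); rewrite JE subrr rnorm0 ltW.
move=> O [F OF] oO.
have : nbhs F O by exact: open_nbhs_nbhs.
move=> /nbhs_ballP[e /= e0 FO].
(* Radii of balls in a normed space over [R[i]] are positive elements of [R[i]], hence real. *)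
have eR : e = (complex.Re e)%:C%C by rewrite RRe_real// gtr0_real.
have {}e0 : 0 < complex.Re e by move: e0; rewrite {1}eR ltcR.
have [u hu] := JA F (complex.Re e / 2) ltac:(by rewrite divr_gt0).
exists (J u); split; last by exists u.
apply: FO; rewrite -ball_normE /ball_ /= rnormE eR ltcR.
by rewrite (le_lt_trans hu)// ltr_pdivrMr// ltr_pMr// ltr1n.
Qed.

End Embedding.

Theorem mainTheorem1 (R : realType) (disp : measure_display)
    (X : measurableType disp) (mu : probability X R)
    (mu_standard : standard_probability mu)
    (d : nat) (d1 : (1 <= d)%N)
    (p r : R) (p1 : 1 <= p) (r1 : 1 <= r) (dr : d%:R * r = p) :
  (exists J : {linear proj_tensor (fun _ : 'I_d => Lp mu p1 : normedModType R[i])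
                 -> Lp (power_measure mu d) p1},
    [/\ forall f : 'I_d -> Lp mu p1,
          {ae power_measure mu d, forall x : d.-tuple X,
             Lp_fun (J (elem_proj_tensor f)) x =
             \prod_(i < d) Lp_fun (f i) (tnth x i)},
        forall u, `|J u| <= `|u|,
        injective J &
        dense (range J)]) /\
  (exists D : {linear proj_tensor (fun _ : 'I_d => Lp mu p1 : normedModType R[i])
                 -> Lp mu r1},
    (forall f : 'I_d -> Lp mu p1,
       {ae mu, forall x : X,
          Lp_fun (D (elem_proj_tensor f)) x = \prod_(i < d) Lp_fun (f i) x}) /\
    op_norm D = 1%E).
Proof.
split.
  have [J [JE JC Ji]] := tensor_map_extension mu d p1.
  exists J; split => //; last exact: dense_range_tensor_map.
    by move=> f; rewrite JE; exact: mkLpK.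
  by move=> u; rewrite !rnormE lecR.
have [D [DE DC]] := diag_map_extension mu d1 p1 r1 dr.
exists D; split; last exact: op_norm_diag DE DC.
by move=> f; rewrite DE; exact: mkLpK.
Qed.
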